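(* Let $(R,\mathfrak m)$ be a commutative Noetherian local ring which is not Gorenstein, with $\mathfrak m^3=(0)$ but $\mathfrak m^2\neq(0)$. Assume that $R$ contains a field $k$ isomorphic to $R/\mathfrak m$ (via the natural map $k\subseteq R\to R/\mathfrak m$). Let $r=\dim_k \mathrm{Hom}_R(k,R)$ be the type of $R$. Assume that there is a finitely generated nonfree $R$-module of G-dimension zero. Then the following hold. (1) $R$ has a natural structure of a homogeneous graded ring $R=R_0\oplus R_1\oplus R_2$ with $R_0=k$, $\dim_k R_1=r+1$ and $\dim_k R_2=r$. In particular, the Hilbert series of $R$ is $H_R(t)=(1+t)(1+rt)$, and $(0:_R\mathfrak m)=\mathfrak m^2$. (2) Under this graded structure, $R$ is a Koszul algebra whose Poincaré series is $$P_R(t)=\frac{1}{(1-t)(1-rt)}.$$ (3) The Bass series of $R$ is $$B_R(t)=\frac{r-t}{1-rt}.$$ (4) Every finitely generated $R$-module $M$ of G-dimension zero has a natural structure of a graded $R$-module (with respect to the grading of $R$ in (1)). If $M$ has no free summand, then $M$ has only two graded pieces, $M=M_0\oplus M_1$, where, putting $b=\dim_k M_0$, the number $b$ is equal to the minimal number of generators of $M$ and $\dim_k M_1=rb$; in particular the length of the $R$-module $M$ is $\ell_R(M)=b(1+r)$. Furthermore, such an $M$ has a graded free resolution of the form $$\cdots\to R(-n-1)^b\to R(-n)^b\to\cdots\to R(-1)^b\to R^b\to M\to 0.$$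
   Context: All modules are finitely generated. A finitely generated $R$-module $M$ has G-dimension zero if: (i) the natural map $M\to \mathrm{Hom}_R(\mathrm{Hom}_R(M,R),R)$ is an isomorphism; (ii) $\mathrm{Ext}^i_R(M,R)=0$ for all $i>0$; (iii) $\mathrm{Ext}^i_R(\mathrm{Hom}_R(M,R),R)=0$ for all $i>0$. In the formula for $r$, and in $\mathrm{Ext}$ and $\mathrm{Tor}$, $k$ is regarded as the $R$-module $R/\mathfrak m$. A homogeneous graded ring (over $k$) is a nonnegatively graded ring with degree-zero part $k$ which is generated as a $k$-algebra by finitely many elements of degree one. For a graded module $M$ with finite-dimensional pieces, its Hilbert series is $H_M(t)=\sum_i (\dim_k M_i)t^i$. The Poincaré series is $P_R(t)=\sum_{i\ge0}\dim_k\mathrm{Tor}_i^R(k,k)\,t^i$ and the Bass series is $B_R(t)=\sum_{i\geq 0}\dim_k\mathrm{Ext}^i_R(k,R)\,t^i$. The homogeneous graded ring $R$ is a Koszul algebra if $\mathrm{Tor}_i^R(k,k)_j=0$ for all $i\neq j$, where the subscript $j$ denotes the degree-$j$ piece of the internal grading. $R(-n)$ denotes the graded module with $R(-n)_i=R_{i-n}$. *)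

(* Defs.v *)
From HB Require Import structures.
From mathcomp Require Export all_boot all_order all_algebra.
From mathcomp Require Export boolp classical_sets functions cardinality fsbigop.

Set Implicit Arguments.
Unset Strict Implicit.
Unset Printing Implicit Defensive.

Import GRing.Theory.

Local Open Scope ring_scope.
Local Open Scope classical_set_scope.
Local Open Scope quotient_scope.

Section HomModule.
Variables (R : comNzRingType) (U V : lmodType R).
Implicit Types f g h : {linear U -> V}.

HB.instance Definition _ := gen_eqMixin {linear U -> V}.
HB.instance Definition _ := gen_choiceMixin {linear U -> V}.

Lemma linear_ext f g : f =1 g -> f = g.
Proof.
case: f g => [f cf] [g cg] /= fg.
have {}fg : f = g by apply/funext.
case: _ / fg cg => cg; congr GRing.Linear.Pack.
case: cf cg => [[f1] [f2]] [[g1] [g2]].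
by rewrite (Prop_irrelevance f1 g1) (Prop_irrelevance f2 g2).
Qed.

Definition hom_zero : {linear U -> V} := \0.
Definition hom_opp f : {linear U -> V} := \- f.
Definition hom_add f g : {linear U -> V} := f \+ g.
Definition hom_scale (a : R) f : {linear U -> V} := a \*: f.

Lemma hom_addA : associative hom_add.
Proof. by move=> f g h; apply: linear_ext => x /=; rewrite addrA. Qed.
Lemma hom_addC : commutative hom_add.
Proof. by move=> f g; apply: linear_ext => x /=; rewrite addrC. Qed.
Lemma hom_add0 : left_id hom_zero hom_add.
Proof. by move=> f; apply: linear_ext => x /=; rewrite add0r. Qed.
Lemma hom_addN : left_inverse hom_zero hom_opp hom_add.
Proof. by move=> f; apply: linear_ext => x /=; rewrite addNr. Qed.

HB.instance Definition _ := GRing.isZmodule.Build {linear U -> V}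
  hom_addA hom_addC hom_add0 hom_addN.

Lemma hom_scaleA a b f : hom_scale a (hom_scale b f) = hom_scale (a * b) f.
Proof. by apply: linear_ext => x /=; rewrite scalerA. Qed.
Lemma hom_scale1 : left_id 1 hom_scale.
Proof. by move=> f; apply: linear_ext => x /=; rewrite scale1r. Qed.
Lemma hom_scaleDr : right_distributive hom_scale +%R.
Proof. by move=> a f g; apply: linear_ext => x /=; rewrite scalerDr. Qed.
Lemma hom_scaleDl f : {morph hom_scale^~ f : a b / a + b}.
Proof. by move=> a b; apply: linear_ext => x /=; rewrite scalerDl. Qed.

HB.instance Definition _ := GRing.Zmodule_isLmodule.Build R {linear U -> V}
  hom_scaleA hom_scale1 hom_scaleDr hom_scaleDl.

End HomModule.

Section QuotientModule.
Variables (R : comNzRingType) (I : idealr R).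

Definition iquot_scale (a : R) (x : {ideal_quot I}) : {ideal_quot I} :=
  \pi_({ideal_quot I}) a * x.

Lemma iquot_scaleA a b x :
  iquot_scale a (iquot_scale b x) = iquot_scale (a * b) x.
Proof. by rewrite /iquot_scale -[x]reprK !piE mulrA. Qed.
Lemma iquot_scale1 : left_id 1 iquot_scale.
Proof. by move=> x; rewrite /iquot_scale -[x]reprK !piE mul1r. Qed.
Lemma iquot_scaleDr : right_distributive iquot_scale +%R.
Proof. by move=> a x y; rewrite /iquot_scale mulrDr. Qed.
Lemma iquot_scaleDl x : {morph iquot_scale^~ x : a b / a + b}.
Proof. by move=> a b; rewrite /iquot_scale -[x]reprK !piE mulrDl. Qed.

HB.instance Definition _ := GRing.Zmodule_isLmodule.Build R {ideal_quot I}
  iquot_scaleA iquot_scale1 iquot_scaleDr iquot_scaleDl.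

End QuotientModule.

Section Rings.
Variable R : comNzRingType.

(* [idealr R] is the type of proper ideals of [R]. *)
Definition maximal_ideal (I : idealr R) : Prop :=
  forall J : idealr R, {subset I <= J} -> J =i I.

Definition local_ring (m : idealr R) : Prop :=
  maximal_ideal m /\ forall J : idealr R, maximal_ideal J -> J =i m.

(* The improper ideal is generated by 1, so proper ideals suffice. *)
Definition noetherian : Prop :=
  forall I : idealr R, exists (n : nat) (g : 'I_n -> R),
    forall x, x \in I <-> exists c : 'rV[R]_n, x = \sum_i c 0 i * g i.

Definition ideal_mul (I J : set R) : set R :=
  [set z | exists (n : nat) (x y : 'I_n -> R),
     (forall i, I (x i) /\ J (y i)) /\ z = \sum_i x i * y i].

Definition ideal_pow (I : set R) (n : nat) : set R := iter n (ideal_mul I) setT.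

Definition annihilator (I : set R) : set R :=
  [set x | forall y, I y -> x * y = 0].

End Rings.

Section Modules.
Variable R : comNzRingType.
Implicit Types M N E : lmodType R.

Definition generated_by M (n : nat) : Prop :=
  exists g : 'I_n -> M, forall x, exists c : 'rV[R]_n, x = \sum_i c 0 i *: g i.

Definition fin_gen M : Prop := exists n, generated_by M n.

Definition min_gens M (b : nat) : Prop :=
  generated_by M b /\ forall n, generated_by M n -> (b <= n)%N.

(* Free of finite rank, i.e. free among finitely generated modules. *)
Definition free_module M : Prop :=
  exists (n : nat) (f : {linear 'rV[R]_n -> M}), bijective f.

Definition has_free_summand M : Prop :=
  exists (N : lmodType R) (f : {linear M -> (R^o * N)%type}), bijective f.

Definition is_submodule M (S : set M) : Prop :=
  S 0 /\ forall (a : R) x y, S x -> S y -> S (a *: x + y).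

(* The length of a composition series, well defined by Jordan-Hoelder. *)
Definition has_length M (n : nat) : Prop :=
  exists c : nat -> set M,
    [/\ c 0%N = [set 0], c n = setT, forall i, (i <= n)%N -> is_submodule (c i)
      & forall i, (i < n)%N -> c i `<` c i.+1 /\
          forall S, is_submodule S -> c i `<=` S -> S `<=` c i.+1 ->
            S = c i \/ S = c i.+1].

Definition injective_module E : Prop :=
  forall (A B : lmodType R) (i : {linear A -> B}) (f : {linear A -> E}),
    injective i -> exists g : {linear B -> E}, forall x, g (i x) = f x.

(* A finite injective resolution 0 -> N -> E 0 -> ... -> E n -> 0. *)
Definition finite_injective_dimension N : Prop :=
  exists (n : nat) (E : nat -> lmodType R) (eta : {linear N -> E 0%N})
         (d : forall i, {linear E i -> E i.+1}),
    [/\ forall i, injective_module (E i),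
        forall i, (n < i)%N -> forall x : E i, x = 0,
        injective eta,
        range eta = [set x | d 0%N x = 0]
      & forall i, range (d i) = [set x | d i.+1 x = 0]].

End Modules.

(* The definition for a Noetherian local ring: finite self-injective dimension. *)
Definition gorenstein (R : comNzRingType) : Prop :=
  finite_injective_dimension R^o.

(* [kdim iota Z B n] : dim_k (Z / B) = n, where B <= Z are k-subspaces of an
   R-module regarded as a k-vector space through iota : k -> R. *)
Definition kdim (K : fieldType) (R : comNzRingType) (iota : {rmorphism K -> R})
    (N : lmodType R) (Z B : set N) (n : nat) : Prop :=
  exists e : 'I_n -> N, (forall i, Z (e i)) /\
    forall z, Z z -> exists! c : 'rV[K]_n, B (z - \sum_i iota (c 0 i) *: e i).

(* A sequence of maps  ... -> R^(rk 2) -> R^(rk 1) -> R^(rk 0);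
   the n-th map is v |-> v *m diff n on row vectors.  Over a Noetherian ring
   every finitely generated module is resolved by such a sequence. *)
Record free_complex (R : comNzRingType) := FreeComplex {
  rk : nat -> nat;
  diff : forall n, 'M[R]_(rk n.+1, rk n) }.

Section ExtTor.
Variable R : comNzRingType.
Implicit Types (F : free_complex R) (M N : lmodType R).

Definition is_resolution F M (eps : {linear 'rV[R]_(rk F 0) -> M}) : Prop :=
  [/\ range eps = setT,
      [set v | eps v = 0] = range (fun w : 'rV_(rk F 1) => w *m diff F 0)
    & forall n, [set v : 'rV_(rk F n.+1) | v *m diff F n = 0] =
                range (fun w : 'rV_(rk F n.+2) => w *m diff F n.+1)].

Definition resolves F M : Prop :=
  exists eps : {linear 'rV[R]_(rk F 0) -> M}, is_resolution eps.

(* Kernels and images in the complex Hom_R(F, N), whose cohomology is Ext. *)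
Definition hom_cocycles F N (n : nat) : set {linear 'rV[R]_(rk F n) -> N} :=
  [set f | forall v, f (v *m diff F n) = 0].

Definition hom_coboundaries F N (n : nat) : set {linear 'rV[R]_(rk F n) -> N} :=
  match n return set {linear 'rV[R]_(rk F n) -> N} with
  | 0 => [set 0]
  | n'.+1 => [set f | exists g : {linear 'rV[R]_(rk F n') -> N},
                        forall v, f v = g (v *m diff F n')]
  end.

Arguments hom_cocycles : clear implicits.
Arguments hom_coboundaries : clear implicits.

(* Ext and Tor are computed from some resolution of M by finite free modules;
   by the comparison theorem the result does not depend on it. *)
Definition Ext_zero (n : nat) M N : Prop :=
  exists F, resolves F M /\ hom_cocycles F N n `<=` hom_coboundaries F N n.

(* The complex F (x) N, with R^b (x) N identified with N^b. *)
Definition tens_diff F N (n : nat) (w : {ffun 'I_(rk F n.+1) -> N}) :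
    {ffun 'I_(rk F n) -> N} :=
  [ffun j => \sum_l diff F n l j *: w l].

Arguments tens_diff : clear implicits.

Definition tens_cycles F N (n : nat) : set {ffun 'I_(rk F n) -> N} :=
  match n return set {ffun 'I_(rk F n) -> N} with
  | 0 => setT
  | n'.+1 => [set w | tens_diff F N n' w = 0]
  end.

Definition tens_boundaries F N (n : nat) : set {ffun 'I_(rk F n) -> N} :=
  range (tens_diff F N n).

Arguments tens_cycles : clear implicits.
Arguments tens_boundaries : clear implicits.

Variables (K : fieldType) (iota : {rmorphism K -> R}).

Definition Ext_dim (n : nat) M N (e : nat) : Prop :=
  exists F, resolves F M /\
    kdim iota (hom_cocycles F N n) (hom_coboundaries F N n) e.

Definition Tor_dim (n : nat) M N (e : nat) : Prop :=
  exists F, resolves F M /\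
    kdim iota (tens_cycles F N n) (tens_boundaries F N n) e.

End ExtTor.

Arguments hom_cocycles {R} F N n.
Arguments hom_coboundaries {R} F N n.
Arguments tens_diff {R} F N n w.
Arguments tens_cycles {R} F N n.
Arguments tens_boundaries {R} F N n.

Definition dual (R : comNzRingType) (M : lmodType R) : lmodType R :=
  {linear M -> R^o}.

Section Biduality.
Variables (R : comNzRingType) (M : lmodType R).

Definition eval_at (x : M) (f : dual M) : R^o := f x.

Lemma eval_at_is_linear x : linear (eval_at x).
Proof. by []. Qed.

HB.instance Definition _ x :=
  GRing.isLinear.Build R (dual M) R^o *:%R (eval_at x) (eval_at_is_linear x).

Definition biduality (x : M) : dual (dual M) := eval_at x : {linear _ -> _}.

End Biduality.

Definition G_dim_zero (R : comNzRingType) (M : lmodType R) : Prop :=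
  [/\ bijective (@biduality R M),
      forall i, (0 < i)%N -> Ext_zero i M R^o
    & forall i, (0 < i)%N -> Ext_zero i (dual M) R^o].

Definition is_subgroup (V : zmodType) (S : set V) : Prop :=
  S 0 /\ forall x y, S x -> S y -> S (x - y).

Definition is_direct_sum (I : choiceType) (V : zmodType) (D : I -> set V) :
    Prop :=
  forall x, exists! f : I -> V,
    [/\ forall i, D i (f i), finite_set [set i | f i != 0]
      & x = \sum_(i \in [set: I]) f i].

Section Gradings.
Variable R : comNzRingType.
Implicit Types (G : nat -> set R) (M N : lmodType R).

Definition ring_grading G : Prop :=
  [/\ forall i, is_subgroup (G i), is_direct_sum G, G 0%N 1
    & forall i j x y, G i x -> G j y -> G (i + j)%N (x * y)].

Definition homogeneous_grading (K : fieldType) (iota : {rmorphism K -> R}) G :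
    Prop :=
  [/\ ring_grading G, G 0%N = range iota
    & exists (n : nat) (x : 'I_n -> R), (forall i, G 1%N (x i)) /\
        forall S : {pred R}, subring_closed S ->
          (forall c, iota c \in S) -> (forall i, x i \in S) ->
          forall y, y \in S].

(* The pieces of R indexed by all integers. *)
Definition zpiece G (i : int) : set R :=
  match i with Posz n => G n | Negz _ => [set 0] end.

Definition module_grading G M (D : int -> set M) : Prop :=
  [/\ forall i, is_subgroup (D i), is_direct_sum D
    & forall (i : nat) (j : int) a x, G i a -> D j x -> D (i%:Z + j) (a *: x)].

(* Degree i piece of the graded free module  \bigoplus_l R(- s l). *)
Definition free_piece G (b : nat) (s : 'I_b -> int) (i : int) : set 'rV[R]_b :=
  [set v | forall l, zpiece G (i - s l) (v 0 l)].

(* The shifts s give F n the grading of  \bigoplus_l R(- s n l). *)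
Definition is_graded_resolution G (F : free_complex R)
    (s : forall n, 'I_(rk F n) -> int) M (D : int -> set M)
    (eps : {linear 'rV[R]_(rk F 0) -> M}) : Prop :=
  [/\ is_resolution eps,
      forall n i v, free_piece G (s n.+1) i v ->
        free_piece G (s n) i (v *m diff F n)
    & forall i v, free_piece G (s 0%N) i v -> D i (eps v)].

(* Tor_n(M, N)_j = 0, M and N being graded by D and D'. *)
Definition Tor_piece_zero G (n : nat) (j : int) M (D : int -> set M)
    N (D' : int -> set N) : Prop :=
  exists (F : free_complex R) (s : forall n, 'I_(rk F n) -> int)
         (eps : {linear 'rV[R]_(rk F 0) -> M}),
    is_graded_resolution G s D eps /\
    let piece n := [set w : {ffun 'I_(rk F n) -> N} |
                     forall l, D' (j - s n l) (w l)] in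
    tens_cycles F N n `&` piece n `<=` tens_diff F N n @` piece n.+1.

Definition degree0_grading M (i : int) : set M :=
  if i == 0 then setT else [set 0].

Definition koszul G (m : idealr R) : Prop :=
  forall (i : nat) (j : int), j != i%:Z ->
    Tor_piece_zero G i j (@degree0_grading {ideal_quot m})
                         (@degree0_grading {ideal_quot m}).

End Gradings.

(* The series \sum_n a_n t^n equals p / q in Z[[t]]; q has constant term 1. *)
Definition series_is_frac (a : nat -> nat) (p q : {poly int}) : Prop :=
  q`_0 = 1 /\ forall n, \sum_(i < n.+1) (a i)%:Z * q`_(n - i) = p`_n.

(* Main.v *)
(* Let F be a minimal free resolution of a nonfree M with Ext^i(M, R) = 0 for i > 0; it is exact
   and so is its dual.  As R is not self-injective, k is not a direct summand of a syzygy, and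
   this forces Soc(R)F_n = Soc(F_{n+1} -> F_n) = m im(F_{n+1} -> F_n); hence Soc(R) = m^2 and the
   strands 0 -> F_{n+1}/m -> mF_n/m^2 -> m^2F_{n-1} -> 0 are exact.  With e = dim m/m^2 this gives
   b_{n+1} + r b_{n-1} = e b_n, and dually b_{n-1} + r b_{n+1} = e b_n; since r >= 2 the ranks are
   constant and e = r + 1.

   The matrices of F may then be replaced by their linear parts D.  Multiplication by D, exact in
   both directions, is played against successive linear syzygies of k: if A_n has entries in R_1
   and A_{n+1} spans its linear syzygies, every tuple in R_2 is D_i Y A_n with Y over k, so the A_n
   form a linear resolution of k.  This gives the Koszul property and the Poincare series.  The
   same argument applied to E = Hom_k(R, k), followed by balancing Tor(k, E), gives the Bass
   series.  A module of G-dimension zero without free summand is killed by m^2, and splicing its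
   resolution with that of its dual puts it in the middle of such a complex. *)
From HB Require Import structures.
Require Import Defs.
From mathcomp Require Import zify ring.

Set Implicit Arguments.
Unset Strict Implicit.
Unset Printing Implicit Defensive.

Import GRing.Theory.

Local Open Scope ring_scope.
Local Open Scope classical_set_scope.
Local Open Scope quotient_scope.

(** Koszulness alone does not give the Bass series. Ext(k, R) is read off the transpose of the
    linear resolution A of k, and one must know that a degree-one column killed by A_{n+1} is A_n
    times a column over k. A violation is detected by a functional on tuples in m/m^2. Since Soc(R)
    = m^2, such a functional is multiplication by a matrix X over R_1 followed by a trace form on
    tuples in m^2, whose zeros are the degree-two relations of E. Thus X is a cycle of A tensored
    with E, and the balancing chase along a linear complex over E shows that the functional vanishes
    on the offending column. The same pairing gives r >= 2: for r = 1 it would make m/m^2 self-dual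
    and every map m -> R a multiplication. The failure of self-injectivity is used as Ext^1(k, R) <>
    0; Baer's criterion, testing only on m because m^3 = 0, links it to the Gorenstein property. No
    derived functor or quotient of a complex is formed: matrices act on rows, Hom into R is
    transposition, and dimensions belong to pairs B <= Z of subspaces. *)

Section LinearSubspaces.
Variable K : fieldType.

(** The rows of A are independent, lie in S and are as many as possible; a vector of S outside their
    span could be appended. *)
Lemma rV_subspace n (S : set 'rV[K]_n) :
  S 0 -> (forall a x y, S x -> S y -> S (a *: x + y)) ->
  exists (a : nat) (A : 'M[K]_(a, n)),
    row_free A /\ forall v, S v <-> (v <= A)%MS.
Proof.
move=> S0 SD.
have Ssub p (A : 'M[K]_(p, n)) : (forall i, S (row i A)) ->
    forall v : 'rV_n, (v <= A)%MS -> S v.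
  move=> SA v /submxP [c ->]; rewrite mulmx_sum_row.
  apply: (big_ind S) => // [x y Sx Sy|i _]; first by rewrite -[x]scale1r; apply: SD.
  by rewrite -[_ *: _]addr0; apply: SD.
pose P a := `[< exists A : 'M[K]_(a, n), row_free A /\ forall i, S (row i A) >].
have exP : exists a, P a.
  exists 0%N; apply/asboolP; exists 0; split; last by case.
  by rewrite /row_free mxrank0.
have leP a : P a -> (a <= n)%N.
  by move=> /asboolP [A [/eqP fA _]]; rewrite -[X in (X <= _)%N]fA rank_leq_col.
case: (ex_maxnP exP leP) => a /asboolP [A [fA SA]] amax.
exists a, A; split=> // v; split=> [Sv|]; last exact: Ssub.
apply: contrapT => nvA.
suff /amax : P (1 + a)%N by rewrite add1n ltnn.
apply/asboolP; exists (col_mx v A); split; last first.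
  move=> i; case: (@split_ordP 1 a i) => j ->; first by rewrite rowKu row_id.
  by rewrite rowKd.
rewrite /row_free eqn_leq rank_leq_row [X in (X <= _)%N]add1n.
rewrite -addsmxE -[X in (X < _)%N](eqP fA).
have : (A < v + A)%MS.
  rewrite ltmxE addsmxSr /=; apply/negP => h; apply: nvA.
  by apply: submx_trans h; apply: addsmxSl.
by rewrite ltmxErank => /andP [].
Qed.

End LinearSubspaces.

(** * Dimensions of subquotients over the residue field *)

Section KDim.
Variables (K : fieldType) (R : comNzRingType) (iota : {rmorphism K -> R}).
Implicit Types N : lmodType R.

(** Only scalars from k are allowed, so that complements such as V below, which are not ideals, are
    treated like submodules. *)
Definition ksub N (Z : set N) : Prop :=
  Z 0 /\ forall c x y, Z x -> Z y -> Z (iota c *: x + y).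

Definition kcomb N n (e : 'I_n -> N) (c : 'rV[K]_n) : N :=
  \sum_i iota (c 0 i) *: e i.

Definition klinear N N' (f : N -> N') : Prop :=
  forall c x y, f (iota c *: x + y) = iota c *: f x + f y.

Section Subspaces.
Variables (N : lmodType R) (Z : set N).
Hypothesis kZ : ksub Z.

Lemma ksub0 : Z 0. Proof. by case: kZ. Qed.

Lemma ksubZ c x : Z x -> Z (iota c *: x).
Proof. by move=> Zx; rewrite -[_ *: _]addr0; apply: kZ.2 => //; apply: ksub0. Qed.

Lemma ksubD x y : Z x -> Z y -> Z (x + y).
Proof. by move=> Zx Zy; rewrite -[x]scale1r -(rmorph1 iota); apply: kZ.2. Qed.

Lemma ksubN x : Z x -> Z (- x).
Proof. by move=> Zx; rewrite -scaleN1r -(rmorphN1 iota); apply: ksubZ. Qed.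

Lemma ksubB x y : Z x -> Z y -> Z (x - y).
Proof. by move=> Zx Zy; apply: ksubD => //; apply: ksubN. Qed.

Lemma ksub_sum (I : Type) (s : seq I) (P : pred I) (F : I -> N) :
  (forall i, P i -> Z (F i)) -> Z (\sum_(i <- s | P i) F i).
Proof.
by move=> ZF; apply: big_ind => //; [apply: ksub0 | apply: ksubD].
Qed.

Lemma ksub_kcomb n (e : 'I_n -> N) c : (forall i, Z (e i)) -> Z (kcomb e c).
Proof. by move=> Ze; apply: ksub_sum => i _; apply: ksubZ. Qed.

Lemma ksub_eqD x y : Z (x - y) -> Z x <-> Z y.
Proof.
move=> Zxy; split=> [Zx|Zy].
  by rewrite -[y](subKr x); apply: ksubB.
by rewrite -[x](subrK y); apply: ksubD.
Qed.

End Subspaces.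

Lemma ksub_set0 N : ksub [set (0 : N)].
Proof. by split=> // c x y -> ->; rewrite scaler0 addr0. Qed.

Lemma ksubT N : ksub [set: N].
Proof. by []. Qed.

Lemma ksubI N (Y Z : set N) : ksub Y -> ksub Z -> ksub (Y `&` Z).
Proof.
move=> kY kZ; split=> [|c x y [Yx Zx] [Yy Zy]]; first by split; apply: ksub0.
by split; [apply: kY.2 | apply: kZ.2].
Qed.

Section KLinear.
Variables (N N' : lmodType R) (f : N -> N').
Hypothesis lf : klinear f.

Lemma klin0 : f 0 = 0.
Proof.
have := lf 1 0 0; rewrite rmorph1 !scale1r addr0.
by move/(congr1 (fun x => x - f 0)); rewrite addrK subrr.
Qed.

Lemma klinD x y : f (x + y) = f x + f y.
Proof. by have := lf 1 x y; rewrite rmorph1 !scale1r. Qed.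

Lemma klinZ c x : f (iota c *: x) = iota c *: f x.
Proof. by rewrite -[_ *: x]addr0 lf klin0 addr0. Qed.

Lemma klinB x y : f (x - y) = f x - f y.
Proof.
by rewrite -[- y]scaleN1r -(rmorphN1 iota) klinD klinZ rmorphN1 scaleN1r.
Qed.

Lemma klin_kcomb n (e : 'I_n -> N) c : f (kcomb e c) = kcomb (fun i => f (e i)) c.
Proof.
rewrite /kcomb; elim/big_rec2: _ => [|i x y _ <-]; first exact: klin0.
by rewrite klinD klinZ.
Qed.

Lemma ksub_image Z : ksub Z -> ksub (f @` Z).
Proof.
move=> kZ; split; first by exists 0; [apply: ksub0 | apply: klin0].
move=> c _ _ [x Zx <-] [y Zy <-]; exists (iota c *: x + y); last exact: lf.
exact: kZ.2.
Qed.

Lemma ksub_preimage Z : ksub Z -> ksub (f @^-1` Z).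
Proof.
move=> kZ; split; first by rewrite /preimage /= klin0; apply: ksub0.
by move=> c x y Zx Zy; rewrite /preimage /= lf; apply: kZ.2.
Qed.

End KLinear.

Lemma kcombD N n (e : 'I_n -> N) a c d :
  kcomb e (a *: c + d) = iota a *: kcomb e c + kcomb e d.
Proof.
rewrite /kcomb scaler_sumr -big_split; apply: eq_bigr => i _ /=.
by rewrite !mxE rmorphD rmorphM scalerDl scalerA.
Qed.

Lemma kcomb0 N n (e : 'I_n -> N) : kcomb e 0 = 0.
Proof. by rewrite /kcomb big1 // => i _; rewrite mxE rmorph0 scale0r. Qed.

Lemma kcombB N n (e : 'I_n -> N) c d : kcomb e (c - d) = kcomb e c - kcomb e d.
Proof.
rewrite -[- d]scaleN1r addrC kcombD rmorphN1 scaleN1r addrC //.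
Qed.

Lemma kcomb_delta N n (e : 'I_n -> N) i : kcomb e (delta_mx 0 i) = e i.
Proof.
rewrite /kcomb (bigD1 i) //= mxE !eqxx rmorph1 scale1r big1 ?addr0 // => j ji.
by rewrite mxE eqxx (negPf ji) rmorph0 scale0r.
Qed.

Lemma kcomb_mul N n p (e : 'I_n -> N) (A : 'M[K]_(p, n)) c :
  kcomb e (c *m A) = kcomb (fun i => kcomb e (row i A)) c.
Proof.
rewrite /kcomb; under [RHS]eq_bigr do rewrite scaler_sumr.
rewrite exchange_big; apply: eq_bigr => i _ /=.
rewrite mxE rmorph_sum scaler_suml; apply: eq_bigr => j _.
by rewrite mxE rmorphM scalerA.
Qed.

(** The row space of A consists of the relations among the e_i modulo Y, so a basis of a complement
    C of it yields a basis of Z modulo Y. *)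
Lemma kdim_span N (Z Y : set N) n a (e : 'I_n -> N) (A : 'M[K]_(a, n)) :
  ksub Z -> ksub Y -> (forall i, Z (e i)) ->
  (forall z, Z z -> exists c, Y (z - kcomb e c)) ->
  row_free A -> (forall c, Y (kcomb e c) <-> (c <= A)%MS) ->
  kdim iota Z Y (n - a).
Proof.
move=> kZ kY Ze span fA YA.
have fC : row_free (row_base A^C%MS) by apply: row_base_free.
move: (row_base A^C%MS) fC (eq_row_base A^C%MS).
rewrite mxrank_compl (eqP fA) => C fC eqC.
exists (fun i => kcomb e (row i C)); split=> [i|z Zz].
  exact: ksub_kcomb.
have [c Yc] := span z Zz.
have : (c <= A + C)%MS.
  apply: submx_trans (submx1 _) _.
  by rewrite (adds_eqmx (eqmx_refl A) eqC) sub1mx addsmx_compl_full.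
case/sub_addsmxP => [[d1 d2]] /= cE; exists d2; split=> [|d' Yd'].
  rewrite -[X in _ - X]/(kcomb (fun i => kcomb e (row i C)) d2) -kcomb_mul.
  rewrite -(subrKA (kcomb e c)); apply: (ksubD kY) => //.
  by rewrite -kcombB cE addrK; apply/YA; apply: submxMl.
move: Yd'; rewrite -[X in _ - X]/(kcomb (fun i => kcomb e (row i C)) d').
rewrite -kcomb_mul => Yd'.
have /YA : Y (kcomb e (d' *m C - c)).
  by rewrite kcombB -[X in Y X](subrKA z) addrC -opprB; apply: ksubB.
rewrite cE opprD addrA addrAC -mulmxBl => h.
have {}h : ((d' - d2) *m C <= A)%MS.
  rewrite -[X in (X <= _)%MS](subrK (d1 *m A)); apply: addmx_sub => //.
  exact: submxMl.
have : ((d' - d2) *m C <= A :&: A^C)%MS.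
  by rewrite sub_capmx h -eqC submxMl.
rewrite capmx_compl submx0 mulmx_free_eq0 // subr_eq0 => /eqP -> //.
Qed.

Lemma kspan_kdim N (Z Y : set N) (T : finType) (g : T -> N) :
  ksub Z -> ksub Y -> (forall i, Z (g i)) ->
  (forall z, Z z -> exists c : T -> K, Y (z - \sum_t iota (c t) *: g t)) ->
  exists2 n, (n <= #|T|)%N & kdim iota Z Y n.
Proof.
move=> kZ kY Zg span; pose e (i : 'I_#|T|) := g (enum_val i).
have [||a [A [fA SA]]] := @rV_subspace K #|T| [set c | Y (kcomb e c)].
- by rewrite /= kcomb0; apply: ksub0.
- by move=> a x y /=; rewrite kcombD; apply: kY.2.
exists (#|T| - a)%N; first exact: leq_subr.
apply: (kdim_span kZ kY _ _ fA SA) => // [i|z /span [c Yc]]; first exact: Zg.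
exists (\row_i c (enum_val i)); rewrite (_ : kcomb _ _ = \sum_t iota (c t) *: g t) //.
rewrite /kcomb (reindex (@enum_val T (mem T))) /=.
  by apply: eq_bigr => i _; rewrite mxE.
by exists enum_rank => x _; [apply: enum_valK | apply: enum_rankK].
Qed.

(** As [kdim] is a relation, the existence of both dimensions is part of the claim: the coordinate
    vectors of elements of Y form a subspace of k^n, whose dimension is a. The rank counts below
    start from here. *)
Lemma kdim_sub N (Z Y B : set N) n :
  ksub Z -> ksub Y -> ksub B -> B `<=` Y -> Y `<=` Z -> kdim iota Z B n ->
  exists a d, [/\ (a + d)%N = n, kdim iota Y B a & kdim iota Z Y d].
Proof.
move=> kZ kY kB BY YZ [e [Ze eP]].
have [||a [A [fA SA]]] := @rV_subspace K n [set c | Y (kcomb e c)].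
- by rewrite /= kcomb0; apply: ksub0.
- by move=> a x y /=; rewrite kcombD; apply: kY.2.
exists a, (n - a)%N; split; first by rewrite subnKC // -(eqP fA) rank_leq_col.
  exists (fun i => kcomb e (row i A)); split=> [i|y Yy].
    by apply/SA; apply: row_sub.
  have [c [Bc cu]] := eP y (YZ _ Yy).
  have /SA /submxP [d cE] : Y (kcomb e c).
    by rewrite -[kcomb e c](subKr y); apply: ksubB => //; apply: BY.
  exists d; split=> [|d' Bd'].
    by rewrite -[X in B (_ - X)]/(kcomb (fun i => kcomb e (row i A)) d) -kcomb_mul -cE.
  have := cu (d' *m A); rewrite [in X in X -> _]/= -[X in B (_ - X) -> _]/(kcomb e _).
  rewrite kcomb_mul => /(_ Bd'); rewrite cE => /(row_free_inj fA) //.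
apply: (kdim_span kZ kY Ze _ fA SA) => z /eP [c [Bc _]].
by exists c; apply: BY.
Qed.

Lemma kdim_coord N (Z B : set N) n (e : 'I_n -> N) :
  ksub Z -> ksub B ->
  (forall i, Z (e i)) ->
  (forall z, Z z -> exists! c : 'rV[K]_n, B (z - \sum_i iota (c 0 i) *: e i)) ->
  exists co : N -> 'rV[K]_n,
    [/\ forall z c, Z z -> B (z - kcomb e c) <-> c = co z,
        forall a x y, Z x -> Z y -> co (iota a *: x + y) = a *: co x + co y
      & forall z, Z z -> B z <-> co z = 0].
Proof.
move=> kZ kB Ze eP.
have /choice [co coP] : forall z, exists c, Z z -> forall d, B (z - kcomb e d) <-> d = c.
  move=> z; case: (pselect (Z z)) => [/eP [c [Bc cu]]|nZ]; last by exists 0.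
  by exists c => _ d; split=> [/cu //|->].
exists co; split=> [z c Zz|a x y Zx Zy|z Zz]; first exact: coP.
  apply/esym/coP; first exact: kZ.2.
  rewrite kcombD opprD addrACA -scalerBr; apply: kB.2.
    by apply/coP.
  by apply/coP.
by rewrite -{1}[z]subr0 -(kcomb0 e); split=> [/(coP z Zz) <- //|h]; apply/coP.
Qed.

Lemma kdim_functional N (Z B : set N) n z :
  ksub Z -> ksub B -> kdim iota Z B n -> Z z -> ~ B z ->
  exists chi : N -> K,
    [/\ forall a x y, Z x -> Z y -> chi (iota a *: x + y) = a * chi x + chi y,
        forall x, B x -> Z x -> chi x = 0 & chi z = 1].
Proof.
move=> kZ kB [e [Ze eP]] Zz nBz.
have [co [coE coD co0]] := kdim_coord kZ kB Ze eP.
have /rV0Pn [i ci] : co z != 0 by apply/eqP => /(co0 z Zz).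
(* Some coordinate of z modulo B is nonzero; chi is this coordinate, rescaled. *)
exists (fun x => co x 0 i / co z 0 i); split=> [a x y Zx Zy|x Bx Zx|].
- by rewrite coD // !mxE mulrDl mulrA.
- by have /co0 -> := Bx; rewrite ?mxE ?mul0r.
- by rewrite divff.
Qed.

(** The matrix of coordinates of a spanning family has rank n, hence at least n rows. *)
Lemma kdim_le_span N (Z B : set N) n p (g : 'I_p -> N) :
  ksub Z -> ksub B -> kdim iota Z B n -> (forall i, Z (g i)) ->
  (forall z, Z z -> exists c, B (z - kcomb g c)) -> (n <= p)%N.
Proof.
move=> kZ kB [e [Ze eP]] Zg span.
have [co [coE coD co0]] := kdim_coord kZ kB Ze eP.
pose G := \matrix_(i < p) co (g i).
have coG c : co (kcomb g c) = c *m G.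
  rewrite mulmx_sum_row /kcomb.
  have h (s : seq 'I_p) : Z (\sum_(i <- s) iota (c 0 i) *: g i) /\
     co (\sum_(i <- s) iota (c 0 i) *: g i) = \sum_(i <- s) c 0 i *: row i G.
    elim: s => [|i s [Zs IH]].
      rewrite !big_nil; split; first exact: ksub0.
      by apply/co0; apply: ksub0.
    rewrite !big_cons; split; first exact: kZ.2.
    by rewrite coD // IH rowK.
  exact: (h _).2.
have /eqP fG : row_full G.
  rewrite -sub1mx; apply/row_subP => i; rewrite row1.
  have [c Bc] := span _ (Ze i).
  have ei : co (e i) = delta_mx 0 i.
    by apply/esym/coE => //; rewrite kcomb_delta subrr; apply: ksub0.
  have Zc : Z (kcomb g c) by apply: ksub_kcomb.
  have : co (kcomb g c) = co (e i).
    have : co (e i - kcomb g c) = 0 by apply/co0 => //; apply: ksubB.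
    rewrite addrC -scaleN1r -(rmorphN1 iota) coD // scaleN1r => /eqP.
    by rewrite addrC subr_eq0 => /eqP ->.
  by rewrite coG ei => <-; apply: submxMl.
by rewrite -[X in (X <= _)%N]fG rank_leq_row.
Qed.

Lemma kdim_uniq N (Z B : set N) n n' :
  ksub Z -> ksub B -> kdim iota Z B n -> kdim iota Z B n' -> n = n'.
Proof.
move=> kZ kB d d'; apply/eqP; rewrite eqn_leq; apply/andP; split.
  by case: d' => e [Ze eP]; apply: (kdim_le_span kZ kB d Ze) => z /eP [c []]; exists c.
by case: d => e [Ze eP]; apply: (kdim_le_span kZ kB d' Ze) => z /eP [c []]; exists c.
Qed.

Lemma kdim_add N (Z Y B : set N) a d :
  ksub Z -> ksub Y -> ksub B -> B `<=` Y -> Y `<=` Z ->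
  kdim iota Y B a -> kdim iota Z Y d -> kdim iota Z B (a + d).
Proof.
move=> kZ kY kB BY YZ [e [Ye eP]] [g [Zg gP]].
pose h (i : 'I_(a + d)) := match fintype.split i with inl j => e j | inr j => g j end.
have hE c : kcomb h c = kcomb e (lsubmx c) + kcomb g (rsubmx c).
  rewrite /kcomb big_split_ord; congr (_ + _); apply: eq_bigr => i _ /=.
    by rewrite mxE /h -[lshift d i]/(unsplit (inl i)) unsplitK.
  by rewrite mxE /h -[rshift a i]/(unsplit (inr i)) unsplitK.
exists h; split=> [i|z Zz].
  by rewrite /h; case: fintype.split => j; [apply: YZ | apply: Zg].
have [c [Yc cu]] := gP z Zz; have [c' [Bc' cu']] := eP _ Yc.
exists (row_mx c' c); split=> [|v].
  rewrite -[X in B (_ - X)]/(kcomb h _) hE row_mxKl row_mxKr.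
  by rewrite [kcomb e _ + _]addrC opprD addrA.
rewrite -[X in B (_ - X) -> _]/(kcomb h _) hE => Bv.
have Yv : Y (z - kcomb g (rsubmx v)).
  rewrite -[z](subrK (kcomb e (lsubmx v) + kcomb g (rsubmx v))) addrA addrK.
  by apply: (ksubD kY); [apply: BY | apply: ksub_kcomb].
have vE := cu _ Yv; rewrite -[v]hsubmxK -vE; congr row_mx.
apply: cu'; rewrite -[X in B (_ - X - _)]/(kcomb g c) vE.
by rewrite -addrA -opprD [X in - X]addrC.
Qed.

(** The first isomorphism theorem for subquotients: f identifies Z/B with Z'/B' when it is onto and
    B is the preimage of B' in Z. *)
Lemma kdim_map N N' (f : N -> N') (Z B : set N) (Z' B' : set N') n :
  klinear f -> ksub B' ->
  (forall z, Z z -> Z' (f z)) -> (forall z', Z' z' -> exists2 z, Z z & f z = z') ->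
  (forall z, Z z -> B z <-> B' (f z)) -> ksub Z ->
  kdim iota Z B n <-> kdim iota Z' B' n.
Proof.
move=> lf kB' ZZ' sZ BB' kZ; split=> [[e [Ze eP]]|[e [Ze eP]]].
  exists (fun i => f (e i)); split=> [i|_ /sZ [z Zz <-]]; first exact: ZZ'.
  have [c [Bc cu]] := eP z Zz; exists c.
  have E d : B' (f z - kcomb (fun i => f (e i)) d) <-> B (z - kcomb e d).
    rewrite -(klin_kcomb lf) -(klinB lf); apply: iff_sym; apply: BB'.
    by apply: ksubB => //; apply: ksub_kcomb.
  by split=> [|d /E]; [apply/E | apply: cu].
have /choice [g gP] : forall i, exists x, Z x /\ f x = e i.
  by move=> i; have [x] := sZ _ (Ze i); exists x.
exists g; split=> [i|z Zz]; first by case: (gP i).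
have E d : B' (f z - kcomb e d) <-> B (z - kcomb g d).
  have -> : kcomb e d = f (kcomb g d).
    by rewrite (klin_kcomb lf); apply: eq_bigr => i _; case: (gP i) => _ ->.
  rewrite -(klinB lf); apply: iff_sym; apply: BB'.
  by apply: ksubB => //; apply: ksub_kcomb => // i; case: (gP i).
have [c [Bc cu]] := eP _ (ZZ' _ Zz).
by exists c; split=> [|d /E]; [apply/E | apply: cu].
Qed.

Lemma kdim_triv N (Z : set N) : ksub Z -> kdim iota Z Z 0.
Proof.
move=> kZ; exists (fun=> 0); split=> [[]//|z Zz]; exists 0; split; last first.
  by move=> c _; apply/rowP; case.
by rewrite big_ord0 subr0.
Qed.

Lemma kdim0_eq N (Z B : set N) : kdim iota Z B 0 -> Z `<=` B.
Proof. by case=> e [_ eP] z /eP [c []]; rewrite big_ord0 subr0. Qed.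

Lemma kdim_ext N (Z Z' B B' : set N) n n' : 
  (forall z, Z z <-> Z' z) -> (forall z, B z <-> B' z) -> n = n' ->
  kdim iota Z B n -> kdim iota Z' B' n'.
Proof. by move=> /predeqP -> /predeqP -> ->. Qed.

End KDim.

Arguments kdim_map {K R iota N N' f Z B Z' B' n}.
Arguments kcomb {K R} iota {N n} e c.
Arguments ksub {K R} iota {N} Z.
Arguments klinear {K R} iota {N N'} f.

(** * Matrices with entries in a subspace of R *)

Section Entries.
Variables (K : fieldType) (R : comNzRingType) (iota : {rmorphism K -> R}).
Implicit Types Z B : set R.

Definition entries Z p q : set 'M[R]_(p, q) := [set A | forall i j, Z (A i j)].

Arguments entries Z {p q} _.

Definition ksubR Z := @ksub K R iota R^o Z.

Lemma ksub_entries Z p q : ksubR Z -> ksub iota (@entries Z p q).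
Proof.
move=> kZ; split=> [i j|c x y Zx Zy i j]; first by rewrite mxE; apply: (ksub0 kZ).
by rewrite !mxE; apply: kZ.2.
Qed.

Arguments ksub_entries {Z p q} _.

(** Induction through the rows whose first coordinate lies in B: dropping this coordinate identifies
    them, modulo B, with rows of length p, and the first coordinate identifies the remaining
    quotient with Z/B. *)
Lemma kdim_rows Z B n p : ksubR Z -> ksubR B -> B `<=` Z ->
  @kdim K R iota R^o Z B n ->
  kdim iota (@entries Z 1 p) (@entries B 1 p) (p * n).
Proof.
move=> kZ kB BZ d; elim: p => [|p IH].
  apply: (kdim_ext _ _ _ (kdim_triv (ksubT iota 'rV[R]_0))) => // z.
    by split=> // _ i [].
  by split=> // _ i [].
have kZp q := @ksub_entries Z 1 q kZ; have kBp q := @ksub_entries B 1 q kB.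
pose Y : set 'rV[R]_p.+1 := [set v | entries Z v /\ B (v 0 ord0)].
have kY : ksub iota Y.
  split; first by split; [apply: ksub0 | rewrite mxE; apply: (ksub0 kB)].
  move=> c x y [Zx Bx] [Zy By]; split; first exact: (kZp _).2.
  by rewrite !mxE; apply: kB.2.
have BY : @entries B 1 p.+1 `<=` Y.
  by move=> v Bv; split=> // i j; apply: BZ; apply: Bv.
rewrite mulSn addnC; apply: (kdim_add _ kY (kBp _) BY) => //; first by move=> v [].
- have lf : klinear iota (fun v : 'rV[R]_p.+1 => \row_(j < p) v 0 (lift ord0 j)).
    by move=> c x y; apply/rowP => j; rewrite !mxE.
  apply: (proj2 (kdim_map lf (kBp p) _ _ _ kY) IH).
  + by move=> v [Zv _] i j; rewrite mxE; apply: Zv.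
  + move=> v Zv; pose u : 'rV[R]_p.+1 := \row_j oapp (v 0) 0 (unlift ord0 j).
    exists u; last by apply/rowP => j; rewrite !mxE liftK.
    split=> [i j|]; last by rewrite mxE unlift_none; apply: (ksub0 kB).
    by rewrite mxE; case: unliftP => [l _|_] /=; [apply: Zv | apply: (ksub0 kZ)].
  + move=> v [Zv Bv]; split=> [h i j|h i j]; first by rewrite mxE; apply: h.
    rewrite (ord1 i); case: (unliftP ord0 j) => [l ->|-> //].
    by have := h 0 l; rewrite mxE.
- have lf : klinear iota (fun v : 'rV[R]_p.+1 => v 0 ord0 : R^o).
    by move=> c x y; rewrite !mxE.
  apply: (proj2 (kdim_map lf kB _ _ _ (kZp _)) d) => [v|x Zx|v Zv].
  + exact.
  + by exists (const_mx x) => [i j|]; rewrite mxE.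
  + by split=> [[]|] // Bv; split.
Qed.

Lemma kdim_rows0 Z n p : ksubR Z -> @kdim K R iota R^o Z [set 0] n ->
  kdim iota (@entries Z 1 p) [set 0] (p * n).
Proof.
move=> kZ dZ; have Z0 : [set 0] `<=` Z by move=> _ ->; apply: (ksub0 kZ).
apply: kdim_ext (kdim_rows p kZ (ksub_set0 iota R^o) Z0 dZ) => // v.
split=> [v0|-> i j]; last by rewrite mxE.
by apply/matrixP => i j; rewrite mxE; apply: v0.
Qed.

Lemma kdim_tr (Z B : set R) p q n : ksubR Z -> ksubR B ->
  kdim iota (@entries Z p q) (@entries B p q) n ->
  kdim iota (@entries Z q p) (@entries B q p) n.
Proof.
move=> kZ kB.
have lf : klinear iota (fun v : 'M[R]_(p, q) => v^T).
  by move=> c x y; rewrite linearP.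
move=> h.
apply: (proj1 (kdim_map lf (ksub_entries kB) _ _ _ (ksub_entries kZ)) h) => v.
- by move=> Zv i j; rewrite mxE; apply: Zv.
- by move=> Zv; exists v^T => [i j|]; rewrite ?trmxK // mxE; apply: Zv.
- move=> Zv; split=> Bv i j; first by rewrite mxE; apply: Bv.
  by rewrite -[v]trmxK mxE; apply: Bv.
Qed.

End Entries.

Arguments entries {R} Z {p q} _.
Arguments ksubR {K R} iota Z.
Arguments ksub_entries {K R iota Z p q} _.

(** * Exactness and socles over a local ring with m^3 = 0 *)

Lemma entries_mul (R : comNzRingType) (X Y Z : set R) p q s
    (A : 'M[R]_(p, q)) (B : 'M[R]_(q, s)) :
  Z 0 -> (forall x y, Z x -> Z y -> Z (x + y)) ->
  (forall x y, X x -> Y y -> Z (x * y)) ->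
  entries X A -> entries Y B -> entries Z (A *m B).
Proof.
move=> Z0 ZD XYZ XA YB i j; rewrite mxE; apply: (big_ind Z) => // l _.
by apply: XYZ.
Qed.

Section Exactness.
Variable R : comNzRingType.

Definition row_exact p q s (A : 'M[R]_(p, q)) (B : 'M[R]_(q, s)) : Prop :=
  A *m B = 0 /\ forall v : 'rV_q, v *m B = 0 -> exists x, v = x *m A.

Lemma row_exact_mx p q s (A : 'M[R]_(p, q)) (B : 'M[R]_(q, s)) t
    (V : 'M[R]_(t, q)) :
  row_exact A B -> V *m B = 0 -> exists X, V = X *m A.
Proof.
move=> [_ exA] VB.
have /choice [x xP] : forall i, exists x, row i V = x *m A.
  by move=> i; apply: exA; rewrite -row_mul VB; apply/rowP => j; rewrite !mxE.
exists (\matrix_i x i); apply/row_matrixP => i.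
by rewrite row_mul rowK.
Qed.

End Exactness.

Section ShortLocal.
Variables (K : fieldType) (R : comNzRingType).
Variables (iota : {rmorphism K -> R}) (res : {rmorphism R -> K}).
Hypothesis resK : cancel iota res.

Definition mx0 : set R := [set x | res x = 0].

Definition mx02 : set R := [set z | exists (n : nat) (x y : 'I_n -> R),
  (forall i, mx0 (x i) /\ mx0 (y i)) /\ z = \sum_i x i * y i].

Definition socle : set R := [set x | forall y, mx0 y -> x * y = 0].

(* [Ext^1(k, R) = 0] *)
Definition hom_extend : Prop := forall h : R -> R,
  (forall a x y, mx0 x -> mx0 y -> h (a * x + y) = a * h x + h y) ->
  exists e, forall x, mx0 x -> h x = x * e.

Hypothesis m3 : forall x y z, mx0 x -> mx0 y -> mx0 z -> x * y * z = 0.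

Lemma mx0M a x : mx0 x -> mx0 (a * x).
Proof. by rewrite /mx0 /= rmorphM => ->; rewrite mulr0. Qed.

Lemma mx0Mr a x : mx0 x -> mx0 (x * a).
Proof. by rewrite mulrC; apply: mx0M. Qed.

Lemma mx0D x y : mx0 x -> mx0 y -> mx0 (x + y).
Proof. by rewrite /mx0 /= rmorphD => -> ->; rewrite addr0. Qed.

Lemma mx00 : mx0 0. Proof. exact: rmorph0. Qed.

Lemma ksub_mx0 : ksubR iota mx0.
Proof. by split=> [|c x y mx my]; [exact: mx00 | apply: mx0D => //; apply: mx0M]. Qed.

Lemma mx0_res x : mx0 (x - iota (res x)).
Proof. by rewrite /mx0 /= rmorphB /= resK subrr. Qed.

Lemma mx02D x y : mx02 x -> mx02 y -> mx02 (x + y).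
Proof.
move=> [n [a [b [ab ->]]]] [n' [a' [b' [ab' ->]]]].
pose f T (g : 'I_n -> T) (g' : 'I_n' -> T) i :=
  match fintype.split i with inl j => g j | inr j => g' j end.
exists (n + n')%N, (f _ a a'), (f _ b b'); split=> [i|].
  by rewrite /f; case: fintype.split.
rewrite big_split_ord; congr (_ + _); apply: eq_bigr => i _; rewrite /f.
  by rewrite -[lshift n' i]/(unsplit (inl i)) unsplitK.
by rewrite -[rshift n i]/(unsplit (inr i)) unsplitK.
Qed.

Lemma mx02_mul x y : mx0 x -> mx0 y -> mx02 (x * y).
Proof. by move=> mx my; exists 1%N, (fun=> x), (fun=> y); rewrite big_ord1. Qed.

Lemma mx020 : mx02 0.
Proof. by rewrite -(mulr0 0); apply: mx02_mul; exact: mx00. Qed.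

Lemma mx02M a x : mx02 x -> mx02 (a * x).
Proof.
move=> [n [b [c [bc ->]]]]; exists n, (fun i => a * b i), c; split=> [i|].
  by split; [apply: mx0M; case: (bc i) | case: (bc i)].
by rewrite mulr_sumr; apply: eq_bigr => i _; rewrite mulrA.
Qed.

Lemma ksub_mx02 : ksubR iota mx02.
Proof.
by split=> [|c x y mx my]; [exact: mx020 | apply: mx02D => //; apply: mx02M].
Qed.

Lemma mx02_sub : mx02 `<=` mx0.
Proof.
move=> _ [n [x [y [xy ->]]]]; apply: (big_ind mx0) => [|a b|i _].
- exact: mx00.
- exact: mx0D.
- by apply: mx0M; case: (xy i).
Qed.

Lemma mx02_socle : mx02 `<=` socle.
Proof.
move=> _ [n [x [y [xy ->]]]] z mz; rewrite mulr_suml big1 // => i _.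
by case: (xy i) => mx my; apply: m3.
Qed.

Lemma res_unit x : res x <> 0 -> exists y, x * y = 1.
Proof.
move=> /eqP rx; set u := iota (res x); set n := x - u.
have uV : u * iota (res x)^-1 = 1 by rewrite -rmorphM divff // rmorph1.
have mn : mx0 n by apply: mx0_res.
set v := iota (res x)^-1 in uV *.
(* Here x = u + n with u invertible in k and n in m; the geometric series in n v stops because m^3 =
   0. *)
exists (v * (1 - n * v + (n * v) * (n * v))).
have -> : x = u + n by rewrite addrC subrK.
have n3 : (n * v) * (n * v) * (n * v) = 0 by apply: m3; apply: mx0Mr.
rewrite mulrA mulrDl uV; move: (n * v) n3 => t t3.
rewrite mulrDl mul1r mulrDr mulrBr mulr1 mulrA t3 addr0.
by rewrite addrA addrAC addrK subrK.
Qed.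

Lemma kdim_res : @kdim K R iota R^o setT mx0 1.
Proof.
exists (fun=> 1); split=> // x _; exists (const_mx (res x)); split.
  by rewrite big_ord1 mxE /= [_ *: _]mulr1; apply: mx0_res.
move=> c; rewrite big_ord1 /= [_ *: _]mulr1 => h.
apply/rowP => i; rewrite mxE ord1; apply/eqP; rewrite -subr_eq0; apply/eqP.
by move: h; rewrite /mx0 /= rmorphB /= resK.
Qed.

Lemma entries_mx0M p q s (A : 'M[R]_(p, q)) (B : 'M[R]_(q, s)) :
  entries mx0 B -> entries mx0 (A *m B).
Proof.
move=> mB; apply: (@entries_mul _ setT mx0) mB => //.
- exact: mx00.
- exact: mx0D.
- by move=> x y _; apply: mx0M.
Qed.

Lemma entries_mx02M p q s (A : 'M[R]_(p, q)) (B : 'M[R]_(q, s)) :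
  entries mx0 A -> entries mx0 B -> entries mx02 (A *m B).
Proof.
apply: entries_mul; [exact: mx020 | exact: mx02D | exact: mx02_mul].
Qed.

Lemma entries_soc_mul p q s (A : 'M[R]_(p, q)) (B : 'M[R]_(q, s)) :
  entries socle A -> entries mx0 B -> A *m B = 0.
Proof.
move=> sA mB; apply/matrixP => i j; rewrite !mxE big1 // => l _.
by apply: sA.
Qed.

Section Injectivity.
Hypothesis nhom : ~ hom_extend.
Variables (w t p q : nat) (C' : 'M[R]_(w, t)) (C : 'M[R]_(t, p)) (A : 'M[R]_(p, q)).
Hypotheses (exC : row_exact C^T C'^T) (exA : row_exact C A) (mC : entries mx0 C).

(* If a coordinate x_i were a unit, then L(v) = v_i / x_i would map ker A into m and
   x to 1; for h : m -> R, column exactness extends h o L from ker A to H : R^p -> R,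
   and then h(a) = H(a x) = a H(x), so h would extend to R. *)
Lemma annihilated_row (x : 'rV[R]_p) :
  (forall a, mx0 a -> a *: (x *m A) = 0) -> entries mx0 x.
Proof.
move=> xA i j; rewrite ord1 {i}; apply: contrapT => /res_unit [y xy].
apply: nhom => h hl.
have h0 : h 0 = 0.
  have := hl 1 0 0 mx00 mx00; rewrite !mul1r addr0.
  by move/(congr1 (fun z => z - h 0)); rewrite addrK subrr.
have hsum n (a b : 'I_n -> R) : (forall i, mx0 (b i)) ->
    h (\sum_i a i * b i) = \sum_i a i * h (b i).
  move=> mb; suff [] : h (\sum_i a i * b i) = \sum_i a i * h (b i) /\
    mx0 (\sum_i a i * b i) by [].
  elim/big_rec2: _ => [|l u v _ [IH mv]]; first by split=> //; exact: mx00.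
  by split; [rewrite hl // IH | apply: mx0D => //; apply: mx0M].
pose z : 'cV[R]_t := \col_l h (C l j * y).
have C'z : z^T *m C'^T = 0.
  apply/rowP => l; rewrite !mxE.
  under eq_bigr do rewrite !mxE mulrC.
  rewrite -hsum => [|i]; last by apply: mx0Mr; apply: mC.
  have := exC.1 => /matrixP /(_ j l); rewrite !mxE => CC'.
  rewrite (_ : \sum_i _ = 0) //.
  under eq_bigr do rewrite mulrA.
  rewrite -mulr_suml (_ : \sum_i _ = 0) ?mul0r // -[RHS]CC'.
  by apply: eq_bigr => i _; rewrite !mxE mulrC.
have [H HE] := exC.2 _ C'z.
exists ((x *m H^T) 0 0) => a ma.
have /exA.2 [c cE] : (a *: x) *m A = 0 by rewrite -scalemxAl xA.
have -> : a * (x *m H^T) 0 0 = ((a *: x) *m H^T) 0 0 by rewrite -scalemxAl [RHS]mxE.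
have CH : C *m H^T = z by rewrite -[RHS]trmxK HE trmx_mul trmxK.
rewrite cE -mulmxA CH mxE.
under eq_bigr do rewrite [z _ _]mxE.
rewrite -hsum => [|i]; last by apply: mx0Mr; apply: mC.
congr h; under eq_bigr do rewrite mulrA.
rewrite -mulr_suml.
have := congr1 (fun M : 'rV_p => M 0 j) cE; rewrite !mxE => <-.
by rewrite -mulrA xy mulr1.
Qed.

(** A socle vector is killed by B, hence of the form x A; since m x A = 0, [annihilated_row] puts x
    in m. *)
Lemma socle_image s (B : 'M[R]_(q, s)) (v : 'rV[R]_q) :
  row_exact A B -> entries mx0 B -> entries socle v ->
  exists2 x : 'rV_p, entries mx0 x & v = x *m A.
Proof.
move=> exB mB sv; have [x vE] := exB.2 v (entries_soc_mul sv mB).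
exists x => //; apply: annihilated_row => a ma.
by apply/rowP => j; rewrite -vE !mxE mulrC; apply: sv.
Qed.

End Injectivity.

Section Counting.
Variables (e s : nat).
Hypotheses (de : @kdim K R iota R^o mx0 mx02 e).
Hypotheses (ds : @kdim K R iota R^o mx02 [set 0] s).

(** With Y the kernel of B, the matrix B induces m^q / Y = (m^2)^l and A induces k^p = Y / (m^2)^q.
    The latter is injective because x A in m^2 can be written y A with y in m, and then x - y lies
    in the kernel of A, hence in m. *)
Lemma count_rows p q l (A : 'M[R]_(p, q)) (B : 'M[R]_(q, l)) :
  row_exact A B -> entries mx0 A -> entries mx0 B ->
  (forall y : 'rV_p, y *m A = 0 -> entries mx0 y) ->
  (forall v : 'rV_q, entries mx02 v ->
     exists2 x : 'rV_p, entries mx0 x & v = x *m A) ->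
  (forall v : 'rV_l, entries mx02 v ->
     exists2 x : 'rV_q, entries mx0 x & v = x *m B) ->
  exists Y : set 'rV[R]_q,
  [/\ forall v, Y v <-> v *m B = 0,
      kdim iota (@entries R mx0 1 q) Y (l * s),
      kdim iota Y (@entries R mx02 1 q) p
    & (p + l * s = q * e)%N].
Proof.
move=> [AB exA] mA mB kerA surA surB.
pose Y : set 'rV[R]_q := [set v | v *m B = 0].
have k0 (Z : set R) : ksubR iota Z -> ksub iota (@entries R Z 1 q).
  exact: ksub_entries.
have lB : klinear iota (fun v : 'rV[R]_q => v *m B).
  by move=> c x y; rewrite mulmxDl scalemxAl.
have kY : ksub iota Y.
  exact: (ksub_preimage lB (ksub_set0 iota _)).
have BY : entries mx02 `<=` Y.
  by move=> v mv; apply: (entries_soc_mul _ mB) => i j; apply: mx02_socle; apply: mv.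
have YZ : Y `<=` entries mx0.
  by move=> v /exA [x ->]; apply: entries_mx0M.
have [a [d [adE dY dZ]]] := kdim_sub (k0 _ ksub_mx0) kY (k0 _ ksub_mx02) BY YZ
  (kdim_rows q ksub_mx0 ksub_mx02 mx02_sub de).
have dE : d = (l * s)%N.
  have kl : ksub iota (@entries R mx02 1 l) by apply: ksub_entries ksub_mx02.
  apply: (kdim_uniq kl (ksub_set0 iota _)).
    apply: (proj1 (kdim_map lB (ksub_set0 iota _) _ _ _ (k0 _ ksub_mx0)) dZ).
    - by move=> v mv; apply: entries_mx02M.
    - by move=> v /surB [x mx ->]; exists x.
    - by move=> v _.
  exact: (kdim_rows0 l ksub_mx02 ds).
have aE : a = p.
  have lA : klinear iota (fun v : 'rV[R]_p => v *m A).
    by move=> c x y; rewrite mulmxDl scalemxAl.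
  apply: (kdim_uniq kY (k0 _ ksub_mx02) dY).
  have kT : ksubR iota setT := ksubT iota R^o.
  have := kdim_rows p kT ksub_mx0 (@subsetT _ _) kdim_res; rewrite muln1 => dp.
  apply: (proj1 (kdim_map lA (k0 _ ksub_mx02) _ _ _ (ksub_entries kT)) dp).
  - by move=> x _; rewrite /Y /= -mulmxA AB mulmx0.
  - by move=> v /exA [x ->]; exists x.
  - move=> x _; split=> [mx|/surA [y my /eqP]]; first exact: entries_mx02M.
    rewrite -subr_eq0 -mulmxBl => /eqP/kerA mxy i j.
    by rewrite -[x](subrK y) mxE; apply: mx0D.
exists Y; split=> //; first by rewrite -dE.
  by rewrite -aE.
by rewrite -aE -dE.
Qed.

End Counting.

End ShortLocal.

(** * The pairing of m/m^2 with itself and the bound on the type *)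

Section Socle.
Variables (K : fieldType) (R : comNzRingType).
Variables (iota : {rmorphism K -> R}) (res : {rmorphism R -> K}).
Hypothesis resK : cancel iota res.

Local Notation mm := (mx0 res).
Local Notation mm2 := (mx02 res).

Hypothesis m3 : forall x y z, mm x -> mm y -> mm z -> x * y * z = 0.
Variable e : nat.
Hypotheses (de : @kdim K R iota R^o mm mm2 e).
Hypotheses (socE : socle res = mm2).

Section Duality.
Variables (r : nat) (co : R -> 'rV[K]_r).
Hypothesis coD : forall a x y, mm2 x -> mm2 y ->
  co (iota a * x + y) = a *: co x + co y.
Hypothesis co0 : forall x, mm2 x -> x = 0 <-> co x = 0.

Lemma coord_sum n (c : 'I_n -> K) (x : 'I_n -> R) : (forall i, mm2 (x i)) ->
  co (\sum_i iota (c i) * x i) = \sum_i c i *: co (x i).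
Proof.
move=> mx; suff [] : co (\sum_i iota (c i) * x i) = \sum_i c i *: co (x i) /\
  mm2 (\sum_i iota (c i) * x i) by [].
elim/big_rec2: _ => [|i u v _ [IH mv]].
  by split; [apply/co0 => //|]; exact: mx020.
split; last by apply: mx02D => //; apply: mx02M.
by rewrite coD // IH.
Qed.

(** Multiplication from m/m^2 x m/m^2 to m^2 is nondegenerate because the socle is m^2; therefore
    the functionals obtained from products and coordinates exhaust the dual of m/m^2. *)
Lemma functional_rep (chi : R -> K) :
  (forall a x y, mm x -> mm y -> chi (iota a * x + y) = a * chi x + chi y) ->
  (forall x, mm2 x -> chi x = 0) ->
  exists q : 'I_r -> R, (forall l, mm (q l)) /\
    forall v, mm v -> chi v = \sum_l co (q l * v) 0 l.
Proof.
move=> chiD chi0; have [g [mg gP]] := de.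
pose vec (q : 'I_r -> R) := \row_i \sum_l co (q l * g i) 0 l.
have [||a [A [_ AP]]] := @rV_subspace K e
  [set v | exists q, (forall l, mm (q l)) /\ v = vec q].
- exists (fun=> 0); split=> [l|]; first exact: mx00.
  apply/rowP => i; rewrite !mxE big1 // => l _.
  by rewrite mul0r (co0 _).1 ?mxE //; exact: mx020.
- move=> a _ _ [q [mq ->]] [q' [mq' ->]].
  exists (fun l => iota a * q l + q' l); split=> [l|].
    by apply: mx0D => //; apply: mx0M.
  apply/rowP => i; rewrite !mxE mulr_sumr -big_split; apply: eq_bigr => l _ /=.
  by rewrite mulrDl -mulrA coD ?mxE //; apply: mx02_mul.
pose cv : 'rV_e := \row_i chi (g i).
have sub : (cv <= A)%MS.
  rewrite submxE; suff -> : cokermx A = 0 by rewrite mulmx0.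
  (* A column c of the cokernel is orthogonal to every [vec q]. The element v with coordinates c is
     then killed by m, so it lies in Soc(R) = m^2 and c = 0. *)
  apply/trmx_inj/row_matrixP => j; rewrite trmx0 row0 -tr_col.
  have Ac : A *m col j (cokermx A) = 0 by rewrite colE mulmxA mulmx_coker mul0mx.
  move: (col j _) Ac => c Ac.
  have {}Ac q : (forall l, mm (q l)) -> vec q *m c = 0.
    move=> mq; have /submxP [d ->] : (vec q <= A)%MS by apply/AP; exists q.
    by rewrite -mulmxA Ac mulmx0.
  pose v := \sum_i iota (c i 0) * g i.
  have mv : mm v.
    by apply: (big_ind mm) => [|x y|i _]; [exact: mx00|exact: mx0D|apply: mx0M].
  have : mm2 v.
    rewrite -socE => x mx; rewrite mulrC; apply/co0; first exact: mx02_mul.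
    apply/rowP => l; rewrite [RHS]mxE mulr_sumr.
    under eq_bigr do rewrite mulrCA.
    rewrite coord_sum => [|i]; last exact: mx02_mul.
    (* The tuple with x in place l and 0 elsewhere isolates the l-th coordinate of x v. *)
    have mq l' : mm (if l' == l then x else 0) by case: ifP => _ //; exact: mx00.
    have := congr1 (fun M : 'M_1 => M 0 0) (Ac _ mq); rewrite !mxE summxE.
    move=> h; rewrite -[RHS]h; apply: eq_bigr => i _; rewrite !mxE mulrC.
    congr (_ * _); rewrite (bigD1 l) //= eqxx big1 ?addr0 // => l' /negPf ->.
    by rewrite mul0r (co0 _).1 ?mxE //; exact: mx020.
  have [d [_ du]] := gP v mv => m2v.
  have -> : c^T = d.
    apply/esym/du; rewrite (_ : \sum_i _ = v) ?subrr; first exact: mx020.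
    by apply: eq_bigr => i _; rewrite mxE.
  apply: du; rewrite big1 ?subr0 // => i _.
  by rewrite mxE rmorph0 scale0r.
have /AP [q [mq cvE]] := sub; exists q; split=> // v mv.
have [d [m2d _]] := gP v mv.
set u := \sum_i _ in m2d.
have mu : mm u.
  by apply: (big_ind mm) => [|x y|i _]; [exact: mx00|exact: mx0D|apply: mx0M].
have -> : chi v = chi u.
  rewrite -[v](subrK u) -[v - u]mul1r -(rmorph1 iota) chiD ?(chi0 (v - u)) ?mulr0 ?add0r //.
  exact: mx02_sub.
have qv l : q l * v = q l * u.
  rewrite -[v](subrK u) mulrDr [X in X + _](_ : _ = 0) ?add0r //.
  by rewrite mulrC; apply: (mx02_socle m3).
under eq_bigr do rewrite qv.
have -> : chi u = \sum_i d 0 i * chi (g i).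
  suff [] : chi u = \sum_i d 0 i * chi (g i) /\ mm u by [].
  rewrite /u; elim/big_rec2: _ => [|i x y _ [IH my]].
    by split; [apply: chi0; exact: mx020 | exact: mx00].
  by split; [rewrite chiD // IH | apply: mx0D => //; apply: mx0M].
have -> : \sum_i d 0 i * chi (g i) = \sum_i d 0 i * (\sum_l co (q l * g i) 0 l).
  by apply: eq_bigr => i _; have := congr1 (fun M : 'rV_e => M 0 i) cvE; rewrite !mxE => ->.
under [LHS]eq_bigr do rewrite mulr_sumr.
rewrite exchange_big; apply: eq_bigr => l _ /=.
rewrite mulr_sumr; under [in RHS]eq_bigr do rewrite [_ *: _]/(_ * _) mulrCA.
rewrite coord_sum => [|i]; last by apply: mx02_mul.
by rewrite summxE; apply: eq_bigr => i _; rewrite mxE.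
Qed.

End Duality.

Hypothesis m2n0 : exists2 z, mm2 z & z <> 0.

Lemma mx02_coord r : @kdim K R iota R^o mm2 [set 0] r -> exists co : R -> 'rV[K]_r,
  (forall a x y, mm2 x -> mm2 y -> co (iota a * x + y) = a *: co x + co y) /\
  (forall x, mm2 x -> x = 0 <-> co x = 0).
Proof.
move=> [g [mg gP]].
have k2 : @ksub K R iota R^o mm2 := ksub_mx02 iota res.
have [co [_ coD co0]] := kdim_coord k2 (ksub_set0 iota R^o) mg gP.
by exists co.
Qed.

(** If m^2 = Soc(R) were a line, a homomorphism h from m to R would act on m^2 by a scalar c, and h
    - c would induce a functional on m/m^2. By self-duality that functional is multiplication by an
    element of m, so h would extend to R. *)
Lemma type_gt1 r : @kdim K R iota R^o mm2 [set 0] r ->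
  ~ hom_extend res -> (1 < r)%N.
Proof.
move=> ds nhom; case: ltnP => // r1; exfalso.
have [co [coD co0]] := mx02_coord ds.
case: m2n0 => z0 mz0 z0n0.
case: r r1 co coD co0 ds => [|[|//]] _ co coD co0 d.
  by apply: z0n0; apply/co0 => //; apply/rowP; case.
apply: nhom => h hl.
have h0 : h 0 = 0.
  have := hl 1 0 0 (mx00 res) (mx00 res); rewrite !mul1r addr0.
  by move/(congr1 (fun z => z - h 0)); rewrite addrK subrr.
have hM a x : mm x -> h (a * x) = a * h x.
  by move=> mx; rewrite -[a * x]addr0 hl ?h0 ?addr0 //; exact: mx00.
(* If h x were a unit, z0 h(x) = h(z0 x) = 0 would force z0 = 0. *)
have hm x : mm x -> mm (h x).
  move=> mx; apply: contrapT => /(res_unit resK m3) [y hy]; apply: z0n0.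
  by rewrite -[z0]mulr1 -hy mulrA -hM // (mx02_socle m3 mz0 mx) h0 mul0r.
have [g [mg gP]] := d.
have gE z : mm2 z -> exists c, z = iota c * g 0.
  by move=> /gP [c [/eqP + _]]; rewrite big_ord1 subr_eq0 => /eqP ->; exists (c 0 0).
have [c hg] : exists c, h (g 0) = iota c * g 0.
  apply: gE; have [n [x [y [xy ->]]]] := mg 0.
  suff [] : mm2 (h (\sum_i x i * y i)) /\ mm (\sum_i x i * y i) by [].
  elim/big_rec: _ => [|i u _ [IH mu]].
    by rewrite h0; split; [exact: mx020 | exact: mx00].
  have [mx my] := xy i; split; last by apply: mx0D => //; apply: mx0M.
  by rewrite hl //; apply: mx02D => //; apply: mx02_mul => //; apply: hm.
have h2 z : mm2 z -> h z = iota c * z.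
  by move=> /gE [b ->]; rewrite hM ?hg 1?mulrCA //; apply: mx02_sub.
(* h - c kills m^2, and its values lie in the socle since (h - c)(x) y = h(x y) - c x y = 0. *)
pose h' x := h x - iota c * x.
have h'm x : mm x -> mm2 (h' x).
  move=> mx; rewrite -socE => y my; rewrite mulrBl [h x * y]mulrC -hM //.
  by rewrite h2 1?mulrA ?[x * y]mulrC ?mulrA 1?mulrAC ?subrr //; apply: mx02_mul.
have h'D a x y : mm x -> mm y -> h' (a * x + y) = a * h' x + h' y.
  move=> mx my; rewrite /h' hl // mulrDr opprD addrACA.
  by rewrite mulrBr mulrCA.
have [a x y mx my|x mx|q [mq qP]] := @functional_rep 1 co coD co0 (fun x => co (h' x) 0 0).
- by rewrite h'D // coD ?mxE //; apply: h'm.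
- by rewrite /h' h2 // subrr (co0 _ (mx020 res)).1 ?mxE.
exists (iota c + q 0) => x mx; rewrite mulrDr [x * iota c]mulrC.
apply/eqP; rewrite addrC -subr_eq -/(h' x); apply/eqP.
apply/eqP; rewrite -subr_eq0; apply/eqP/co0.
  by rewrite -[- _]mulN1r; apply: mx02D; [apply: h'm | apply: mx02M; apply: mx02_mul].
rewrite addrC -mulN1r -(rmorphN1 iota) coD; last 2 first.
- exact: mx02_mul.
- exact: h'm.
apply/rowP => i; rewrite ord1 !mxE qP // big_ord1 mulN1r mulrC addrC subrr //.
Qed.

End Socle.

(** Exactness of the complex and of its transpose at each position n + 1; nothing is asked at
    position 0, whence the successors in the indices below. *)
Definition acyclic R (F : free_complex R) : Prop := forall n,
  row_exact (diff F n.+1) (diff F n) /\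
  row_exact (diff F n)^T (diff F n.+1)^T.

(** * Ranks of minimal complexes exact in both directions *)

Section MinimalComplex.
Variables (K : fieldType) (R : comNzRingType).
Variables (iota : {rmorphism K -> R}) (res : {rmorphism R -> K}).
Hypothesis resK : cancel iota res.

Local Notation mm := (mx0 res).
Local Notation mm2 := (mx02 res).

Hypothesis m3 : forall x y z, mm x -> mm y -> mm z -> x * y * z = 0.
Hypothesis m2n0 : exists2 z, mm2 z & z <> 0.
Hypothesis nhom : ~ hom_extend res.

Section OneComplex.
Variable F : free_complex R.
Hypotheses (acF : acyclic F) (minF : forall n, entries mm (diff F n)).

Local Notation b := (rk F).
Local Notation d := (diff F).

Lemma minF_tr n : entries mm (d n)^T.
Proof. by move=> i j; rewrite mxE; apply: minF. Qed.

Lemma minimal_ker n (v : 'rV_(b n.+1)) : v *m d n = 0 -> entries mm v.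
Proof. by move=> /(acF n).1.2 [x ->]; apply: entries_mx0M. Qed.

Lemma minimal_ker_tr n (v : 'rV_(b n.+1)) : v *m (d n.+1)^T = 0 -> entries mm v.
Proof. by move=> /(acF n).2.2 [x ->]; apply: entries_mx0M; apply: minF_tr. Qed.

(** In [socle_image], the minimal d_n kills the socle, and column exactness between d_{n+2} and
    d_{n+3} excludes unit coordinates of the preimage under d_{n+1}. *)
Lemma socle_rows n (v : 'rV_(b n.+1)) : entries (socle res) v ->
  exists2 x : 'rV_(b n.+2), entries mm x & v = x *m d n.+1.
Proof.
by apply: (socle_image resK m3 nhom (acF n.+2).2 (acF n.+1).1 (@minF _) (acF n).1).
Qed.

Lemma socle_cols n (v : 'rV_(b n.+3)) : entries (socle res) v ->
  exists2 x : 'rV_(b n.+2), entries mm x & v = x *m (d n.+2)^T.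
Proof.
have exC : row_exact (d n.+1)^T^T (d n)^T^T by rewrite !trmxK; apply: (acF n).1.
exact: (socle_image resK m3 nhom exC (acF n.+1).2 (@minF_tr _) (acF n.+2).2 (@minF_tr _)).
Qed.

(** The constant vector on a socle element is a combination, with coefficients in m, of rows with
    entries in m. *)
Lemma socle_eq n : (0 < b n.+1)%N -> socle res = mm2.
Proof.
move=> bn; apply/seteqP; split=> [x sx|]; last exact: mx02_socle.
have [//|y my vE] := @socle_rows n (const_mx x) => [i j|]; first by rewrite mxE.
have : mm2 ((const_mx x : 'rV_(b n.+1)) 0 (Ordinal bn)).
  by rewrite vE; apply: entries_mx02M.
by rewrite mxE.
Qed.

(** If F_{n+2} = 0, the all-ones vector is a cocycle of the dual, and minimality would place its
    entries in m. *)
Lemma rank0_descent n : b n.+2 = 0%N -> b n.+1 = 0%N.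
Proof.
case: (posnP (b n.+1)) => // bn1 bn2.
have : (const_mx 1 : 'rV_(b n.+1)) *m (d n.+1)^T = 0.
  by apply/rowP => j; have := ltn_ord j; rewrite [X in (_ < X)%N]bn2.
move/minimal_ker_tr => /(_ 0 (Ordinal bn1)); rewrite mxE /mx0 /= rmorph1.
by move/eqP; rewrite oner_eq0.
Qed.

Section Ranks.
Variables (e r : nat).
Hypotheses (de : @kdim K R iota R^o mm mm2 e).
Hypotheses (dr : @kdim K R iota R^o (socle res) [set 0] r).

Lemma count_complex n : socle res = mm2 -> exists Y : set 'rV[R]_(b n.+2),
  [/\ forall v, Y v <-> v *m d n.+1 = 0,
      kdim iota (@entries R mm 1 _) Y (b n.+1 * r),
      kdim iota Y (@entries R mm2 1 _) (b n.+3)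
    & (b n.+3 + b n.+1 * r = b n.+2 * e)%N].
Proof.
move=> socE; have dr' := dr; rewrite socE in dr'.
apply: (count_rows resK m3 de dr' (acF n.+1).1) => // v.
- exact: minimal_ker.
- by rewrite -socE; apply: socle_rows.
- by rewrite -socE; apply: socle_rows.
Qed.

Lemma count_complex_tr n : socle res = mm2 ->
  (b n.+2 + b n.+4 * r = b n.+3 * e)%N.
Proof.
move=> socE; have dr' := dr; rewrite socE in dr'.
have [|||||Y []//] := count_rows resK m3 de dr' (acF n.+2).2.
- exact: minF_tr.
- exact: minF_tr.
- by move=> v; apply: minimal_ker_tr.
- by move=> v; rewrite -socE; apply: socle_cols.
- by move=> v; rewrite -socE; apply: (@socle_cols n.+1).
Qed.

(** Counting rows and columns at the same place gives b_{n+4} + r b_{n+2} = e b_{n+3} = b_{n+2} + r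
    b_{n+4}. As r > 1, the ranks have period two; constancy has to wait for e = r + 1. *)
Lemma rank_recurrence n : socle res = mm2 ->
  b n.+4 = b n.+2 /\ (b n.+2 * r.+1 = b n.+3 * e)%N.
Proof.
move=> socE; have [Y [_ _ _ E1]] := count_complex n.+1 socE.
have E2 := count_complex_tr n socE.
have r1 : (1 < r)%N.
  by have dr' := dr; rewrite socE in dr'; apply: (type_gt1 resK m3 de socE m2n0 dr' nhom).
have E : b n.+4 = b n.+2.
  have : (b n.+4 + b n.+2 * r = b n.+2 + b n.+4 * r)%N by rewrite E1 E2.
  rewrite -(ltn_predK r1) !mulnS addnCA => /eqP.
  rewrite !eqn_add2l eqn_mul2r -subn1 subn_eq0 leqNgt r1 /= => /eqP -> //.
by split=> //; rewrite -E2 E mulnS.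
Qed.

End Ranks.

End OneComplex.

End MinimalComplex.

(** * Linear syzygies and the residue field *)

Section Iteration.
Variable R : comNzRingType.

(** The rank at position 0 reduces to q, so the first differential composes with a given matrix
    without a cast. *)
Definition complex_cons (q : nat) (l : nat -> nat)
    (d : forall n, 'M[R]_(l n, if n is n'.+1 then l n' else q)) : free_complex R :=
  @FreeComplex R (fun n => if n is n'.+1 then l n' else q) d.

Lemma iter_complex (P : forall p q, 'M[R]_(p, q) -> Prop)
    (Q : forall p q s, 'M[R]_(p, q) -> 'M[R]_(q, s) -> Prop) :
  (forall q s (B : 'M_(q, s)), P q s B ->
     exists p, exists2 A : 'M_(p, q), P p q A & Q p q s A B) ->
  forall q s (B : 'M_(q, s)), P q s B ->
  exists l d, let F := @complex_cons q l d in
    [/\ forall n, P _ _ (diff F n), Q _ _ _ (diff F 0) B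
      & forall n, Q _ _ _ (diff F n.+1) (diff F n)].
Proof.
move=> step q s B PB.
(* Sizes are chosen along with the matrices, so the iterated state packs a matrix with both of its
   sizes. *)
pose St := {x : {q : nat & {s : nat & 'M[R]_(q, s)}} | P _ _ (tagged (tagged x))}.
have nx (x : St) : {y : {p : nat & 'M[R]_(p, tag (sval x))} |
    P _ _ (tagged y) /\ Q _ _ _ (tagged y) (tagged (tagged (sval x)))}.
  apply: cid; case: x => [[q' [s' B']]] /= PB'.
  by have [p [A PA QA]] := step _ _ _ PB'; exists (Tagged (fun p => 'M[R]_(p, q')) A).
pose mk q s (A : 'M[R]_(q, s)) (h : P q s A) : St :=
  exist _ (Tagged (fun q => {s : nat & 'M[R]_(q, s)}) (Tagged (fun s => 'M[R]_(q, s)) A)) h.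
pose next (x : St) : St := mk _ _ (tagged (sval (nx x))) (svalP (nx x)).1.
pose st n := iter n next (mk _ _ B PB).
exists (fun n => tag (sval (nx (st n)))).
exists (fun n => match n return 'M[R]_(tag (sval (nx (st n))),
    if n is n'.+1 then tag (sval (nx (st n'))) else q) with
  | 0 => tagged (sval (nx (st 0%N)))
  | n'.+1 => tagged (sval (nx (st n'.+1)))
  end).
split=> [[|n]||n] /=.
- exact: (svalP (nx (st 0%N))).1.
- exact: (svalP (nx (st n.+1))).1.
- exact: (svalP (nx (st 0%N))).2.
- by have := (svalP (nx (st n.+1))).2; case: n.
Qed.

End Iteration.

(** A functional vanishing on the kernel of f factors through f; a functional on matrices is the
    entrywise pairing with some Y. *)
Lemma factor_functional (K : fieldType) (R : comNzRingType)
    (iota : {rmorphism K -> R}) (N : lmodType R) (Z : set N) n a b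
    (f : N -> 'M[K]_(a, b)) (phi : N -> K) :
  ksub iota Z -> kdim iota Z [set 0] n ->
  (forall c x y, Z x -> Z y -> f (iota c *: x + y) = c *: f x + f y) ->
  (forall c x y, Z x -> Z y -> phi (iota c *: x + y) = c * phi x + phi y) ->
  (forall z, Z z -> f z = 0 -> phi z = 0) ->
  exists Y : 'M[K]_(a, b), forall z, Z z ->
    phi z = \sum_i \sum_j f z i j * Y i j.
Proof.
move=> kZ [g [Zg gP]] fD phiD ker.
have h0 : f 0 = 0 /\ phi 0 = 0.
  have Z0 := ksub0 kZ; have := fD (-1) 0 0 Z0 Z0; have := phiD (-1) 0 0 Z0 Z0.
  by rewrite scaler0 addr0 mulN1r scaleN1r !addNr.
have comb c : f (kcomb iota g c) = \sum_i c 0 i *: f (g i) /\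
    phi (kcomb iota g c) = \sum_i c 0 i * phi (g i).
  suff [] : [/\ f (kcomb iota g c) = \sum_i c 0 i *: f (g i),
    phi (kcomb iota g c) = \sum_i c 0 i * phi (g i) & Z (kcomb iota g c)] by [].
  rewrite /kcomb; elim: (index_enum _) => [|i s [IH1 IH2 Zs]].
    by rewrite !big_nil; case: h0 => -> ->; split=> //; exact: (ksub0 kZ).
  by rewrite !big_cons fD // phiD // IH1 IH2; split=> //; apply: kZ.2.
pose F := \matrix_i mxvec (f (g i)); pose v := \row_i phi (g i).
have /submxP [y yE] : (v <= F^T)%MS.
  rewrite submxE; apply/eqP; have := mulmx_coker F^T.
  set C := cokermx _ => FC; apply/rowP => j; rewrite [RHS]mxE.
  pose c := (col j C)^T.
  have cF : c *m F = 0.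
    apply: trmx_inj; rewrite trmx_mul trmxK colE mulmxA FC mul0mx trmx0 //.
  have /ker : f (kcomb iota g c) = 0.
    rewrite (comb c).1; apply: (can_inj mxvecK); rewrite linear_sum [RHS]linear0 -[RHS]cF.
    by rewrite mulmx_sum_row; apply: eq_bigr => i _; rewrite linearZ rowK.
  rewrite (comb c).2 => <-; last by apply: ksub_kcomb.
  by rewrite mxE; apply: eq_bigr => i _; rewrite !mxE mulrC.
exists (vec_mx y) => z Zz; have [c [/eqP + _]] := gP z Zz.
rewrite subr_eq0 -/(kcomb iota g c) => /eqP ->; rewrite (comb c).1 (comb c).2.
have -> : \sum_i c 0 i * phi (g i) = \sum_i c 0 i * \sum_j F i j * y 0 j.
  apply: eq_bigr => i _; have := congr1 (fun M : 'rV_n => M 0 i) yE.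
  by rewrite !mxE => ->; congr (_ * _); apply: eq_bigr => j _; rewrite !mxE mulrC.
rewrite (pair_bigA _ (fun i j => _ i j * vec_mx y i j)) /=.
have -> (X : 'M_(a, b)) : \sum_p X p.1 p.2 * vec_mx y p.1 p.2 = \sum_j mxvec X 0 j * y 0 j.
  rewrite (reindex _ (curry_mxvec_bij a b)) /=; apply: eq_bigr => [[i j]] _ /=.
  by rewrite mxvecE mxE.
rewrite linear_sum; under [RHS]eq_bigr do rewrite summxE mulr_suml.
rewrite exchange_big; apply: eq_bigr => i _ /=; rewrite mulr_sumr.
by apply: eq_bigr => j _; rewrite linearZ !mxE mulrA.
Qed.

Section Scalars.
Variables (K : fieldType) (R : comNzRingType) (iota : {rmorphism K -> R}).
Variables (Z : set R) (kZ : ksubR iota Z).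

Lemma entries_lift_mull p q t (Y : 'M[K]_(p, q)) (X : 'M[R]_(q, t)) :
  entries Z X -> entries Z (map_mx iota Y *m X).
Proof.
move=> ZX i j; rewrite mxE; apply: (ksub_sum kZ) => l _.
by rewrite mxE; apply: (ksubZ kZ).
Qed.

Lemma entries_lift_mulr p q t (X : 'M[R]_(p, q)) (Y : 'M[K]_(q, t)) :
  entries Z X -> entries Z (X *m map_mx iota Y).
Proof.
move=> ZX i j; rewrite mxE; apply: (ksub_sum kZ) => l _.
by rewrite mxE mulrC; apply: (ksubZ kZ).
Qed.

Lemma entries_row p q (X : 'M[R]_(p, q)) i : entries Z X -> entries Z (row i X).
Proof. by move=> ZX j l; rewrite mxE. Qed.

Lemma entriesB p q (X Y : 'M[R]_(p, q)) :
  entries Z X -> entries Z Y -> entries Z (X - Y).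
Proof. by move=> ZX ZY i j; rewrite !mxE; apply: (ksubB kZ). Qed.

End Scalars.

Section Strand.
Variables (K : fieldType) (R : comNzRingType).
Variables (iota : {rmorphism K -> R}) (res : {rmorphism R -> K}).

Local Notation mm := (mx0 res).
Local Notation mm2 := (mx02 res).
Local Notation lift := (map_mx iota).

Variable e : nat.

Variable V : set R.
Hypothesis kV : ksubR iota V.
Hypothesis Vm : V `<=` mm.
Hypothesis dV : @kdim K R iota R^o V [set 0] e.

Lemma entries_VM p q s (A : 'M[R]_(p, q)) (B : 'M[R]_(q, s)) :
  entries V A -> entries V B -> entries mm2 (A *m B).
Proof.
apply: entries_mul; [exact: mx020 | exact: mx02D |].
by move=> x y /Vm mx /Vm my; apply: mx02_mul.
Qed.

(** One step of a linear strand: the rows of A are a k-basis of the degree-one relations of B.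
    Degree-two relations are the business of [good]. *)
Definition linear_syzygy p q s (A : 'M[R]_(p, q)) (B : 'M[R]_(q, s)) : Prop :=
  [/\ entries V A, A *m B = 0,
      forall v : 'rV_q, entries V v -> v *m B = 0 -> exists y, v = lift y *m A
    & forall y : 'rV_p, lift y *m A = 0 -> y = 0].

Lemma linear_syzygy_mx p q s (A : 'M[R]_(p, q)) (B : 'M[R]_(q, s)) t
    (X : 'M[R]_(t, q)) :
  linear_syzygy A B -> entries V X -> X *m B = 0 -> exists Y, X = lift Y *m A.
Proof.
move=> [_ _ exA _] VX XB.
have /choice [y yP] : forall i, exists y, row i X = lift y *m A.
  move=> i; apply: exA; first exact: entries_row.
  by rewrite -row_mul XB; apply/rowP => j; rewrite !mxE.
exists (\matrix_i y i); apply/row_matrixP => i.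
rewrite row_mul yP; congr (_ *m A); apply/rowP => j.
by rewrite !mxE.
Qed.

Lemma linear_syzygy_kdim p q s (A : 'M[R]_(p, q)) (B : 'M[R]_(q, s)) :
  linear_syzygy A B ->
  kdim iota [set v : 'rV[R]_q | entries V v /\ v *m B = 0] [set 0] p.
Proof.
move=> [VA AB exA indA]; exists (fun i => row i A); split=> [i|v [Vv vB]].
  split; first exact: entries_row.
  by rewrite -row_mul AB; apply/rowP => j; rewrite !mxE.
have sumE (c : 'rV[K]_p) : \sum_i iota (c 0 i) *: row i A = lift c *m A.
  by rewrite mulmx_sum_row; apply: eq_bigr => i _; rewrite mxE.
have [y yE] := exA _ Vv vB; exists y; split=> [|c] /=; rewrite sumE.
  by rewrite yE subrr.
rewrite yE -mulmxBl -map_mxB => /indA /eqP.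
by rewrite subr_eq0 => /eqP.
Qed.

Lemma linear_syzygy_exists q s (B : 'M[R]_(q, s)) :
  exists p (A : 'M[R]_(p, q)), linear_syzygy A B.
Proof.
have kV1 : ksub iota (@entries R V 1 q) := ksub_entries kV.
have lB : klinear iota (fun v : 'rV[R]_q => v *m B).
  by move=> c x y; rewrite mulmxDl scalemxAl.
have kY := ksubI kV1 (ksub_preimage lB (ksub_set0 iota _)).
have k0 : ksub iota [set (0 : 'rV[R]_q)] := ksub_set0 iota _.
have dVq : kdim iota (@entries R V 1 q) [set 0] (q * e) := kdim_rows0 q kV dV.
have [|v [] //|p [_ [_ [g [Yg gP]] _]]] := kdim_sub kV1 kY k0 _ _ dVq.
  by move=> _ ->; exact: (ksub0 kY).
pose A := \matrix_i g i.
have sumE (c : 'rV[K]_p) : \sum_i iota (c 0 i) *: g i = lift c *m A.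
  by rewrite mulmx_sum_row; apply: eq_bigr => i _; rewrite mxE rowK.
exists p, A; split=> [i j||v Vv vB|y yA].
- by rewrite mxE; case: (Yg i).
- apply/row_matrixP => i; rewrite row_mul rowK row0; exact: (Yg i).2.
- have [c [/eqP + _]] := gP v (conj Vv vB).
  by rewrite sumE subr_eq0 => /eqP ->; exists c.
- have [c [_ cu]] := gP _ (ksub0 kY).
  by rewrite -(cu y) ?(cu 0) // /= sumE ?yA ?map_mx0 ?mul0mx subr0.
Qed.

Section Covering.
Variables (b : nat -> nat) (D : forall i, 'M[R]_(b i, b i.+1)).
Hypotheses (VD : forall i, entries V (D i)) (DD : forall i, D i *m D i.+1 = 0).
Hypothesis DS : forall i (u : 'cV_(b i)), entries mm2 u ->
  exists2 x : 'cV_(b i.+1), entries V x & u = D i *m x.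
Hypothesis b0 : (0 < b 0)%N.

Lemma DS_mx i t (U : 'M_(b i, t)) : entries mm2 U ->
  exists2 X : 'M_(b i.+1, t), entries V X & U = D i *m X.
Proof.
move=> mU; have /choice [x xP] : forall j, exists x : 'cV_(b i.+1),
    entries V x /\ col j U = D i *m x.
  by move=> j; have [|x] := @DS i (col j U); [move=> l l'; rewrite mxE | exists x].
exists (\matrix_(l, j) x j l 0) => [l j|]; first by rewrite mxE; apply: (xP j).1.
apply/matrixP => l j; have := congr1 (fun M : 'cV_(b i) => M l 0) (xP j).2.
by rewrite !mxE => ->; apply: eq_bigr => l' _; rewrite mxE.
Qed.

(* In the application D is the transposed linear resolution of a module M with
   Ext^i(M, R) = 0 for i > 0, so [covers] expresses a vanishing of Tor against M; it passes
   from a matrix to its syzygies although D is read one step further at each stage. *)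
Definition covers p q (T : set 'rV[R]_q) (A : 'M[R]_(p, q)) : Prop :=
  forall i (Z : 'M[R]_(b i, q)), (forall j, T (row j Z)) ->
    exists Y : 'M[K]_(b i.+1, p), Z = D i *m lift Y *m A.

(** Write Z = D_i U with U over V. Covering by A at index i + 1 gives U A = D_{i+1} Y A, so U -
    D_{i+1} Y consists of linear relations of A and equals Y' A'. As D_i D_{i+1} = 0, it follows
    that Z = D_i Y' A'. *)
Lemma covers_syzygy p' p q (T : set 'rV[R]_q) (A' : 'M[R]_(p', p)) (A : 'M[R]_(p, q)) :
  (forall u : 'rV_p, entries V u -> T (u *m A)) ->
  linear_syzygy A' A -> covers T A -> covers (entries mm2) A'.
Proof.
move=> TA syz cA i Z mZ.
have [|U VU ->] := @DS_mx i _ Z; first by move=> j l; have := mZ j 0 l; rewrite mxE.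
have [|Y UA] := cA i.+1 (U *m A).
  by move=> j; rewrite row_mul; apply: TA; apply: entries_row.
have [||Y' E] := linear_syzygy_mx (X := U - D i.+1 *m lift Y) syz.
- by apply: (entriesB kV) => //; apply: (entries_lift_mulr kV).
- by rewrite mulmxBl UA subrr.
exists Y'; rewrite -mulmxA -E mulmxBr mulmxA DD mul0mx subr0 //.
Qed.

(** Covering is applied at index 0 to the matrix with t as one row and zeros elsewhere. *)
Lemma covers_surj p q (T : set 'rV[R]_q) (A : 'M[R]_(p, q)) (t : 'rV_q) :
  T 0 -> covers T A -> T t -> exists2 u : 'rV_p, entries V u & t = u *m A.
Proof.
move=> T0 cA Tt; pose i0 := Ordinal b0.
have [|Y E] := cA 0%N (\matrix_j if j == i0 then t else 0).
  by move=> j; rewrite rowK; case: ifP.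
exists (row i0 (D 0 *m lift Y)); last by rewrite -row_mul -E rowK eqxx.
by apply: entries_row; apply: (entries_lift_mulr kV).
Qed.

Lemma covers_complex (q s : nat) (T : set 'rV[R]_s) (B : 'M[R]_(q, s)) :
  (forall u : 'rV_q, entries V u -> T (u *m B)) -> covers T B ->
  exists l d, let F := @complex_cons R q l d in
    [/\ forall n, covers (entries mm2) (diff F n), linear_syzygy (diff F 0) B
      & forall n, linear_syzygy (diff F n.+1) (diff F n)].
Proof.
move=> TB cB.
(* The target is T for B and m^2 for all later matrices; quantifying over it gives one invariant for
   both. *)
pose P p t (A : 'M[R]_(p, t)) := exists T' : set 'rV[R]_t,
  (forall u : 'rV_p, entries V u -> T' (u *m A)) /\ covers T' A.
pose Q p t s (A' : 'M[R]_(p, t)) (A : 'M[R]_(t, s)) :=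
  linear_syzygy A' A /\ covers (entries mm2) A'.
have [|l [d /= [_ [sy0 c0] QF]]] := @iter_complex R P Q _ _ _ B (ex_intro _ T (conj TB cB)).
  move=> t s' A [T' [TA cA]].
  have [p [A' syz]] := linear_syzygy_exists A.
  have c' := covers_syzygy TA syz cA.
  exists p, A' => //; exists (entries mm2); split=> // u Vu.
  by apply: entries_VM => //; case: syz.
exists l, d; split=> [n||n] //=; last by case: (QF n).
by case: n => [|n] //=; case: (QF n).
Qed.

End Covering.

End Strand.

Section ResidueField.
Variables (K : fieldType) (R : comNzRingType).
Variables (iota : {rmorphism K -> R}) (res : {rmorphism R -> K}).
Hypothesis resK : cancel iota res.

Local Notation mm := (mx0 res).
Local Notation mm2 := (mx02 res).
Local Notation lift := (map_mx iota).

Hypothesis m3 : forall x y z, mm x -> mm y -> mm z -> x * y * z = 0.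
Variables (e r : nat).

Variable V : set R.
Hypothesis kV : ksubR iota V.
Hypothesis Vm : V `<=` mm.
Hypothesis Vdec : forall x, mm x -> exists2 v, V v & mm2 (x - v).
Hypothesis dV : @kdim K R iota R^o V [set 0] e.
Hypothesis V0 : forall x, V x -> mm2 x -> x = 0.

Local Notation linear_syzygy := (linear_syzygy iota V).

Lemma mulV2 x y : V x -> mm2 y -> x * y = 0.
Proof. by move=> /Vm mx my; rewrite mulrC; apply: (mx02_socle m3). Qed.

Lemma mul_V_mx02 p q t (X : 'M[R]_(p, q)) (Y : 'M[R]_(q, t)) :
  entries V X -> entries mm2 Y -> X *m Y = 0.
Proof.
move=> VX mY; apply/matrixP => i j; rewrite !mxE big1 // => l _.
exact: mulV2.
Qed.

Lemma mul_mx02_V p q t (X : 'M[R]_(p, q)) (Y : 'M[R]_(q, t)) :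
  entries mm2 X -> entries V Y -> X *m Y = 0.
Proof.
move=> mX VY; apply/matrixP => i j; rewrite !mxE big1 // => l _.
by rewrite mulrC; apply: mulV2.
Qed.

Lemma mx_decomp p q (X : 'M[R]_(p, q)) : exists X1 X2,
  [/\ entries V X1, entries mm2 X2 & X = lift (map_mx res X) + X1 + X2].
Proof.
have /choice [f fP] : forall x : R, exists v, V v /\ mm2 (x - iota (res x) - v).
  by move=> x; have [v Vv mv] := Vdec (mx0_res resK x); exists v.
exists (map_mx f X), (map_mx (fun x => x - iota (res x) - f x) X).
split=> [i j|i j|]; rewrite ?mxE; [exact: (fP _).1 | exact: (fP _).2 |].
by apply/matrixP => i j; rewrite !mxE -[_ - _ - _]addrA -opprD addrC subrK.
Qed.

Lemma entries_disjoint p q (X Y : 'M[R]_(p, q)) :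
  entries V X -> entries mm2 Y -> X + Y = 0 -> X = 0 /\ Y = 0.
Proof.
move=> VX mY XY.
have X0 : X = 0.
  apply/matrixP => i j; rewrite mxE; apply: V0 => //.
  have /matrixP /(_ i j) := XY; rewrite !mxE => /eqP.
  by rewrite addr_eq0 => /eqP ->; rewrite -mulN1r; apply: mx02M.
by move: XY; rewrite X0 add0r.
Qed.

(** The degree-two part of exactness, complementary to [linear_syzygy]. *)
Definition good p q (A : 'M[R]_(p, q)) : Prop := forall t : 'rV_q, entries mm2 t ->
  exists2 u : 'rV_p, entries V u & t = u *m A.

Section Complex.
Variables (b : nat -> nat) (D : forall i, 'M[R]_(b i, b i.+1)).
Hypotheses (VD : forall i, entries V (D i)) (DD : forall i, D i *m D i.+1 = 0).
Hypothesis DS : forall i (u : 'cV_(b i)), entries mm2 u ->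
  exists2 x : 'cV_(b i.+1), entries V x & u = D i *m x.
Hypothesis DX : forall i (v : 'rV_(b i.+1)), entries V v -> v *m D i.+1 = 0 ->
  exists y, v = lift y *m D i.
Hypothesis b0 : (0 < b 0)%N.

Local Notation covers := (covers iota D).
Lemma entries2_0 p q : entries mm2 (0 : 'M[R]_(p, q)).
Proof. by move=> i j; rewrite mxE; exact: mx020. Qed.

(** The start is the 1 x 0 matrix: every element of V is a linear relation of it, so the first
    differential is a column listing a basis of V, and covering is trivial for lack of columns. *)
Lemma residue_complex : exists l d, let F := @complex_cons R 1 l d in
  [/\ forall n, good (diff F n), linear_syzygy (diff F 0) (0 : 'M_(1, 0))
    & forall n, linear_syzygy (diff F n.+1) (diff F n)].
Proof.
have [||l [d /= [cF sy0 sy]]] :=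
    covers_complex kV Vm dV VD DD DS (T := setT) (B := (0 : 'M[R]_(1, 0))).
- by [].
- by move=> i Z _; exists 0; apply/matrixP => j [].
exists l, d; split=> // n t mt.
by apply: (covers_surj kV VD b0 _ (cF n)) => //; apply: entries2_0.
Qed.

Section Canonical.
Variable co : R -> 'rV[K]_r.
Hypothesis coD : forall a x y, mm2 x -> mm2 y ->
  co (iota a * x + y) = a *: co x + co y.
Hypothesis co0 : forall x, mm2 x -> x = 0 <-> co x = 0.

(** If functionals phi_l on R extend the coordinates of m^2, this is the value at 1 of the sum of
    the t_l phi_l. For t over m^2 it vanishes exactly when that sum is 0 in E. *)
Definition trace_co (t : 'rV[R]_r) : K := \sum_l co (t 0 l) 0 l.

Lemma trace_coD a (x y : 'rV[R]_r) : entries mm2 x -> entries mm2 y ->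
  trace_co (iota a *: x + y) = a * trace_co x + trace_co y.
Proof.
move=> mx my; rewrite /trace_co mulr_sumr -big_split; apply: eq_bigr => l _ /=.
by rewrite !mxE coD ?mxE.
Qed.

Lemma trace_co0 : trace_co 0 = 0.
Proof.
by rewrite /trace_co big1 // => l _; rewrite !mxE (co0 (mx020 res)).1 ?mxE.
Qed.

Lemma trace_co_sum n (c : 'I_n -> K) (x : 'I_n -> 'rV[R]_r) :
  (forall i, entries mm2 (x i)) ->
  trace_co (\sum_i iota (c i) *: x i) = \sum_i c i * trace_co (x i).
Proof.
move=> mx; suff [] : trace_co (\sum_i iota (c i) *: x i) =
  \sum_i c i * trace_co (x i) /\ entries mm2 (\sum_i iota (c i) *: x i) by [].
elim/big_rec2: _ => [|i u v _ [IH mv]]; first by split; [exact: trace_co0 | exact: entries2_0].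
split; first by rewrite trace_coD ?IH.
by move=> j l; rewrite !mxE; apply: mx02D; [apply: mx02M; apply: mx | apply: mv].
Qed.

Definition trace0 : set 'rV[R]_r := [set t | entries mm2 t /\ trace_co t = 0].

(* [trace_co] pairs tuples in m^2 with the generators of E = Hom_k(R, k): the rows of B
   span the linear syzygies of E, and exactness of D along rows is what makes them cover. *)
Lemma canonical_cover : exists q (B : 'M[R]_(q, r)),
  [/\ entries V B, forall i v, V v -> trace_co (v *: row i B) = 0
    & covers trace0 B].
Proof.
pose X := [set q : 'rV[R]_r | entries V q /\ forall v, V v -> trace_co (v *: q) = 0].
have kVr : ksub iota (@entries R V 1 r) := ksub_entries kV.
have mvq v (q : 'rV[R]_r) : V v -> entries V q -> entries mm2 (v *: q).
  by move=> /Vm mv Vq i j; rewrite mxE; apply: mx02_mul => //; apply: Vm.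
have kX : ksub iota X.
  split; first by split=> [|v _]; [exact: (ksub0 kVr) | rewrite scaler0 trace_co0].
  move=> c x y [Vx Tx] [Vy Ty]; split=> [|v Vv]; first exact: kVr.2.
  rewrite scalerDr scalerA mulrC -scalerA trace_coD ?Tx ?Ty ?mulr0 ?addr0 //; exact: mvq.
have k0 : ksub iota [set (0 : 'rV[R]_r)] := ksub_set0 iota _.
have dVq q : kdim iota (@entries R V 1 q) [set 0] (q * e) := kdim_rows0 q kV dV.
have [|v [] //|p [_ [_ [g [Xg gP]] _]]] := kdim_sub kVr kX k0 _ _ (dVq r).
  by move=> _ ->; exact: (ksub0 kX).
pose B := \matrix_i g i; exists p, B; split=> [i j|i v Vv|i Z TZ].
- by rewrite mxE; apply: (Xg i).1.
- by rewrite rowK; apply: (Xg i).2.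
have [|U VU ZU] := DS_mx DS (U := Z).
  by move=> j l; have := (TZ j).1 0 l; rewrite mxE.
(* phi factors through f: if v D_{i+1} = 0 then v = y D_i over k, and v U = y Z has trace 0. The
   matrix Y so obtained makes the rows of U - D_{i+1} Y linear relations of E, and D_i kills the
   correction. *)
pose phi (v : 'rV[R]_(b i.+1)) := trace_co (v *m U).
pose f (v : 'rV[R]_(b i.+1)) := \matrix_(t, l) co ((v *m D i.+1) 0 t) 0 l.
have fE v t l : f v t l = co ((v *m D i.+1) 0 t) 0 l by rewrite mxE.
have mvU (v : 'rV[R]_(b i.+1)) : entries V v -> entries mm2 (v *m U).
  by move=> Vv; apply: (entries_VM Vm).
have mvD (v : 'rV[R]_(b i.+1)) : entries V v -> entries mm2 (v *m D i.+1).
  by move=> Vv; apply: (entries_VM Vm).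
have kVb : ksub iota (@entries R V 1 (b i.+1)) := ksub_entries kV.
have [|||Y YP] := factor_functional (f := f) (phi := phi) kVb (dVq _).
- move=> c x y Vx Vy; apply/matrixP => t l.
  rewrite [RHS]mxE [X in _ = X + _]mxE !fE mulmxDl -scalemxAl.
  have -> : (iota c *: (x *m D i.+1) + y *m D i.+1) 0 t =
      iota c * (x *m D i.+1) 0 t + (y *m D i.+1) 0 t.
    by rewrite [LHS]mxE [X in X + _ = _]mxE.
  rewrite coD; [|exact: mvD|exact: mvD].
  by rewrite [LHS]mxE [X in X + _ = _]mxE.
- by move=> c x y Vx Vy; rewrite /phi mulmxDl -scalemxAl trace_coD //; apply: mvU.
- move=> v Vv fv; have [y vE] : exists y, v = lift y *m D i.
    apply: DX => //; apply/rowP => t; rewrite [RHS]mxE.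
    apply/co0; first exact: mvD.
    by apply/rowP => l; have /matrixP/(_ t l) := fv; rewrite !mxE.
  rewrite /phi vE -mulmxA -ZU mulmx_sum_row.
  under eq_bigr do rewrite [lift _ _ _]mxE.
  rewrite trace_co_sum => [|j]; last exact: (TZ j).1.
  by rewrite big1 // => j _; rewrite (TZ j).2 mulr0.
pose W := U - D i.+1 *m lift Y.
have VW : entries V W.
  by apply: (entriesB kV) => //; apply: (entries_lift_mulr kV).
have WX j : X (row j W).
  split=> [|v Vv]; first exact: entries_row.
  pose vj : 'rV[R]_(b i.+1) := v *: delta_mx 0 j.
  have Vvj : entries V vj.
    move=> a c; rewrite !mxE; case: (_ && _); rewrite ?mulr1 ?mulr0 //.
    exact: (ksub0 kV).
  have -> : v *: row j W = iota (-1) *: (vj *m D i.+1 *m lift Y) + vj *m U.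
    rewrite rmorphN1 scaleN1r addrC -mulmxA -mulmxBr -scalemxAl -rowE //.
  rewrite trace_coD; last 2 first.
  - by apply: (entries_lift_mulr (ksub_mx02 iota res)); apply: mvD.
  - exact: mvU.
  rewrite mulN1r -/(phi vj) YP // addrC; apply/eqP; rewrite subr_eq0; apply/eqP.
  rewrite /trace_co exchange_big; apply: eq_bigr => l _ /=.
  rewrite mxE; under [in RHS]eq_bigr do rewrite [lift Y _ _]mxE mulrC.
  rewrite (coord_sum coD co0) => [|t]; last exact: mvD.
  by rewrite summxE; apply: eq_bigr => t _; rewrite !mxE mulrC.
have /choice [c cP] : forall j, exists c : 'rV[K]_p, row j W = lift c *m B.
  move=> j; have [c [/eqP + _]] := gP _ (WX j); rewrite subr_eq0 => /eqP ->.
  by exists c; rewrite mulmx_sum_row; apply: eq_bigr => l _; rewrite mxE rowK.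
exists (\matrix_j c j); rewrite ZU -mulmxA.
have -> : lift (\matrix_j c j) *m B = W.
  apply/row_matrixP => j; rewrite row_mul cP; congr (_ *m B).
  by apply/rowP => l; rewrite !mxE.
by rewrite mulmxBr [D i *m (D _ *m _)]mulmxA DD mul0mx subr0.
Qed.

Lemma canonical_complex : exists l d, let H := @complex_cons R r l d in
  [/\ forall n, entries V (diff H n), forall n, diff H n.+1 *m diff H n = 0,
      forall n, good (diff H n.+1),
      forall i v, V v -> trace_co (v *: row i (diff H 0)) = 0
    & forall t, trace0 t -> exists2 u, entries V u & t = u *m diff H 0].
Proof.
have [q [B [VB TB cB]]] := canonical_cover.
have kT0 : ksub iota trace0.
  have km : ksub iota (@entries R mm2 1 r) := ksub_entries (ksub_mx02 iota res).
  split; first by split; [apply: entries2_0 | apply: trace_co0].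
  move=> c x y [mx Tx] [my Ty]; split; first exact: km.2.
  by rewrite trace_coD // Tx Ty mulr0 addr0.
have TB0 (u : 'rV_q) : entries V u -> trace0 (u *m B).
  move=> Vu; rewrite mulmx_sum_row; apply: (ksub_sum kT0) => i _.
  split; last exact: TB.
  by move=> j t; rewrite !mxE; apply: mx02_mul; apply: Vm; [apply: Vu | apply: VB].
have [l [d /= [cG sy0 sy]]] := covers_complex kV Vm dV VD DD DS TB0 cB.
exists (fun n => if n is n'.+1 then l n' else q).
exists (fun n => match n return 'M[R]_(if n is n'.+1 then l n' else q,
   if n is n'.+1 then if n' is n''.+1 then l n'' else q else r) with
   | 0 => B | n'.+1 => d n' end).
split=> [[|n] /=|[|n] /=|n t mt|i v Vv|t Tt] //.
- by case: n => [|n]; [case: sy0 | case: (sy n)].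
- by case: sy0.
- by case: (sy n).
- by apply: (covers_surj kV VD b0 _ (cG n)) => //; apply: entries2_0.
- exact: TB.
- by apply: (covers_surj kV VD b0 _ cB) => //; apply: (ksub0 kT0).
Qed.

End Canonical.

End Complex.

End ResidueField.

(** * The linear resolution of k and the linear strand of its dual *)

Section LinearResolution.
Variables (K : fieldType) (R : comNzRingType).
Variables (iota : {rmorphism K -> R}) (res : {rmorphism R -> K}).
Hypothesis resK : cancel iota res.

Local Notation mm := (mx0 res).
Local Notation mm2 := (mx02 res).
Local Notation lift := (map_mx iota).

Hypothesis m3 : forall x y z, mm x -> mm y -> mm z -> x * y * z = 0.
Hypothesis socE : socle res = mm2.
Variables (e r : nat).
Hypothesis de : @kdim K R iota R^o mm mm2 e.
Hypothesis dr : @kdim K R iota R^o mm2 [set 0] r.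

Variable V : set R.
Hypothesis kV : ksubR iota V.
Hypothesis Vm : V `<=` mm.
Hypothesis Vdec : forall x, mm x -> exists2 v, V v & mm2 (x - v).
Hypothesis dV : @kdim K R iota R^o V [set 0] e.
Hypothesis V0 : forall x, V x -> mm2 x -> x = 0.

Local Notation linear_syzygy := (linear_syzygy iota V).
Local Notation good := (good res V).

Variables (l : nat -> nat) (d : forall n, 'M[R]_(l n, if n is n'.+1 then l n' else 1%N)).
Local Notation F := (@complex_cons R 1 l d).
Local Notation p := (rk F).
Local Notation A := (diff F).
Hypothesis goodF : forall n, good (A n).
Hypothesis sy0 : linear_syzygy (A 0) (0 : 'M_(1, 0)).
Hypothesis sy : forall n, linear_syzygy (A n.+1) (A n).

Lemma VA n : entries V (A n).
Proof. by case: n => [|n]; [case: sy0 | case: (sy n)]. Qed.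

Lemma A_complex n : A n.+1 *m A n = 0.
Proof. by case: (sy n). Qed.

Lemma A_indep n (y : 'rV_(p n.+1)) : lift y *m A n = 0 -> y = 0.
Proof. by case: n y => [|n] y; [case: sy0 => _ _ _ | case: (sy n) => _ _ _]; apply. Qed.

Lemma linear_basis_ideal (v : 'rV[R]_1) : entries mm v ->
  exists x : 'rV_(p 1), v = x *m A 0.
Proof.
move=> mv; have [v1 [v2 [Vv1 mv2 vE]]] := mx_decomp resK Vdec v.
have v0 : map_mx res v = 0 by apply/matrixP => i j; rewrite !mxE; apply: mv.
have [y yE] : exists y, v1 = lift y *m A 0.
  by case: sy0 => _ _ ex _; apply: ex => //; apply/matrixP => i [].
have [u _ uE] := @goodF 0 _ mv2.
by exists (lift y + u); rewrite mulmxDl -yE -uE vE v0 map_mx0 add0r.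
Qed.

(** A kernel vector is split by degree. The constant part vanishes by independence, the linear part
    is a linear syzygy, and the part in m^2 is reached because A_{n+1} is [good]. *)
Lemma linear_row_exact n : row_exact (A n.+1) (A n).
Proof.
split=> [|v vA]; first exact: A_complex.
have [v1 [v2 [Vv1 mv2 vE]]] := mx_decomp resK Vdec v.
move: vA; rewrite {1}vE !mulmxDl (mul_mx02_V m3 Vm mv2 (@VA n)) addr0.
have V0A : entries V (lift (map_mx res v) *m A n).
  by apply: (entries_lift_mull kV); apply: VA.
have m1A : entries mm2 (v1 *m A n) by apply: (entries_VM Vm) => //; apply: VA.
case/(entries_disjoint V0 V0A m1A) => /A_indep v0 v1A.
have [y yE] : exists y, v1 = lift y *m A n.+1 by case: (sy n) => _ _ ex _; apply: ex.
have [u _ uE] := goodF mv2.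
by exists (lift y + u); rewrite mulmxDl -yE -uE vE v0 map_mx0 add0r.
Qed.

(** The strand 0 -> k^{p_{n+2}} -> V^{p_{n+1}} -> (m^2)^{p_n} -> 0 is exact: the kernel is known by
    [linear_syzygy], surjectivity is [good]. *)
Lemma linear_betti : [/\ p 0 = 1%N, p 1 = e
  & forall n, (p n.+2 + p n * r = p n.+1 * e)%N].
Proof.
have kVq q : ksub iota (@entries R V 1 q) := ksub_entries kV.
have dVq q : kdim iota (@entries R V 1 q) [set 0] (q * e) := kdim_rows0 q kV dV.
have kmq q : ksub iota (@entries R mm2 1 q) := ksub_entries (ksub_mx02 iota res).
have dmq q : kdim iota (@entries R mm2 1 q) [set 0] (q * r).
  exact: (kdim_rows0 q (ksub_mx02 iota res) dr).
have lA q t (B : 'M[R]_(q, t)) : klinear iota (fun v : 'rV[R]_q => v *m B).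
  by move=> c x y; rewrite mulmxDl scalemxAl.
have k0 q : ksub iota [set (0 : 'rV[R]_q)] := ksub_set0 iota _.
split=> // [|n].
  apply: (kdim_uniq (kVq 1%N) (k0 _)); last by have := dVq 1%N; rewrite mul1n.
  apply: kdim_ext (linear_syzygy_kdim sy0) => // v; split=> [[]|Vv] //.
  by split=> //; apply/matrixP => i [].
pose Y := [set v : 'rV[R]_(p n.+1) | entries V v /\ v *m A n = 0].
have kY : ksub iota Y.
  exact: (ksubI (kVq _) (ksub_preimage (lA _ _ (A n)) (k0 _))).
have [||a [c [<- dY dVY]]] := kdim_sub (kVq _) kY (k0 _) _ _ (dVq (p n.+1)).
- by move=> _ ->; exact: (ksub0 kY).
- by move=> v [].
congr (_ + _)%N.
  exact: (kdim_uniq kY (k0 _) (linear_syzygy_kdim (sy n)) dY).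
apply: (kdim_uniq (kmq _) (k0 _) (dmq _)).
apply: (proj1 (kdim_map (lA _ _ (A n)) (k0 _) _ _ _ (kVq _)) dVY) => v.
- by move=> Vv; apply: (entries_VM Vm) => //; apply: VA.
- by move=> /goodF [u Vu ->]; exists u.
- by move=> Vv; split=> [[]|].
Qed.

(** For a nonzero s in m^2, the tuple s e_i is of the form u A_n, so s z_i = u A_n z = 0 and the
    scalar z_i vanishes. *)
Lemma linear_indep_col n (z : 'cV[K]_(p n)) : (0 < r)%N ->
  A n *m lift z = 0 -> z = 0.
Proof.
move=> r0 Az; have [g [mg gP]] := dr.
pose s := g (Ordinal r0).
have sn0 : s <> 0.
  have [c [_ cu]] := gP _ (mg (Ordinal r0)).
  move=> s0; have E : c = delta_mx 0 (Ordinal r0).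
    by apply: cu; rewrite /= -[\sum_i _]/(kcomb iota g _) kcomb_delta subrr.
  have : c = 0.
    by apply: cu; rewrite /= -[\sum_i _]/(kcomb iota g _) kcomb0 subr0; exact: s0.
  by rewrite E => /rowP/(_ (Ordinal r0)); rewrite !mxE !eqxx => /eqP; rewrite oner_eq0.
apply/colP => i; rewrite [RHS]mxE; apply: contrapT => /eqP zi; apply: sn0.
have [|u _ uE] := @goodF n (s *: delta_mx 0 i).
  by move=> j t; rewrite mxE mulrC; apply: mx02M; apply: mg.
have : (s *: delta_mx 0 i : 'rV_(p n)) *m lift z = 0 by rewrite uE -mulmxA Az mulmx0.
rewrite -scalemxAl -rowE => /matrixP/(_ 0 0); rewrite !mxE => sz.
have zV : iota (z i 0) * iota (z i 0)^-1 = 1 by rewrite -rmorphM divff // rmorph1.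
by rewrite -[s]mulr1 -zV mulrA sz mul0r.
Qed.

(** The entries of A_0 generate m, so u lies in the socle m^2, which meets V in 0. *)
Lemma linear_socle_col (u : 'cV_(p 0)) : entries V u -> A 0 *m u = 0 -> u = 0.
Proof.
move=> Vu Au; apply/colP => i; rewrite [RHS]mxE; apply: V0 => //.
rewrite -socE => y my; have [|x xE] := @linear_basis_ideal (const_mx y).
  by move=> a b; rewrite mxE.
have : (const_mx y : 'rV_1) *m u = 0 by rewrite xE -mulmxA Au mulmx0.
by move=> /matrixP/(_ 0 0); rewrite !mxE big_ord1 mxE mulrC (ord1 i).
Qed.

Section Balance.
Variable H : free_complex R.
Hypothesis VH : forall n, entries V (diff H n).
Hypothesis HH : forall n, diff H n.+1 *m diff H n = 0.
Hypothesis goodH : forall n, good (diff H n.+1).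

Lemma goodH_col n t (X : 'M_(rk H n.+1, t)) : entries mm2 X ->
  exists2 U : 'M_(rk H n.+2, t), entries V U & X = (diff H n.+1)^T *m U.
Proof.
move=> mX; have /choice [u uP] : forall i, exists u : 'rV_(rk H n.+2),
    entries V u /\ (col i X)^T = u *m diff H n.+1.
  move=> i; have [|u Vu uE] := @goodH n (col i X)^T; last by exists u.
  by move=> a b; rewrite !mxE.
exists (\matrix_i u i)^T => [i j|]; first by rewrite !mxE; apply: (uP j).1.
rewrite -trmx_mul; apply: trmx_inj; rewrite trmxK; apply/row_matrixP => i.
by rewrite -tr_col row_mul rowK (uP i).2.
Qed.

(* The chase comparing Tor(k, E) computed from a resolution of k with Tor(k, E) computed
   from a resolution of E = Hom_k(R, k); each step trades a syzygy of k for one of E. *)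
Lemma balance n j (X : 'M_(rk H j, p n.+1)) (y : 'M_(rk H j.+1, p n)) :
  entries V X -> entries V y -> X *m A n = (diff H j)^T *m y ->
  exists Y Y', X = lift Y *m A n.+1 + (diff H j)^T *m lift Y'.
Proof.
elim: n j X y => [|n IH] j X y VX Vy XA.
  have [|Y yE] := linear_syzygy_mx sy0 Vy; first by apply/matrixP => i [].
  have [||Y1 XE] := linear_syzygy_mx (X := X - (diff H j)^T *m lift Y) (sy 0).
  - apply: (entriesB kV) => //; apply: (entries_lift_mulr kV) => a b.
    by rewrite mxE; apply: VH.
  - by rewrite mulmxBl XA -mulmxA -yE subrr.
  by exists Y1, Y; rewrite -XE subrK.
have [|y' Vy' yA] := @goodH_col j _ (y *m A n).
  by apply: (entries_VM Vm) => //; apply: VA.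
have [Y [Y' yE]] := IH _ _ _ Vy Vy' yA.
have [||Y1 XE] := linear_syzygy_mx (X := X - (diff H j)^T *m lift Y) (sy n.+1).
- apply: (entriesB kV) => //; apply: (entries_lift_mulr kV) => a b.
  by rewrite mxE; apply: VH.
- rewrite mulmxBl XA yE mulmxDr [_ *m ((diff H j.+1)^T *m _)]mulmxA.
  by rewrite -trmx_mul HH trmx0 mul0mx addr0 mulmxA subrr.
by exists Y1, Y; rewrite -XE subrK.
Qed.

End Balance.

Section Functionals.
Variable co : R -> 'rV[K]_r.
Hypothesis coD : forall a x y, mm2 x -> mm2 y ->
  co (iota a * x + y) = a *: co x + co y.
Hypothesis co0 : forall x, mm2 x -> x = 0 <-> co x = 0.

Local Notation trace_co := (trace_co co).

Variables (h : nat -> nat) (g : forall n, 'M[R]_(h n, if n is n'.+1 then h n' else r)).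
Local Notation H := (@complex_cons R r h g).
Hypothesis VH : forall n, entries V (diff H n).
Hypothesis HH : forall n, diff H n.+1 *m diff H n = 0.
Hypothesis goodH : forall n, good (diff H n.+1).
Hypothesis trH : forall i v, V v -> trace_co (v *: row i (diff H 0)) = 0.
Hypothesis gen0 : forall t, trace0 res co t ->
  exists2 u, entries V u & t = u *m diff H 0.

(** Otherwise a functional chi on m/m^2-tuples kills the columns of A_n and takes the value 1 at u.
    It is the trace of multiplication by a matrix X1 over V, and [balance] rewrites X1 so that the
    trace of X1 u is visibly 0. *)
Lemma linear_col_exact n (u : 'cV_(p n.+1)) : entries V u ->
  A n.+1 *m u = 0 -> exists z, u = A n *m lift z.
Proof.
move=> Vu Au.
pose Z : set 'cV[R]_(p n.+1) := entries mm.
pose Y := [set v : 'cV[R]_(p n.+1) | exists z w, entries mm2 w /\ v = A n *m lift z + w].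
have kZ : ksub iota Z := ksub_entries (ksub_mx0 iota res).
have km : ksub iota (@entries R mm2 (p n.+1) 1) := ksub_entries (ksub_mx02 iota res).
have kY : ksub iota Y.
  split; first by exists 0, 0; rewrite map_mx0 mulmx0 addr0; split=> //; exact: (ksub0 km).
  move=> c _ _ [z [w [mw ->]]] [z' [w' [mw' ->]]].
  exists (c *: z + z'), (iota c *: w + w'); split; first exact: km.2.
  by rewrite map_mxD map_mxZ mulmxDr -scalemxAr scalerDr addrACA.
have YZ : Y `<=` Z.
  move=> _ [z [w [mw ->]]] i j; rewrite mxE; apply: mx0D; last by apply: mx02_sub.
  by apply: Vm; apply: (entries_lift_mulr kV); apply: VA.
have mY : @entries R mm2 (p n.+1) 1 `<=` Y.
  by move=> w mw; exists 0, w; rewrite map_mx0 mulmx0 add0r.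
have [[z [w [mw uE]]]|nYu] := pselect (Y u).
  exists z; apply/eqP; rewrite -subr_eq0; apply/eqP.
  apply/matrixP => i j; rewrite [RHS]mxE; apply: V0.
    by apply: (entriesB kV) => //; apply: (entries_lift_mulr kV); apply: VA.
  by rewrite uE addrC addKr.
exfalso.
have mu : Z u by move=> i j; apply: Vm.
have [a [c [_ _ dZY]]] := kdim_sub kZ kY km mY YZ
  (kdim_tr (ksub_mx0 iota res) (ksub_mx02 iota res)
    (kdim_rows _ (ksub_mx0 iota res) (ksub_mx02 iota res) (@mx02_sub _ _ res) de)).
have [chi [chiD chi0 chiu]] := kdim_functional kZ kY dZY mu nYu.
have md i x : mm x -> Z (x *: delta_mx i 0).
  by move=> mx a' b; rewrite mxE mulrC; apply: mx0M.
have chi_sum (s : seq 'I_(p n.+1)) (x : 'cV[R]_(p n.+1)) : Z x ->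
    chi (\sum_(i <- s) x i 0 *: delta_mx i 0) =
    \sum_(i <- s) chi (x i 0 *: delta_mx i 0) /\
    Z (\sum_(i <- s) x i 0 *: delta_mx i 0).
  move=> mx; elim: s => [|i s [IH mIH]].
    have Z0 : Z 0 := ksub0 kZ.
    by rewrite !big_nil; split=> //; apply: chi0 => //; exact: (ksub0 kY).
  rewrite !big_cons -{1}[x i 0 *: _]scale1r -{1}(rmorph1 iota) chiD ?mul1r ?IH //.
    by split=> //; apply: (ksubD kZ) => //; apply: md; apply: mx.
  by apply: md; apply: mx.
have chiE (x : 'cV[R]_(p n.+1)) : Z x -> chi x = \sum_i chi (x i 0 *: delta_mx i 0).
  move=> mx; rewrite -(chi_sum _ _ mx).1; congr chi.
  rewrite [LHS]matrix_sum_delta; apply: eq_bigr => i _.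
  by rewrite big_ord1.
have /choice [q qP] : forall i, exists q : 'I_r -> R, (forall t, mm (q t)) /\
    forall v, mm v -> chi (v *: delta_mx i 0) = \sum_t co (q t * v) 0 t.
  move=> i; apply: (functional_rep m3 de socE coD co0).
    move=> a' x y mx my; rewrite scalerDl -scalerA chiD //; exact: md.
  move=> x mx; apply: chi0; last by apply: md; apply: mx02_sub.
  by apply: mY => a' b; rewrite mxE mulrC; apply: mx02M.
(* Only the V-part of the coefficients q acts on m, because m^2 m = 0. *)
have [X1 [X2 [VX1 mX2 QE]]] := mx_decomp resK Vdec (\matrix_(t < r, i < p n.+1) q i t).
have qX i t v : mm v -> q i t * v = X1 t i * v.
  move=> mv; have /matrixP/(_ t i) := QE; rewrite !mxE ((qP i).1 t) rmorph0 add0r => ->.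
  by rewrite mulrDl [X2 t i * v](mx02_socle m3) ?addr0 //; apply: mX2.
have chiX (x : 'cV[R]_(p n.+1)) : Z x -> chi x = \sum_t \sum_i co (X1 t i * x i 0) 0 t.
  move=> mx; rewrite chiE // exchange_big; apply: eq_bigr => i _ /=.
  rewrite (qP i).2; last exact: mx.
  by apply: eq_bigr => t _; rewrite qX //; apply: mx.
have mXA : entries mm2 (X1 *m A n) by apply: (entries_VM Vm) => //; apply: VA.
have co_add s (x : 'I_s -> R) t : (forall i, mm2 (x i)) ->
    \sum_i co (x i) 0 t = co (\sum_i x i) 0 t.
  move=> mx; have := coord_sum coD co0 (fun=> 1) mx.
  under eq_bigr do rewrite rmorph1 mul1r.
  by move=> ->; rewrite summxE; apply: eq_bigr => i _; rewrite scale1r.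
(* chi kills each column of A_n, so each column of X1 A_n has trace 0 and is generated, with
   coefficients in V, by the rows of H_0. *)
have [y Vy yE] : exists2 y, entries V y & X1 *m A n = (diff H 0)^T *m y.
  have /choice [y yP] : forall j, exists y : 'rV_(rk H 1), entries V y /\
      (col j (X1 *m A n))^T = y *m diff H 0.
    move=> j; have [|y Vy yE] := gen0 (t := (col j (X1 *m A n))^T); last by exists y.
    split; first by move=> a' b; rewrite !mxE; have := mXA b j; rewrite mxE.
    have mj : Z (A n *m lift (delta_mx j 0)).
      by apply: YZ; exists (delta_mx j 0), 0; rewrite addr0; split=> //; exact: (ksub0 km).
    have /esym : chi (A n *m lift (delta_mx j 0)) = 0.
      apply: chi0 => //; exists (delta_mx j 0), 0.
      by rewrite addr0; split=> //; exact: (ksub0 km).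
    rewrite chiX // => ->; apply: eq_bigr => t _.
    rewrite map_delta_mx -colE !mxE co_add => [|i]; first by under [in RHS]eq_bigr do rewrite mxE.
    by rewrite mxE; apply: mx02_mul; apply: Vm; [apply: VX1 | apply: VA].
  exists (\matrix_j y j)^T => [i j|]; first by rewrite !mxE; apply: (yP j).1.
  rewrite -trmx_mul; apply: trmx_inj; rewrite trmxK; apply/row_matrixP => i.
  by rewrite -tr_col row_mul rowK (yP i).2.
(* In X1 u the term with A_{n+1} u disappears, and what remains combines V-multiples of rows of H_0,
   of trace 0 by [trH]. *)
have [Y1 [Y2 XE]] := balance VH HH goodH (j := 0) VX1 Vy yE.
have V1 : entries V (lift Y1 *m A n.+1) by apply: (entries_lift_mull kV); apply: VA.
have V2 : entries V ((diff H 0)^T *m lift Y2).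
  by apply: (entries_lift_mulr kV) => i j; rewrite mxE; apply: VH.
have : chi u = 0; last by rewrite chiu => /eqP; rewrite oner_eq0.
rewrite chiX //.
have -> : \sum_t \sum_i co (X1 t i * u i 0) 0 t =
   \sum_t co ((X1 *m u) t 0) 0 t.
  apply: eq_bigr => t _; rewrite mxE co_add // => i.
  by apply: mx02_mul; apply: Vm.
rewrite XE mulmxDl -mulmxA Au mulmx0 add0r.
have E : ((diff H 0)^T *m lift Y2 *m u)^T =
  \sum_j \sum_i iota (Y2 j i) *: (u i 0 *: row j (diff H 0)).
  rewrite !trmx_mul trmxK mulmxA mulmx_sum_row; apply: eq_bigr => j _.
  rewrite !mxE scaler_suml; apply: eq_bigr => i _; rewrite !mxE.
  by rewrite scalerA mulrC.
have m3' (i : 'I_(p n.+1)) j : entries mm2 (u i 0 *: row j (diff H 0)).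
  by move=> a' b; rewrite !mxE; apply: mx02_mul; apply: Vm; [apply: Vu|apply: VH].
transitivity (trace_co ((diff H 0)^T *m lift Y2 *m u)^T).
  by apply: eq_bigr => t _; rewrite [_^T 0 t]mxE.
rewrite E pair_bigA /=.
pose T := fun ji : 'I_(rk H 1) * 'I_(p n.+1) => u ji.2 0 *: row ji.1 (diff H 0).
suff [] : trace_co (\sum_ji iota (Y2 ji.1 ji.2) *: T ji) = 0 /\
   entries mm2 (\sum_ji iota (Y2 ji.1 ji.2) *: T ji) by [].
elim/big_rec: _ => [|ji x _ [IH mx]].
  by split; [exact: (trace_co0 co0) | exact: entries2_0].
have mT : entries mm2 (T ji) by apply: m3'.
split; first by rewrite (trace_coD coD) // IH trH ?mulr0 ?addr0 //; apply: Vu.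
move=> a' b; rewrite !mxE; apply: mx02D; last exact: mx.
by apply: mx02M; have := mT a' b; rewrite !mxE.
Qed.

End Functionals.

End LinearResolution.

(** * Gradings, Tor, Ext and the Koszul property *)

(** Pieces outside s vanish, so finitely supported sums over all indices reduce to sums over s. *)
Lemma direct_sum_seq (I : choiceType) (W : zmodType) (D : I -> set W) (s : seq I) :
  uniq s -> (forall i, is_subgroup (D i)) ->
  (forall i, i \notin s -> D i = [set 0]) ->
  (forall x, exists f : I -> W, (forall i, i \in s -> D i (f i)) /\ x = \sum_(i <- s) f i) ->
  (forall f : I -> W, (forall i, i \in s -> D i (f i)) -> \sum_(i <- s) f i = 0 ->
     forall i, i \in s -> f i = 0) ->
  is_direct_sum D.
Proof.
move=> us gD D0 ex un x.
have sumE (f : I -> W) : (forall i, D i (f i)) ->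
    \sum_(i \in [set: I]) f i = \sum_(i <- s) f i.
  move=> Df; rewrite (fsbigE s f us) => [|//|i _ /D0 E]; last by have := Df i; rewrite E.
  apply: eq_bigl => i; exact: mem_set.
have [f [Df xE]] := ex x.
pose g i := if i \in s then f i else 0.
have Dg i : D i (g i) by rewrite /g; case: ifP => [/Df //|_]; case: (gD i).
exists g; split=> [|h [Dh _ xh]].
  split=> //.
    apply: sub_finite_set (finite_seq s) => i /=; rewrite /g.
    by case: ifP => // _; rewrite eqxx.
  rewrite sumE // xE; apply: eq_big_seq => i si; by rewrite /g si.
apply/funext => i; case: (boolP (i \in s)) => [si|nsi]; last first.
  by have := Dh i; rewrite /g (negPf nsi) (D0 _ nsi) => ->.
apply/eqP; rewrite -subr_eq0; apply/eqP.
apply: (un (fun i => g i - h i)) => // [j _|].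
  exact: (gD j).2.
rewrite sumrB -(sumE h) // -xh xE; apply/eqP; rewrite subr_eq0; apply/eqP.
by apply: eq_big_seq => j sj; rewrite /g sj.
Qed.

Section QuotientMap.
Variables (R : comNzRingType) (m : idealr R).
Local Notation Q := {ideal_quot m}.

Definition quot_map (v : 'rV[R]_1) : Q := \pi_Q (v 0 0).

Lemma quot_map_is_linear : linear quot_map.
Proof.
by move=> a u v; rewrite /quot_map !mxE !piE.
Qed.

HB.instance Definition _ :=
  GRing.isLinear.Build R 'rV[R]_1 Q *:%R quot_map quot_map_is_linear.

Lemma quot_eq0 x : \pi_Q x = 0 <-> x \in m.
Proof.
split=> [h|xm].
  by rewrite -[x]subr0 Quotient.idealrBE; apply/eqP; rewrite h !piE.
by have := Quotient.idealrBE m x 0; rewrite subr0 xm => /esym/eqP ->; rewrite !piE.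
Qed.

Lemma quot_scale a x : a *: (\pi_Q x) = \pi_Q (a * x).
Proof. by rewrite [LHS]/(\pi_Q a * \pi_Q x) rmorphM. Qed.

Lemma quot_annihilated a (x : Q) : a \in m -> a *: x = 0.
Proof.
move=> am; rewrite -[x]reprK quot_scale; apply/quot_eq0.
by rewrite mulrC idealMr.
Qed.

End QuotientMap.

Section ColumnHom.
Variables (R : comNzRingType) (p : nat).

Definition col_hom (u : 'cV[R]_p) (v : 'rV[R]_p) : R^o := (v *m u) 0 0.

Lemma col_hom_is_linear u : linear (col_hom u).
Proof. by move=> a v w; rewrite /col_hom mulmxDl -scalemxAl !mxE. Qed.

HB.instance Definition _ u :=
  GRing.isLinear.Build R 'rV[R]_p R^o *:%R (col_hom u) (col_hom_is_linear u).

Lemma col_homE (f : {linear 'rV[R]_p -> R^o}) v :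
  f v = col_hom (\col_i f (delta_mx 0 i)) v.
Proof.
rewrite /col_hom mxE {1}[v]row_sum_delta linear_sum; apply: eq_bigr => i _.
by rewrite linearZ mxE.
Qed.

Lemma col_hom_eq0 (u : 'cV[R]_p) : (forall v, col_hom u v = 0) -> u = 0.
Proof.
move=> h; apply/colP => i; have := h (delta_mx 0 i).
by rewrite /col_hom -rowE !mxE.
Qed.

End ColumnHom.

(** The second isomorphism theorem, for Z = W + B. *)
Lemma kdim_rel (K : fieldType) (R : comNzRingType) (iota : {rmorphism K -> R})
    (N : lmodType R) (W Z B : set N) n :
  ksub iota W -> ksub iota Z -> ksub iota B -> W `<=` Z ->
  (forall z, Z z -> exists2 w, W w & B (z - w)) ->
  kdim iota W (W `&` B) n -> kdim iota Z B n.
Proof.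
move=> kW kZ kB WZ dec [g [Wg gP]]; exists g; split=> [i|z Zz]; first exact: WZ.
have [w Ww Bzw] := dec z Zz; have [c [[_ Bc] cu]] := gP w Ww.
have E (d : 'rV[K]_n) : B (z - kcomb iota g d) <-> B (w - kcomb iota g d).
  by apply: (ksub_eqD kB); rewrite opprB addrA subrK.
exists c; split=> [|d /E Bd]; first exact/E.
by apply: cu; split=> //; apply: (ksubB kW) => //; apply: ksub_kcomb.
Qed.

(** * The grading of R *)

Section Grading.
Variables (K : fieldType) (R : comNzRingType).
Variables (iota : {rmorphism K -> R}) (res : {rmorphism R -> K}).
Hypothesis resK : cancel iota res.

Local Notation mm := (mx0 res).
Local Notation mm2 := (mx02 res).
Local Notation lift := (map_mx iota).

Hypothesis m3 : forall x y z, mm x -> mm y -> mm z -> x * y * z = 0.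
Variable r : nat.
Hypothesis dr : @kdim K R iota R^o mm2 [set 0] r.

Variable V : set R.
Hypothesis kV : ksubR iota V.
Hypothesis Vm : V `<=` mm.
Hypothesis Vdec : forall x, mm x -> exists2 v, V v & mm2 (x - v).
Hypothesis dV : @kdim K R iota R^o V [set 0] r.+1.
Hypothesis V0 : forall x, V x -> mm2 x -> x = 0.

(** Any complement V of m^2 in m serves: products of two elements of V lie in m^2, and products of
    total degree at least 3 vanish by m^3 = 0. *)
Definition short_grading (n : nat) : set R :=
  match n with 0 => range iota | 1 => V | 2 => mm2 | _ => [set 0] end.

Local Notation G := short_grading.

Lemma ksub_subgroup (N : lmodType R) (Z : set N) : ksub iota Z -> is_subgroup Z.
Proof. by move=> kZ; split=> [|x y]; [apply: (ksub0 kZ) | apply: (ksubB kZ)]. Qed.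

Lemma ksub_grading n : ksubR iota (G n).
Proof.
case: n => [|[|[|n]]] //; last 2 first.
- exact: ksub_mx02.
- exact: (ksub_set0 iota R^o).
split; first by exists 0; rewrite ?rmorph0.
by move=> c _ _ [a _ <-] [b _ <-]; exists (c * a + b); rewrite ?rmorphD ?rmorphM.
Qed.

Lemma grading_gt0 n x : (0 < n)%N -> G n x -> mm x.
Proof.
case: n => [|[|[|n]]] //= _; [exact: Vm | exact: mx02_sub | move=> ->; exact: mx00].
Qed.

Lemma grading_mul i j x y : G i x -> G j y -> G (i + j)%N (x * y).
Proof.
have Z x' y' n : G n x' -> G n (iota y' * x').
  by move=> Gx; apply: (ksubZ (ksub_grading n)).
case: i => [|i]; first by case=> c _ <- Gy; apply: Z.
case: j => [|j]; first by rewrite addn0 mulrC => Gx [c _ <-]; apply: Z.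
case: i => [|i]; case: j => [|j].
- by move=> Vx Vy; apply: mx02_mul; apply: Vm.
- move=> Vx; case: j => [|j] /=; first by move=> my; apply: (mulV2 m3 Vm).
  by move=> ->; rewrite mulr0.
- rewrite addn1 mulrC => + Vx; case: i => [|i] /=; first by move=> my; apply: (mulV2 m3 Vm).
  by move=> ->; rewrite mulr0.
rewrite addSn addnS /=; case: i => [|i] /=; last by move=> -> _; rewrite mul0r.
move=> mx my; rewrite (mx02_socle m3 mx) //.
exact: (@grading_gt0 j.+2).
Qed.

Lemma short_ring_grading : ring_grading G.
Proof.
split=> [i||//|//]; last 2 first.
- by exists 1; rewrite ?rmorph1.
- exact: grading_mul.
- exact: (ksub_subgroup (ksub_grading i)).
apply: (@direct_sum_seq _ R G [:: 0; 1; 2]%N) => // [i|[|[|[|]]] //|x|f Df].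
- exact: (ksub_subgroup (ksub_grading i)).
- have [v Vv mv] := Vdec (mx0_res resK x).
  exists (fun i => match i with 0 => iota (res x) | 1 => v | _ => x - iota (res x) - v end).
  split; first by case=> [|[|[|]]] //= _; exists (res x).
  by rewrite !big_cons big_nil addr0 [v + _]addrC subrK addrC subrK.
rewrite !big_cons big_nil addr0 => f0.
have [c _ cE] := Df 0%N isT; have V1 := Df 1%N isT; have m2 := Df 2%N isT.
have f00 : f 0%N = 0.
  move/(congr1 res): f0; rewrite !rmorphD rmorph0 /= (Vm V1) (mx02_sub m2) !addr0 -cE.
  by rewrite resK => ->; rewrite rmorph0.
move: f0; rewrite f00 add0r => /eqP; rewrite addr_eq0 => /eqP f1.
have f10 : f 1%N = 0.
  by apply: V0 => //; rewrite f1 -mulN1r; apply: mx02M.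
move: f1; rewrite f10 => /eqP; rewrite eq_sym oppr_eq0 => /eqP f2.
by case=> [|[|[|]]].
Qed.

Lemma short_homogeneous : homogeneous_grading iota G.
Proof.
split=> //; first exact: short_ring_grading.
have [g [Vg gP]] := dV; exists r.+1, g; split=> // S cS Sk Sg.
have SM x y : x \in S -> y \in S -> x * y \in S by case: cS => _ _; apply.
have S0 : 0 \in S by have := Sk 0; rewrite rmorph0.
have SD x y : x \in S -> y \in S -> x + y \in S.
  case: cS => _ SB _ Sx Sy; have Sny : - y \in S by rewrite -[- y]add0r; apply: SB.
  by rewrite -[y]opprK; apply: SB.
have SV x : V x -> x \in S.
  move=> /gP [c [/eqP + _]]; rewrite subr_eq0 => /eqP ->.
  by apply: (big_ind (fun z => z \in S)) => // i _; apply: SM.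
have S2 x : mm2 x -> x \in S.
  move=> [n [a [b [ab ->]]]]; apply: (big_ind (fun z => z \in S)) => // i _.
  have [ma mb] := ab i; have [v Vv mv] := Vdec ma; have [w Vw mw] := Vdec mb.
  (* Replacing each factor by its V-part changes the product by an element of m^3 = 0. *)
  have -> : a i * b i = v * w.
    rewrite -{1}[a i](subrK v) mulrDl (mx02_socle m3 mv) // add0r.
    rewrite -{1}[b i](subrK w) mulrDr [v * (_ - _)]mulrC (mx02_socle m3 mw) ?add0r //.
    exact: Vm.
  by apply: SM; apply: SV.
move=> y; have [v Vv mv] := Vdec (mx0_res resK y).
rewrite -[y](subrK (iota (res y))); apply: (SD) => //.
by rewrite -[_ - _](subrK v); apply: SD; [apply: S2 | apply: SV].
Qed.

Lemma kdim_grading0 : @kdim K R iota R^o (G 0) [set 0] 1.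
Proof.
exists (fun=> 1); split=> [_|_ [c _ <-]]; first by exists 1; rewrite ?rmorph1.
exists (const_mx c); split; first by rewrite big_ord1 mxE /= [_ *: _]mulr1 subrr.
move=> d; rewrite big_ord1 /= [_ *: _]mulr1 => /eqP; rewrite subr_eq0 => /eqP h.
by apply/rowP => i; rewrite mxE ord1; apply: (can_inj resK).
Qed.

Lemma short_hilbert : exists H : nat -> nat,
  (forall i, @kdim K R iota R^o (G i) [set 0] (H i)) /\
  series_is_frac H ((1 + 'X) * (1 + r%:R *: 'X)) 1.
Proof.
exists (fun i => match i with 0 => 1 | 1 => r.+1 | 2 => r | _ => 0 end)%N.
split=> [[|[|[|i]]]|]; [exact: kdim_grading0 | exact: dV | exact: dr | |].
  exact: (kdim_triv (ksub_set0 iota R^o)).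
split=> [|n]; first by rewrite coef1.
rewrite big_ord_recr /= subnn coef1 mulr1 big1 ?add0r => [|i _]; last first.
  by rewrite coef1 subn_eq0 leqNgt ltn_ord mulr0.
rewrite mulrDl mul1r mulrDr mulr1 -scalerAr -expr2 !coefD !coefZ coef1 coefX coefXn.
case: n => [|[|[|n]]] //=; rewrite ?mulr0 ?mulr1 ?addr0 ?add0r //.
- by rewrite natz -addn1 PoszD.
- by rewrite natz.
Qed.

Lemma zpiece0 (a : int) : zpiece G a 0.
Proof. by case: a => [n|n] //; apply: (ksub0 (ksub_grading n)). Qed.

Lemma zpiece_mul (a : int) x y : zpiece G a x -> G 1%N y -> zpiece G (a + 1) (x * y).
Proof.
case: a => [n|n]; last first.
  by move=> /= -> _; rewrite mul0r; apply: zpiece0.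
by move=> Gx Gy; rewrite -[n%:Z + 1]/(Posz (n + 1)); apply: grading_mul.
Qed.

Lemma zpiece_sum (a : int) (I : Type) (s : seq I) (F : I -> R) :
  (forall i, zpiece G a (F i)) -> zpiece G a (\sum_(i <- s) F i).
Proof.
case: a => [n|n] ZF; first by apply: (ksub_sum (ksub_grading n)) => i _; apply: ZF.
by rewrite big1 //= => i _; apply: ZF.
Qed.

Lemma linear_piece p q (s : int) (A : 'M[R]_(p, q)) i v : entries V A ->
  free_piece G (fun _ : 'I_p => s + 1) i v -> free_piece G (fun _ : 'I_q => s) i (v *m A).
Proof.
move=> VA Fv l; rewrite mxE; apply: zpiece_sum => j.
have -> : i - s = (i - (s + 1)) + 1 by rewrite opprD addrA subrK.
by apply: zpiece_mul; [apply: Fv | apply: VA].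
Qed.

End Grading.

(** * Betti and Bass numbers of the residue field *)

Section ResidueSeries.
Variables (K : fieldType) (R : comNzRingType).
Variables (iota : {rmorphism K -> R}) (res : {rmorphism R -> K}).
Hypothesis resK : cancel iota res.

Local Notation mm := (mx0 res).
Local Notation mm2 := (mx02 res).
Local Notation lift := (map_mx iota).

Hypothesis m3 : forall x y z, mm x -> mm y -> mm z -> x * y * z = 0.
Hypothesis socE : socle res = mm2.
Variable r : nat.
Hypothesis r0 : (0 < r)%N.
Hypothesis dr : @kdim K R iota R^o mm2 [set 0] r.

Variable V : set R.
Hypothesis kV : ksubR iota V.
Hypothesis Vm : V `<=` mm.
Hypothesis Vdec : forall x, mm x -> exists2 v, V v & mm2 (x - v).
Hypothesis dV : @kdim K R iota R^o V [set 0] r.+1.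
Hypothesis V0 : forall x, V x -> mm2 x -> x = 0.

Variable m : idealr R.
Hypothesis mE : forall x, x \in m <-> res x = 0.

Local Notation linear_syzygy := (linear_syzygy iota V).
Local Notation good := (good res V).
Local Notation G := (short_grading iota res V).
Local Notation Q := {ideal_quot m}.

Section Fixed.
Variables (l : nat -> nat) (d : forall n, 'M[R]_(l n, if n is n'.+1 then l n' else 1%N)).
Local Notation F := (@complex_cons R 1 l d).
Local Notation p := (rk F).
Local Notation A := (diff F).
Hypothesis goodF : forall n, good (A n).
Hypothesis sy0 : linear_syzygy (A 0) (0 : 'M_(1, 0)).
Hypothesis sy : forall n, linear_syzygy (A n.+1) (A n).

(** The recurrence p_{n+2} + r p_n = (r + 1) p_{n+1} keeps p_{n+1} - r p_n constant, and it is 1 at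
    n = 0. *)
Lemma betti_rec n : p n.+1 = (r * p n).+1.
Proof.
have [p0 p1 prec] := linear_betti dr kV Vm dV goodF sy0 sy.
elim: n => [|n IH]; first by rewrite p1 p0 muln1.
move: (p n) (p n.+1) (p n.+2) IH (prec n) => a b c -> E.
apply: (@addIn (a * r)%N); rewrite E mulnS !addSn addnC mulnC.
by rewrite [(a * r)%N]mulnC.
Qed.

Lemma VF n : entries V (A n). Proof. exact: (VA sy0 sy). Qed.

Lemma mA n i j : A n i j \in m.
Proof. by apply/mE; apply: Vm; apply: (VA sy0 sy). Qed.

Lemma quot_map_resolution : is_resolution (F := F) (@quot_map R m).
Proof.
split=> [||n].
- apply/seteqP; split=> // x _; exists (const_mx (repr x)) => //.
  by rewrite /= /quot_map mxE reprK.
- apply/seteqP; split=> [v /= /quot_eq0 /mE v0|_ [w _ <-]] /=.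
    have [|x ->] := linear_basis_ideal resK Vdec goodF sy0 (v := v); last by exists x.
    by move=> i j; rewrite (ord1 i) (ord1 j).
  apply/quot_eq0/mE; rewrite -[res _ = 0]/(mm _).
  have : entries mm (w *m A 0) by apply: entries_mx0M => i j; apply/mE/mA.
  exact.
- have [AA ex] := linear_row_exact resK m3 kV Vm Vdec V0 goodF sy0 sy n.
  apply/seteqP; split=> [v /= /ex [x ->]|_ [w _ <-]] /=; first by exists x.
  by rewrite -mulmxA AA mulmx0.
Qed.

Lemma quot_map_graded :
  is_graded_resolution G (F := F) (fun n _ => n%:Z) (@degree0_grading R Q) (@quot_map R m).
Proof.
split; first exact: quot_map_resolution.
- move=> n i v Fv; apply: (linear_piece m3 kV Vm (@VF n)) => j.
  have E : n.+1%:Z = n%:Z + 1 by rewrite -addn1 PoszD.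
  by have := Fv j; rewrite E.
- move=> i v Fv; rewrite /degree0_grading; case: eqP => // i0 /=.
  apply/quot_eq0/mE; have := Fv 0; rewrite subr0.
  case: i i0 {Fv} => [[|n]|n] // _; first exact: (grading_gt0 Vm).
  by move=> ->; exact: mx00.
Qed.

Lemma tens_diff0 n w : tens_diff F Q n w = 0.
Proof.
apply/ffunP => j; rewrite !ffunE big1 // => i _.
by rewrite quot_annihilated ?mA.
Qed.

(** F_n is generated in degree n, so its tensor product with k lives in that single degree. *)
Lemma linear_koszul : koszul G m.
Proof.
move=> i j ji; exists F, (fun n _ => n%:Z), (@quot_map R m).
split=> [|piece w [_ wp]]; first exact: quot_map_graded.
have w0 : w = 0.
  apply/ffunP => t; have := wp t; rewrite ffunE /degree0_grading subr_eq0.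
  by rewrite (negPf ji).
exists 0; last by rewrite tens_diff0 w0.
by move=> t; rewrite ffunE /degree0_grading; case: ifP.
Qed.

Lemma linear_Tor_dim n : Tor_dim iota n Q Q (p n).
Proof.
exists F; split; first by exists (@quot_map R m); exact: quot_map_resolution.
have -> : tens_boundaries F Q n = [set 0].
  apply/seteqP; split=> [_ [w _ <-]|_ ->]; first exact: tens_diff0.
  by exists 0; rewrite ?tens_diff0.
have -> : tens_cycles F Q n = setT.
  case: n => [//|n]; apply/seteqP; split=> // w _; exact: tens_diff0.
pose f (v : 'rV[R]_(p n)) : {ffun 'I_(p n) -> Q} := [ffun i => \pi_Q (v 0 i)].
have lf : klinear iota f.
  by move=> c x y; apply/ffunP => i; rewrite !ffunE !mxE quot_scale rmorphD.
have kT : ksubR iota setT := ksubT iota R^o.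
have := kdim_rows (p n) kT (ksub_mx0 iota res) (@subsetT _ _) (kdim_res resK).
rewrite muln1 => dp.
apply: (proj1 (kdim_map lf (ksub_set0 iota _) _ _ _ (ksub_entries kT)) dp) => //.
- move=> w _; exists (\row_i repr (w i)) => //.
  by apply/ffunP => i; rewrite ffunE mxE reprK.
- move=> v _; split=> [mv|/ffunP v0 i j].
    by apply/ffunP => i; rewrite !ffunE; apply/quot_eq0/mE; apply: mv.
  by have := v0 j; rewrite !ffunE (ord1 i) => /quot_eq0/mE.
Qed.

Section Bass.
Hypothesis colF : forall n (u : 'cV_(p n.+1)), entries V u ->
  A n.+1 *m u = 0 -> exists z, u = A n *m lift z.

(** The complex Hom_R(F, R), with a homomorphism recorded as the column of its values on the
    basis. *)
Definition cocyc n : set 'cV[R]_(p n) := [set u | A n *m u = 0].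
Definition cobd n : set 'cV[R]_(p n) := match n with
  | 0 => [set 0] | n'.+1 => range (fun z : 'cV[R]_(p n') => A n' *m z) end.

Arguments cocyc : clear implicits.
Arguments cobd : clear implicits.

Lemma lin_mul q t (B : 'M[R]_(q, t)) : klinear iota (fun v : 'cV[R]_t => B *m v).
Proof. by move=> c x y; rewrite mulmxDr scalemxAr. Qed.

Lemma ksub_cocyc n : ksub iota (cocyc n).
Proof. exact: (ksub_preimage (lin_mul _) (ksub_set0 iota _)). Qed.

Lemma ksub_cobd n : ksub iota (cobd n).
Proof.
case: n => [|n]; first exact: ksub_set0.
exact: (ksub_image (lin_mul _) (ksubT iota _)).
Qed.

Lemma Ext_dim_columns n b : kdim iota (cocyc n) (cobd n) b -> Ext_dim iota n Q R^o b.
Proof.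
move=> db; exists F; split; first by exists (@quot_map R m); exact: quot_map_resolution.
have lf : klinear iota (fun u : 'cV[R]_(p n) => col_hom u : {linear 'rV[R]_(p n) -> R^o}).
  move=> c x y; apply: linear_ext => v; rewrite /= /col_hom mulmxDr -scalemxAr.
  by rewrite !mxE.
have kB : ksub iota (hom_coboundaries F R^o n).
  clear; case: n => [|n]; first exact: ksub_set0.
  split; first by exists 0.
  move=> c f g [f' fE] [g' gE]; exists (iota c *: f' + g') => v.
  by rewrite /= fE gE.
have colE (f : {linear 'rV[R]_(p n) -> R^o}) : f = (col_hom (\col_i (f (delta_mx 0 i) : R)) : {linear 'rV[R]_(p n) -> R^o}).
  by apply: linear_ext => v; rewrite [LHS]col_homE.
apply: (proj1 (kdim_map lf kB _ _ _ (@ksub_cocyc n)) db).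
- by move=> u Au v; rewrite /= /col_hom -mulmxA Au mulmx0 mxE.
- move=> f cf; exists (\col_i (f (delta_mx 0 i) : R)); last by rewrite -colE.
  apply: col_hom_eq0 => v; rewrite /col_hom mulmxA.
  by rewrite -[LHS]/(col_hom _ (v *m A n)) -col_homE cf.
- move=> u _; case: n {db lf kB colE} u => [|n] u /=.
    split=> [->|u0]; first by apply: linear_ext => v; rewrite /= /col_hom mulmx0 mxE.
    by apply: col_hom_eq0 => v; have := congr1 (fun f : {linear _ -> _} => f v) u0.
  split=> [[z _ <-]|[g gE]].
    by exists (col_hom z) => v; rewrite /= /col_hom mulmxA.
  exists (\col_i (g (delta_mx 0 i) : R)) => //.
  apply/eqP; rewrite -subr_eq0; apply/eqP; apply: col_hom_eq0 => v.
  have E1 : (v *m u) 0 0 = g (v *m A n) := gE v.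
  have E2 : (v *m (A n *m \col_i (g (delta_mx 0 i) : R))) 0 0 = g (v *m A n).
    by rewrite mulmxA col_homE.
  by rewrite /col_hom mulmxBr [LHS]mxE [X in _ + X]mxE E2 E1 subrr.
Qed.

Definition W n : set 'cV[R]_(p n) := entries mm2.

Arguments W : clear implicits.

Lemma kW n : ksub iota (W n).
Proof. exact: (ksub_entries (ksub_mx02 iota res)). Qed.

Lemma dW n : kdim iota (W n) [set 0] (p n * r).
Proof.
have k00 : ksubR iota [set 0] := ksub_set0 iota R^o.
have m20 : [set 0] `<=` mm2 by move=> _ ->; exact: mx020.
apply: kdim_ext (kdim_tr (ksub_mx02 iota res) k00
  (kdim_rows (p n) (ksub_mx02 iota res) k00 m20 dr)) => // v.
split=> [h|-> i j]; last by rewrite mxE.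
by apply/matrixP => i j; rewrite mxE; apply: h.
Qed.

Lemma dVc n : kdim iota (@entries R V (p n) 1) [set 0] (p n * r.+1).
Proof.
have k00 : ksubR iota [set 0] := ksub_set0 iota R^o.
have V00 : [set 0] `<=` V by move=> _ ->; exact: (ksub0 kV).
apply: kdim_ext (kdim_tr kV k00 (kdim_rows (p n) kV k00 V00 dV)) => // v.
split=> [h|-> i j]; last by rewrite mxE.
by apply/matrixP => i j; rewrite mxE; apply: h.
Qed.

Lemma W_cocyc n : W n `<=` cocyc n.
Proof.
move=> w mw; apply: (mul_V_mx02 m3 Vm); [exact: (VA sy0 sy) | exact: mw].
Qed.

(** Ext is carried by columns over m^2: the constant part of a cocycle is 0 by independence of the
    columns of A_n, and its linear part is a coboundary by [colF], or 0 when n = 0. *)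
Lemma cocyc_decomp n (u : 'cV_(p n)) : cocyc n u ->
  exists2 w, W n w & cobd n (u - w).
Proof.
move=> Au; have [u1 [u2 [Vu1 mu2 uE]]] := mx_decomp resK Vdec u.
exists u2 => //; move: Au; rewrite /cocyc /= {1}uE !mulmxDr (W_cocyc mu2) addr0.
have V0A : entries V (A n *m lift (map_mx res u)).
  by apply: (entries_lift_mulr kV); apply: (VA sy0 sy).
have m1A : entries mm2 (A n *m u1) by apply: (entries_VM Vm) => //; apply: (VA sy0 sy).
case/(entries_disjoint V0 V0A m1A) => /(linear_indep_col dr goodF r0) ures Au1.
rewrite uE ures map_mx0 add0r addrK; case: n u u1 {u2 mu2 uE V0A m1A ures} Vu1 Au1 => [|n] u u1 Vu1 Au1.
  exact: (linear_socle_col resK socE Vdec V0 goodF sy0 Vu1 Au1).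
by have [z ->] := colF Vu1 Au1; exists (lift z).
Qed.

Lemma Ext_dim0 : Ext_dim iota 0 Q R^o r.
Proof.
apply: Ext_dim_columns; apply: (kdim_rel (@kW 0) (@ksub_cocyc 0) (ksub_cobd 0) (@W_cocyc 0) (@cocyc_decomp 0)).
apply: kdim_ext (dW 0) => //; last by rewrite mul1n.
by move=> w; split=> [->|[]//]; split=> //; exact: (ksub0 (@kW 0)).
Qed.

(** Linear cocycles are the k-combinations of the independent columns of the preceding differential;
    for n = 0 there is none. *)
Lemma kdim_kernel n :
  kdim iota [set x : 'cV[R]_(p n) | entries V x /\ A n *m x = 0] [set 0]
    (if n is n'.+1 then p n' else 0%N).
Proof.
case: n => [|n].
  have K0 (x : 'cV_(p 0)) : (entries V x /\ A 0 *m x = 0) <-> x = 0.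
    split=> [[Vx Ax]|->]; first exact: (linear_socle_col resK socE Vdec V0 goodF sy0 Vx Ax).
    by split; [move=> i j; rewrite mxE; apply: (ksub0 kV) | rewrite mulmx0].
  by apply: kdim_ext (kdim_triv (ksub_set0 iota 'cV[R]_(p 0))) => // x; split=> [/K0|/K0].
exists (fun i => A n *m lift (delta_mx i 0)).
have sumE (c : 'rV[K]_(p n)) : \sum_i iota (c 0 i) *: (A n *m lift (delta_mx i 0)) =
    A n *m lift c^T.
  rewrite [in RHS](matrix_sum_delta c^T) map_mx_sum mulmx_sumr.
  apply: eq_bigr => i _; rewrite big_ord1 map_mxZ -scalemxAr.
  by rewrite !mxE.
split=> [i|x [Vx Ax]].
  split; first by apply: (entries_lift_mulr kV); apply: (VA sy0 sy).
  by rewrite mulmxA (A_complex sy) mul0mx.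
have [z zE] := colF Vx Ax; exists z^T; split=> [|y].
  by rewrite /= sumE trmxK zE subrr.
rewrite /= sumE zE -mulmxBr -map_mxB => /(linear_indep_col dr goodF r0) /eqP.
by rewrite subr_eq0 => /eqP ->; rewrite trmxK.
Qed.

(** Ext^{n+1}(k, R) is (m^2)^{p_{n+1}} modulo A_n V^{p_n}, and the latter has dimension (r + 1) p_n
    minus that of the linear cocycles. The additive form avoids truncated subtraction. *)
Lemma Ext_dimS n : exists2 b, Ext_dim iota n.+1 Q R^o b &
  (b + p n * r.+1 = p n.+1 * r + (if n is n'.+1 then p n' else 0))%N.
Proof.
have kVn q : ksub iota (@entries R V q 1) := ksub_entries kV.
pose Kn : set 'cV[R]_(p n) := [set x | entries V x /\ A n *m x = 0].
have kK : ksub iota Kn := ksubI (kVn _) (@ksub_cocyc n).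
have [||a [c [acE dK dVK]]] := kdim_sub (kVn _) kK (ksub_set0 iota _) _ _ (dVc n).
- by move=> _ ->; exact: (ksub0 kK).
- by move=> x [].
pose Y : set 'cV[R]_(p n.+1) := (fun x => A n *m x) @` entries V.
have kY : ksub iota Y := ksub_image (lin_mul _) (kVn _).
have YW : Y `<=` W n.+1.
  by move=> _ [x Vx <-]; apply: (entries_VM Vm) => //; apply: (VA sy0 sy).
have dY : kdim iota Y [set 0] c.
  apply: (proj1 (kdim_map (lin_mul (A n)) (ksub_set0 iota _) _ _ _ (kVn _)) dVK) => x.
  - by move=> Vx; exists x.
  - by move=> [x' Vx' <-]; exists x'.
  - by move=> Vx; split=> [[]|].
have [|c' [b [cbE dY' dWY]]] := kdim_sub (@kW n.+1) kY (ksub_set0 iota _) _ YW (dW n.+1).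
  by move=> _ ->; exact: (ksub0 kY).
have cc : c' = c := kdim_uniq kY (ksub_set0 iota _) dY' dY.
exists b.
  apply: Ext_dim_columns; apply: (kdim_rel (@kW n.+1) (@ksub_cocyc n.+1) (ksub_cobd n.+1) (@W_cocyc n.+1) (@cocyc_decomp n.+1)).
  (* A coboundary A_n z over m^2 comes from the linear part of z: the constant part contributes over
     V, hence 0, and A_n kills m^2. *)
  apply: kdim_ext dWY => // w; split=> [Yw|[mw [z _ zw]]].
    by split; [exact: YW | case: Yw => x _ <-; exists x].
  have [z1 [z2 [Vz1 mz2 zE]]] := mx_decomp resK Vdec z.
  move: zw; rewrite zE !mulmxDr (W_cocyc mz2) addr0 => /eqP; rewrite -subr_eq0 -addrA => /eqP.
  have V0A : entries V (A n *m lift (map_mx res z)).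
    by apply: (entries_lift_mulr kV); apply: (VA sy0 sy).
  have m1A : entries mm2 (A n *m z1 - w).
    apply: (ksubB (@kW n.+1)) => //.
    by apply: (entries_VM Vm) => //; apply: (VA sy0 sy).
  case/(entries_disjoint V0 V0A m1A) => _ /eqP; rewrite subr_eq0 => /eqP <-.
  by exists z1.
have aE := kdim_uniq kK (ksub_set0 iota _) dK (kdim_kernel n).
by rewrite -aE -cbE cc -acE [(a + c)%N]addnC addnA [(b + c)%N]addnC.
Qed.

End Bass.

End Fixed.

End ResidueSeries.

(** * Self-injectivity and resolutions *)

Section LinearOf.
Variables (R : comNzRingType) (U W : lmodType R).

Definition linear_of (f : U -> W) (h : linear f) : U -> W := f.

HB.instance Definition _ f h :=
  GRing.isLinear.Build R U W *:%R (@linear_of f h) h.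

End LinearOf.

Section SelfInjective.
Variables (K : fieldType) (R : comNzRingType) (res : {rmorphism R -> K}).
Local Notation mm := (mx0 res).
Hypothesis m3 : forall x y z, mm x -> mm y -> mm z -> x * y * z = 0.
Hypothesis unitP : forall x, res x <> 0 -> exists y, x * y = 1.
Hypothesis hom_ext : hom_extend res.

Section Extension.
Variables (A B : lmodType R) (i : {linear A -> B}) (f : {linear A -> R^o}).
Hypothesis i_inj : injective i.

Let closedG (X : set (B * R)) := forall a x y, X x -> X y ->
  X (a *: x.1 + y.1, a * x.2 + y.2).

Let good_graph (X : set (B * R)) :=
  [/\ forall x, X (i x, f x), closedG X & forall y, X (0, y) -> y = 0].

Let graphP (X : set (B * R)) := X = set0 \/ good_graph X.

Lemma graph_f : good_graph [set p | exists x, p = (i x, f x)].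
Proof.
split=> [x|a _ _ [x ->] [y ->]|y [x [ix ->]]]; first by exists x.
  by exists (a *: x + y); rewrite !linearP.
by move: ix; rewrite -(linear0 i) => /i_inj <-; rewrite linear0.
Qed.

Lemma maximal_graph : exists X, good_graph X /\ forall Y, good_graph Y -> X `<=` Y -> Y = X.
Proof.
have [F FP Ftot|X [PX Xmax]] := @Zorn_bigcup _ graphP.
  have [[X0 [FX0 [p Xp]]]|none] := pselect (exists X, F X /\ exists p, X p); last first.
    left; apply/seteqP; split=> // p [X FX Xp]; apply: none.
    by exists X; split=> //; exists p.
  have goodF X q : F X -> X q -> good_graph X.
    by move=> FX Xq; case: (FP _ FX) => // X0'; move: Xq; rewrite X0'.
  right; split=> [x|a q q' [X FX Xq] [Y FY Yq]|y [X FX Xy]].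
  - by exists X0 => //; case: (goodF _ _ FX0 Xp).
  - case: (Ftot _ _ FX FY) => XY.
      by exists Y => //; case: (goodF _ _ FY Yq) => _ + _; apply => //; apply: XY.
    by exists X => //; case: (goodF _ _ FX Xq) => _ + _; apply => //; apply: XY.
  - by case: (goodF _ _ FX Xy) => _ _; apply.
case: PX => [X0|gX]; last first.
  exists X; split=> // Y gY XY; apply/seteqP; split=> // q Yq.
  apply: contrapT => nXq; apply: (Xmax Y); last by right.
  by split=> // YX; apply: nXq; apply: YX.
exfalso; apply: (Xmax _ _ (or_intror graph_f)); rewrite X0; split=> // h.
by have /h : [set p | exists x, p = (i x, f x)] (i 0, f 0) by exists 0.
Qed.

(** Baer's argument on a maximal partial extension. As m^3 = 0, a vector outside the domain has a
    multiple y still outside with m y inside; the map a -> value at a y is defined on m and is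
    multiplication by some e. *)
Lemma extend_hom : exists g : {linear B -> R^o}, forall x, g (i x) = f x.
Proof.
have [X [[Xf Xcl X0] Xmax]] := maximal_graph.
have X00 : X (0, 0) by have := Xf 0; rewrite !linear0.
have Xuniq b y z : X (b, y) -> X (b, z) -> y = z.
  move=> Xy Xz; have := Xcl (-1) _ _ Xy Xz; rewrite /= scaleN1r addNr => /X0.
  by rewrite mulN1r addrC => /eqP; rewrite subr_eq0 => /eqP.
pose D b := exists y, X (b, y).
have DM a b : D b -> D (a *: b).
  by move=> [y Xy]; exists (a * y); have := Xcl a _ _ Xy X00; rewrite /= !addr0.
have all_D b : D b.
  apply: contrapT => nDb.
  have [y [nDy mDy]] : exists y, ~ D y /\ forall a, mm a -> D (a *: y).
    have [mb|] := pselect (forall a, mm a -> D (a *: b)); first by exists b.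
    move=> /existsNP [a /not_implyP [ma nDa]].
    have [mab|] := pselect (forall c, mm c -> D (c *: (a *: b))); first by exists (a *: b).
    move=> /existsNP [c /not_implyP [mc nDc]].
    exists (c *: (a *: b)); split=> // t mt; rewrite !scalerA m3 // scale0r.
    by exists 0.
  have /choice [h hP] : forall a, exists z, mm a -> X (a *: y, z).
    move=> a; case: (pselect (mm a)) => [/mDy [z Xz]|na]; last by exists 0.
    by exists z.
  have [a x x' mx mx'|e eP] := hom_ext (h := h).
    have max : mm (a * x + x') by apply: mx0D => //; apply: mx0M.
    apply: (Xuniq _ _ _ (hP _ max)).
    by have := Xcl a _ _ (hP _ mx) (hP _ mx'); rewrite /= scalerDl scalerA.
  (* Sending y to e is consistent: if c y is already in the domain then c lies in m, since a unit c
     would put y there, and the old value at c y is c e. *)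
  pose Y : set (B * R) := [set p | exists c q, X q /\ p = (q.1 + c *: y, q.2 + c * e)].
  have : Y = X.
    apply: Xmax; last by move=> [q1 q2] Xq; exists 0, (q1, q2); rewrite scale0r mul0r !addr0.
    split=> [x|a _ _ [c [q [Xq ->]]] [c' [q' [Xq' ->]]]|z [c [[q1 q2] [Xq [/= E ->]]]]].
    - by exists 0, (i x, f x); rewrite scale0r mul0r !addr0.
    - exists (a * c + c'), (a *: q.1 + q'.1, a * q.2 + q'.2); split; first exact: Xcl.
      by rewrite /= !scalerDr !scalerDl !mulrDr !mulrDl scalerA -mulrA !addrA
        ![_ + _ + q'.1]addrAC ![_ + _ + q'.2]addrAC.
    - have cy : c *: y = (-1) *: q1.
        by rewrite scaleN1r; apply/eqP; rewrite -addr_eq0 addrC -E.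
      have mc : mm c.
        apply: contrapT => /unitP [u cu]; apply: nDy.
        rewrite -[y]scale1r -cu mulrC -scalerA cy scalerA; apply: DM.
        by exists q2.
      have Xc := hP _ mc; rewrite cy in Xc.
      have := Xcl (-1) _ _ Xq X00; rewrite /= !addr0 => Xq'.
      rewrite -eP // (Xuniq _ _ _ Xc Xq') mulN1r subrr //.
  move=> YX; apply: nDy; exists e; rewrite -YX; exists 1, (0, 0).
  by rewrite scale1r mul1r !add0r.
have /choice [g gP] := all_D.
have lg : linear (g : B -> R^o).
  move=> a x y; apply: (Xuniq _ _ _ (gP _)).
  exact: (Xcl a _ _ (gP x) (gP y)).
by exists (linear_of lg) => x; apply: (Xuniq _ _ _ (gP _)).
Qed.

End Extension.

Lemma self_injective_gorenstein : gorenstein R.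
Proof.
pose E n : lmodType R := if n is 0 then R^o else 'rV[R]_0.
exists 0%N, E, idfun, (fun n => (\0 : {linear E n -> E n.+1})).
have E0 n (x : E n.+1) : x = 0 by apply/rowP; case.
split=> [[|n] A B i f i_inj|[|n] // _|x y //||n].
- exact: extend_hom.
- by exists \0 => x; rewrite [RHS]E0.
- by apply/seteqP; split=> // x _; exists x.
- by apply/seteqP; split=> [_ [x _ <-] //|x _]; exists 0 => //; rewrite [RHS]E0.
Qed.

End SelfInjective.

(** * Comparison of resolutions *)

Section Comparison.
Variable R : comNzRingType.

Lemma resolution_row_exact (M : lmodType R) (F : free_complex R)
    (eps : {linear 'rV[R]_(rk F 0) -> M}) n :
  is_resolution eps -> row_exact (diff F n.+1) (diff F n).
Proof.
case=> _ _ /(_ n) E; split=> [|v vA].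
  apply/row_matrixP => i; rewrite row_mul row0.
  suff : [set v : 'rV_(rk F n.+1) | v *m diff F n = 0] (row i (diff F n.+1)) by [].
  by rewrite E rowE; exists (delta_mx 0 i).
have : [set v : 'rV_(rk F n.+1) | v *m diff F n = 0] v by [].
by rewrite E => -[x _ <-]; exists x.
Qed.

Section Lifting.
Variables (M : lmodType R) (F F' : free_complex R).
Variables (eps : {linear 'rV[R]_(rk F 0) -> M}) (eps' : {linear 'rV[R]_(rk F' 0) -> M}).
Hypothesis resF : is_resolution eps.

Lemma lift_augmentation : exists phi : 'M[R]_(rk F' 0, rk F 0),
  forall v, eps (v *m phi) = eps' v.
Proof.
have /choice [x xP] : forall i, exists x, eps x = eps' (delta_mx 0 i).
  move=> i; have [E _ _] := resF; have : [set: M] (eps' (delta_mx 0 i)) by [].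
  by rewrite -E => -[x _ <-]; exists x.
exists (\matrix_i x i) => v; rewrite mulmx_sum_row linear_sum.
rewrite {2}[v]row_sum_delta linear_sum; apply: eq_bigr => i _.
by rewrite rowK !linearZ /= xP.
Qed.

Lemma lift_kernel t (X : 'M[R]_(t, rk F 0)) : (forall i, eps (row i X) = 0) ->
  exists Y, X = Y *m diff F 0.
Proof.
move=> X0; have [_ E _] := resF.
have /choice [y yP] : forall i, exists y, row i X = y *m diff F 0.
  move=> i; have : [set v | eps v = 0] (row i X) by apply: X0.
  by rewrite E => -[y _ <-]; exists y.
exists (\matrix_i y i); apply/row_matrixP => i.
by rewrite row_mul rowK yP.
Qed.

End Lifting.

Section Homotopy.
Variables (M : lmodType R) (F F' : free_complex R).
Variables (eps : {linear 'rV[R]_(rk F 0) -> M}) (eps' : {linear 'rV[R]_(rk F' 0) -> M}).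
Hypotheses (resF : is_resolution eps) (resF' : is_resolution eps').

Lemma eps_diff0 (G : free_complex R) (e : {linear 'rV[R]_(rk G 0) -> M}) v :
  is_resolution e -> e (v *m diff G 0) = 0.
Proof.
case=> _ E _; suff : [set v | e v = 0] (v *m diff G 0) by [].
by rewrite E; exists v.
Qed.

(** Comparison maps in both directions and a homotopy from their composite to the identity, kept
    only at positions n and n + 1. The last equation is what exactness needs to supply the next
    homotopy. *)
Lemma homotopy n : exists (phi0 : 'M_(rk F' n, rk F n)) (phi1 : 'M_(rk F' n.+1, rk F n.+1))
    (psi0 : 'M_(rk F n, rk F' n)) (psi1 : 'M_(rk F n.+1, rk F' n.+1))
    (s : 'M_(rk F' n, rk F' n.+1)),
  [/\ phi1 *m diff F n = diff F' n *m phi0, psi1 *m diff F' n = diff F n *m psi0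
    & (phi1 *m psi1 - 1%:M - diff F' n *m s) *m diff F' n = 0].
Proof.
elim: n => [|n [phi0 [phi1 [psi0 [psi1 [s [Ephi Epsi Es]]]]]]].
  have [phi0 phiP] := lift_augmentation eps' resF.
  have [psi0 psiP] := lift_augmentation eps resF'.
  have [|phi1 Ephi] := lift_kernel resF (X := diff F' 0 *m phi0).
    by move=> i; rewrite row_mul phiP rowE; apply: eps_diff0.
  have [|psi1 Epsi] := lift_kernel resF' (X := diff F 0 *m psi0).
    by move=> i; rewrite row_mul psiP rowE; apply: eps_diff0.
  have [|s Es] := lift_kernel resF' (X := phi0 *m psi0 - 1%:M).
    by move=> i; rewrite linearB /= linearB /= row_mul psiP row1 rowE phiP subrr.
  exists phi0, phi1, psi0, psi1, s; split=> //.
  rewrite !mulmxBl mul1mx -!mulmxA -Epsi [phi1 *m _]mulmxA -Ephi -!mulmxA -Es.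
  by rewrite mulmxBr mulmx1 subrr.
have exF k := resolution_row_exact k resF; have exF' k := resolution_row_exact k resF'.
have [|phi2 Ephi2] := row_exact_mx (V := diff F' n.+1 *m phi1) (exF n).
  by rewrite -mulmxA Ephi mulmxA (exF' n).1 mul0mx.
have [|psi2 Epsi2] := row_exact_mx (V := diff F n.+1 *m psi1) (exF' n).
  by rewrite -mulmxA Epsi mulmxA (exF n).1 mul0mx.
have [s' Es'] := row_exact_mx (exF' n) Es.
exists phi1, phi2, psi1, psi2, s'; split=> //.
rewrite !mulmxBl mul1mx -!mulmxA -Epsi2 [phi2 *m _]mulmxA -Ephi2 -!mulmxA -Es'.
rewrite !mulmxBr mulmx1 [diff F' n.+1 *m (diff F' n *m s)]mulmxA (exF' n).1 mul0mx.
by rewrite subr0 subrr.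
Qed.

(** A cocycle u of F' pulls back to the cocycle psi1 u = d z of F; pushing z forward and correcting
    by the homotopy gives u = d'(phi0 z - s u). *)
Lemma col_exact_transfer n :
  (forall u : 'cV_(rk F n.+1), diff F n.+1 *m u = 0 -> exists z, u = diff F n *m z) ->
  forall u : 'cV_(rk F' n.+1), diff F' n.+1 *m u = 0 -> exists z, u = diff F' n *m z.
Proof.
move=> colF u u0; have [phi0 [phi1 [psi0 [psi1 [s [Ephi Epsi Es]]]]]] := homotopy n.
have exF k := resolution_row_exact k resF; have exF' k := resolution_row_exact k resF'.
have [psi2 Epsi2] : exists psi2, diff F n.+1 *m psi1 = psi2 *m diff F' n.+1.
  apply: row_exact_mx (exF' n) _.
  by rewrite -mulmxA Epsi mulmxA (exF n).1 mul0mx.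
have [s' Es'] := row_exact_mx (exF' n) Es.
have [|z zE] := colF (psi1 *m u); first by rewrite mulmxA Epsi2 -mulmxA u0 mulmx0.
exists (phi0 *m z - s *m u).
have : (phi1 *m psi1 - 1%:M - diff F' n *m s) *m u = 0 by rewrite Es' -mulmxA u0 mulmx0.
rewrite !mulmxBl mul1mx -mulmxA zE mulmxA Ephi -!mulmxA => /eqP.
rewrite subr_eq0 subr_eq => /eqP E; rewrite mulmxBr E.
by rewrite addrC addKr.
Qed.

End Homotopy.

(** [Ext_zero] refers to some resolution of M, whereas a prescribed one has to be handled. *)
Lemma Ext_zero_col (M : lmodType R) (F : free_complex R) n :
  resolves F M -> Ext_zero n.+1 M R^o ->
  forall u : 'cV_(rk F n.+1), diff F n.+1 *m u = 0 -> exists z, u = diff F n *m z.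
Proof.
move=> [eps' resF'] [G [[eps resG] cc]].
apply: (col_exact_transfer resG resF') => u u0.
have [|g gE] := cc (col_hom u : {linear _ -> _}).
  by move=> v; rewrite /= /col_hom -mulmxA u0 mulmx0 mxE.
exists (\col_i (g (delta_mx 0 i) : R)).
apply/eqP; rewrite -subr_eq0; apply/eqP; apply: col_hom_eq0 => v.
have E1 : (v *m u) 0 0 = g (v *m diff G n) := gE v.
have E2 : (v *m (diff G n *m \col_i (g (delta_mx 0 i) : R))) 0 0 = g (v *m diff G n).
  by rewrite mulmxA col_homE.
by rewrite /col_hom mulmxBr [LHS]mxE [X in _ + X]mxE E2 E1 subrr.
Qed.

End Comparison.

Lemma iter_complex_from (R : comNzRingType) (P : forall p q, 'M[R]_(p, q) -> Prop)
    (Q : forall p q s, 'M[R]_(p, q) -> 'M[R]_(q, s) -> Prop)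
    s (X : forall q, 'M[R]_(q, s) -> Prop) :
  (forall q s (B : 'M_(q, s)), P q s B ->
     exists p, exists2 A : 'M_(p, q), P p q A & Q p q s A B) ->
  (exists q, exists2 B : 'M_(q, s), P q s B & X q B) ->
  exists l d, let F := @complex_cons R s l d in
    [/\ forall n, P _ _ (diff F n), X _ (diff F 0)
      & forall n, Q _ _ _ (diff F n.+1) (diff F n)].
Proof.
move=> step [q [B PB XB]]; have [l [d /= [PF Q0 QF]]] := iter_complex step PB.
exists (fun n => if n is n'.+1 then l n' else q).
exists (fun n => match n return 'M[R]_(if n is n'.+1 then l n' else q,
   if n is n'.+1 then if n' is n''.+1 then l n'' else q else s) with
   | 0 => B | n'.+1 => d n' end).
by split=> [[|n]||[|n]] /=.
Qed.

(** * Nakayama's lemma and minimal resolutions *)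

Section Minimal.
Variables (K : fieldType) (R : comNzRingType).
Variables (iota : {rmorphism K -> R}) (res : {rmorphism R -> K}).
Hypothesis resK : cancel iota res.

Local Notation mm := (mx0 res).
Local Notation mm2 := (mx02 res).

Hypothesis m3 : forall x y z, mm x -> mm y -> mm z -> x * y * z = 0.
Variable dimR : nat.
Hypothesis dR : @kdim K R iota R^o setT [set 0] dimR.

Lemma submodule_ksub (N : lmodType R) (S : set N) : is_submodule S -> ksub iota S.
Proof. by case=> S0 SD; split=> // c x y; apply: SD. Qed.

Definition max_mul (N : lmodType R) (S : set N) : set N :=
  [set z | exists (n : nat) (a : 'I_n -> R) (x : 'I_n -> N),
     (forall i, mm (a i) /\ S (x i)) /\ z = \sum_i a i *: x i].

Section MaxMul.
Variables (N : lmodType R) (S : set N).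
Hypothesis sS : is_submodule S.

Lemma submodule_sum (I : Type) (s : seq I) (a : I -> R) (x : I -> N) :
  (forall i, S (x i)) -> S (\sum_(i <- s) a i *: x i).
Proof.
move=> Sx; elim: s => [|i s IH]; first by rewrite big_nil; case: sS.
by rewrite big_cons; apply: sS.2.
Qed.

Lemma max_mul_sub : max_mul S `<=` S.
Proof. by move=> _ [n [a [x [ax ->]]]]; apply: submodule_sum => i; case: (ax i). Qed.

Lemma max_mul1 a x : mm a -> S x -> max_mul S (a *: x).
Proof. by move=> ma Sx; exists 1%N, (fun=> a), (fun=> x); rewrite big_ord1. Qed.

Lemma max_mul_submodule : is_submodule (max_mul S).
Proof.
split; first by exists 0%N, (fun=> 0), (fun=> 0); split=> [[]//|]; rewrite big_ord0.
move=> c _ _ [n [a [x [ax ->]]]] [n' [a' [x' [ax' ->]]]].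
pose f T (g : 'I_n -> T) (g' : 'I_n' -> T) i :=
  match fintype.split i with inl j => g j | inr j => g' j end.
exists (n + n')%N, (f _ (fun i => c * a i) a'), (f _ x x'); split=> [i|].
  rewrite /f; case: fintype.split => j //; case: (ax j) => ma Sx.
  by split=> //; apply: mx0M.
rewrite big_split_ord scaler_sumr; congr (_ + _); apply: eq_bigr => i _; rewrite /f.
  by rewrite -[lshift n' i]/(unsplit (inl i)) unsplitK scalerA.
by rewrite -[rshift n i]/(unsplit (inr i)) unsplitK.
Qed.

(* The maximal ideal is nilpotent, so no finiteness is needed for Nakayama. *)
Lemma nakayama (T : set N) : is_submodule T ->
  (forall x, S x -> exists2 t, T t & max_mul S (x - t)) -> S `<=` T.
Proof.
move=> sT dec; have kT := submodule_ksub sT.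
have TZ a x : T x -> T (a *: x).
  by move=> Tx; rewrite -[_ *: _]addr0; apply: sT.2 => //; case: sT.
have step (P : R -> Prop) : (forall a b x, P a -> mm b -> S x -> T (a *: (b *: x))) ->
    forall a x, P a -> S x -> T (a *: x).
  move=> H a x Pa Sx; have [t Tt [n [b [y [by_ xE]]]]] := dec x Sx.
  rewrite -[x](subrK t) scalerDr xE scaler_sumr; apply: (ksubD kT); last exact: TZ.
  by apply: (ksub_sum kT) => i _; case: (by_ i) => mb Sy; apply: H.
move=> x Sx; rewrite -[x]scale1r; apply: (step (fun=> True)) => // a b {Sx}x _ mb Sx.
apply: TZ; apply: (step mm) => // {mb Sx x a}b b' x mb mb' Sx.
rewrite scalerA.
pose P2 a := exists u v, [/\ mm u, mm v & a = u * v].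
apply: (step P2) => //; last by exists b, b'.
move=> _ c y [u [v [mu mv ->]]] mc Sy.
by rewrite scalerA m3 // scale0r; case: sT.
Qed.

(** Lifts of a basis of S/mS generate S by Nakayama, and a relation among them becomes trivial
    modulo m. *)
Lemma minimal_generators n : kdim iota S [set 0] n ->
  exists b (g : 'I_b -> N),
  [/\ forall i, S (g i), forall x, S x -> exists c : 'rV_b, x = \sum_i c 0 i *: g i,
      forall c : 'rV_b, \sum_i c 0 i *: g i = 0 -> entries mm c
    & kdim iota S (max_mul S) b].
Proof.
have kS := submodule_ksub sS; have kmS := submodule_ksub max_mul_submodule.
move=> dS; have [|a [b [_ _ dmS]]] := kdim_sub kS kmS (ksub_set0 iota N) _ max_mul_sub dS.
  by move=> _ ->; exact: (ksub0 kmS).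
have [g [Sg gP]] := dmS; exists b, g; split=> // [|c c0].
  pose T : set N := [set x | exists c : 'rV[R]_b, x = \sum_i c 0 i *: g i].
  apply: (@nakayama T).
    split; first by exists 0; rewrite big1 // => i _; rewrite mxE scale0r.
    move=> a' _ _ [c ->] [c' ->]; exists (a' *: c + c').
    rewrite scaler_sumr -big_split; apply: eq_bigr => i _ /=.
    by rewrite !mxE scalerDl scalerA.
  move=> x /gP [c [mc _]]; exists (\sum_i iota (c 0 i) *: g i) => //.
  by exists (map_mx iota c); apply: eq_bigr => i _; rewrite mxE.
have [d [_ du]] := gP 0 (ksub0 kS).
have E : map_mx res c = 0.
  rewrite -(du 0) ?(du (map_mx res c)) //; last first.
    by rewrite big1 ?subr0; [exact: (ksub0 kmS) | move=> i _; rewrite mxE rmorph0 scale0r].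
  rewrite -[X in X - _]c0 -sumrB; apply: (ksub_sum kmS) => i _.
  by rewrite -scalerBl mxE; apply: max_mul1 => //; apply: mx0_res.
by move=> i j; have /matrixP/(_ i j) := E; rewrite !mxE.
Qed.

End MaxMul.

Lemma kdim_free n : kdim iota [set: 'rV[R]_n] [set 0] (n * dimR).
Proof.
by apply: kdim_ext (kdim_rows0 n (ksubT iota R^o) dR) => // v; split.
Qed.

Lemma submoduleT (N : lmodType R) : is_submodule [set: N].
Proof. by []. Qed.

Lemma submodule_kernel (N N' : lmodType R) (f : {linear N -> N'}) :
  is_submodule [set x | f x = 0].
Proof.
split; first exact: linear0.
by move=> a x y /= fx fy; rewrite linearP fx fy scaler0 addr0.
Qed.

Lemma linear_klinear (N N' : lmodType R) (f : {linear N -> N'}) : klinear iota f.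
Proof. by move=> c x y; rewrite linearP. Qed.

Lemma fin_gen_kdim (M : lmodType R) : fin_gen M ->
  exists n, kdim iota [set: M] [set 0] n.
Proof.
move=> [n [g gP]].
pose f (v : 'rV[R]_n) := \sum_i v 0 i *: g i.
have lf : klinear iota f.
  move=> c x y; rewrite /f scaler_sumr -big_split; apply: eq_bigr => i _ /=.
  by rewrite !mxE scalerDl scalerA.
have kk := ksub_preimage lf (ksub_set0 iota _).
have [|a [d [_ _ dM]]] := kdim_sub (ksubT iota _) kk (ksub_set0 iota _) _
    (@subsetT _ _) (kdim_free n).
  by move=> _ ->; exact: (ksub0 kk).
exists d; apply: (proj1 (kdim_map lf (ksub_set0 iota _) _ _ _ (ksubT iota _)) dM) => //.
by move=> x _; have [c ->] := gP x; exists c.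
Qed.

Lemma minimal_syzygy p (S : set 'rV[R]_p) : is_submodule S ->
  exists q, exists2 B : 'M[R]_(q, p),
    forall v : 'rV_q, v *m B = 0 -> entries mm v
  & forall v, S v <-> exists x, v = x *m B.
Proof.
move=> sS; have [|n [_ [_ dS _]]] := kdim_sub (ksubT iota _) (submodule_ksub sS)
    (ksub_set0 iota _) _ (@subsetT _ _) (kdim_free p).
  by move=> _ ->; case: sS.
have [q [g [Sg gen ind _]]] := minimal_generators sS dS.
have E (v : 'rV[R]_q) : v *m (\matrix_i g i) = \sum_i v 0 i *: g i.
  by rewrite mulmx_sum_row; apply: eq_bigr => i _; rewrite rowK.
exists q, (\matrix_i g i) => v; first by rewrite E; apply: ind.
split=> [/gen [c ->]|[x ->]]; first by exists c; rewrite E.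
by rewrite E; apply: submodule_sum.
Qed.

Lemma minimal_resolution (M : lmodType R) : fin_gen M ->
  exists b (eps : {linear 'rV[R]_b -> M}) l d, let F := @complex_cons R b l d in
  [/\ is_resolution (F := F) eps, forall n, entries mm (diff F n),
      forall v, eps v = 0 -> entries mm v
    & kdim iota [set: M] (max_mul [set: M]) b].
Proof.
move=> /fin_gen_kdim [n dM].
have [b [g [_ gen ind dmM]]] := minimal_generators (@submoduleT M) dM.
have le : linear (fun v : 'rV[R]_b => \sum_i v 0 i *: g i).
  move=> c x y; rewrite scaler_sumr -big_split; apply: eq_bigr => i _ /=.
  by rewrite !mxE scalerDl scalerA.
pose eps : {linear 'rV[R]_b -> M} := linear_of le.
(* Minimality is carried as a condition on kernels; the rows of the next differential lie in such a
   kernel, hence in m. *)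
pose P p q (A : 'M[R]_(p, q)) := forall v : 'rV_p, v *m A = 0 -> entries mm v.
have [q s B _||l [d [PF X0 QF]]] := @iter_complex_from R P (@row_exact R) b
  (fun q B => forall v, eps v = 0 <-> exists x, v = x *m B).
- have [|p [A PA AE]] := @minimal_syzygy q [set v | v *m B = 0].
    split; first exact: mul0mx.
    by move=> a x y /= xB yB; rewrite mulmxDl -scalemxAl xB yB scaler0 addr0.
  exists p, A => //; split=> [|v vB]; last exact/AE.
  apply/row_matrixP => i; rewrite row_mul row0.
  by have /AE : exists x, row i A = x *m A by exists (delta_mx 0 i); rewrite rowE.
- have [q [B PB BE]] := minimal_syzygy (submodule_kernel eps).
  by exists q, B.
exists b, eps, l, d; split=> //.
- split=> [||k].
  + by apply/seteqP; split=> // x _; have [c ->] := gen x I; exists c.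
  + apply/seteqP; split=> [v /X0 [x ->]|_ [x _ <-]]; first by exists x.
    by apply/X0; exists x.
  + have [AA ex] := QF k; apply/seteqP; split=> [v /ex [x ->]|_ [x _ <-]]; first by exists x.
    by rewrite /= -mulmxA AA mulmx0.
- case=> [|k] i j.
    have := ind (row i (diff (complex_cons d) 0)) _ 0 j; rewrite mxE; apply.
    have /X0 // : exists x, row i (diff (complex_cons d) 0) = x *m diff (complex_cons d) 0.
    by exists (delta_mx 0 i); rewrite rowE.
  have := PF k (row i (diff (complex_cons d) k.+1)) _ 0 j; rewrite mxE; apply.
  by rewrite -row_mul (QF k).1 row0.
Qed.

Lemma resolution_acyclic (M : lmodType R) (F : free_complex R)
    (eps : {linear 'rV[R]_(rk F 0) -> M}) :
  is_resolution eps -> (forall i, (0 < i)%N -> Ext_zero i M R^o) -> acyclic F.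
Proof.
move=> resF ext n; split; first exact: resolution_row_exact resF.
split=> [|v vA].
  by rewrite -trmx_mul (resolution_row_exact n resF).1 trmx0.
have rF : resolves F M by exists eps.
have [|z zE] := Ext_zero_col rF (ext n.+1 isT) (u := v^T).
  by apply: trmx_inj; rewrite trmx_mul trmxK trmx0.
by exists z^T; rewrite -trmx_mul -zE trmxK.
Qed.

End Minimal.

(** * Modules of G-dimension zero *)

Section KernelModule.
Variables (R : comNzRingType) (M N : lmodType R) (f : {linear M -> N}).

Definition kernel_pred : {pred M} := fun x => f x == 0.

Lemma kernel_submod_closed : submod_closed kernel_pred.
Proof.
split; first by rewrite unfold_in linear0.
move=> a x y; rewrite !unfold_in => /eqP fx /eqP fy.
by rewrite linearP fx fy scaler0 addr0.
Qed.

HB.instance Definition _ := GRing.isSubmodClosed.Build R M kernel_pred kernel_submod_closed.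

Definition kernel_module := {x : M | x \in kernel_pred}.

HB.instance Definition _ := SubChoice.on kernel_module.
HB.instance Definition _ := [SubChoice_isSubLmodule of kernel_module by <:].

End KernelModule.

(** For y = u x one has f y = 1, and M is the direct sum of R y and the kernel of f. *)
Lemma unit_value_free_summand (R : comNzRingType) (M : lmodType R)
    (f : {linear M -> R^o}) x u : u * f x = 1 -> has_free_summand M.
Proof.
move=> ufx; pose y := u *: x; have fy : f y = 1 by rewrite linearZ.
have ker z : z - f z *: y \in kernel_pred f.
  by rewrite unfold_in linearB linearZ /= fy [_ *: _]mulr1 subrr.
pose N : lmodType R := kernel_module f.
pose g (z : M) : (R^o * N)%type := (f z, Sub (z - f z *: y) (ker z) : kernel_module f).
have lg : linear g.
  move=> a v w; congr (_, _); first exact: linearP.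
  apply: val_inj; rewrite [RHS]linearP /= linearP /=.
  by rewrite scalerDl scalerBr [a *: (_ *: y)]scalerA opprD addrACA.
exists N, (linear_of lg), (fun p => p.1 *: y + val p.2) => [z|[c n]] /=.
  by rewrite /linear_of /= addrC subrK.
have fn : f (val n) = 0 by apply/eqP; have := valP n; rewrite unfold_in.
have fE : f (c *: y + val n) = c by rewrite linearP /= fy fn addr0 [_ *: _]mulr1.
rewrite /linear_of /g; congr (_, _); first exact: fE.
by apply: val_inj => /=; rewrite fE addrC addKr.
Qed.

(** * Length and gradings of modules *)

Section Length.
Variables (K : fieldType) (R : comNzRingType).
Variables (iota : {rmorphism K -> R}) (res : {rmorphism R -> K}).
Hypothesis resK : cancel iota res.
Local Notation mm := (mx0 res).
Variable M : lmodType R.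

Definition chain_to (Z T : set M) (n : nat) : Prop := exists c : nat -> set M,
  [/\ c 0%N = Z, c n = T, forall i, (i <= n)%N -> is_submodule (c i)
    & forall i, (i < n)%N -> c i `<` c i.+1 /\
        forall S, is_submodule S -> c i `<=` S -> S `<=` c i.+1 ->
          S = c i \/ S = c i.+1].

Lemma chain_cons (Z Y T : set M) n : is_submodule Z -> is_submodule Y -> Z `<=` Y ->
  kdim iota Y Z 1 -> chain_to Y T n -> chain_to Z T n.+1.
Proof.
move=> sZ sY ZY dY [c [c0 cn cs cstep]].
have kZ := submodule_ksub iota sZ; have kY := submodule_ksub iota sY.
exists (fun i => if i is i'.+1 then c i' else Z); split=> // [[|i] // /cs //|[|i]] //=.
  rewrite c0 => _; split.
    split=> // YZ; have E : Y = Z by apply/seteqP.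
    by move: dY; rewrite E => /(kdim_uniq kZ kZ (kdim_triv kZ)).
  move=> S sS ZS SY; have kS := submodule_ksub iota sS.
  have [a [d [ad dSZ dYS]]] := kdim_sub kY kS kZ ZS SY dY.
  case: a ad dSZ => [|[|a]]; case: d dYS => [|[|d]] // dYS _ dSZ.
    by left; apply/seteqP; split=> //; apply: kdim0_eq dSZ.
  by right; apply/seteqP; split=> //; apply: kdim0_eq dYS.
exact: cstep.
Qed.

(** As m Z' lies in Z, every k-subspace between them is a submodule, so basis vectors of Z'/Z may be
    adjoined one at a time. *)
Lemma chain_kdim (Z Z' T : set M) q n : is_submodule Z -> is_submodule Z' ->
  Z `<=` Z' -> (forall a x, mm a -> Z' x -> Z (a *: x)) ->
  kdim iota Z' Z q -> chain_to Z' T n -> chain_to Z T (q + n).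
Proof.
move=> + sZ'; elim: q Z => [|q IH] Z sZ ZZ' mZ dZ ch.
  by have -> : Z = Z' by apply/seteqP; split=> //; apply: kdim0_eq dZ.
have kZ := submodule_ksub iota sZ; have kZ' := submodule_ksub iota sZ'.
have [e [Ze eP]] := dZ; pose g := e ord0.
pose Y : set M := [set x | exists c z, Z z /\ x = iota c *: g + z].
have ZY : Z `<=` Y by move=> z Zz; exists 0, z; rewrite rmorph0 scale0r add0r.
have YZ' : Y `<=` Z'.
  by move=> _ [c [z [Zz ->]]]; apply: kZ'.2; [apply: Ze | apply: ZZ'].
have kY : ksub iota Y.
  split; first exact: (ZY _ (ksub0 kZ)).
  move=> a _ _ [c [z [Zz ->]]] [c' [z' [Zz' ->]]].
  exists (a * c + c'), (iota a *: z + z'); split; first exact: kZ.2.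
  by rewrite rmorphD rmorphM scalerDl scalerDr scalerA addrACA.
have sY : is_submodule Y.
  split=> [|a x y Yx Yy]; first exact: (ksub0 kY).
  have -> : a *: x + y = iota (res a) *: x + ((a - iota (res a)) *: x + y).
    by rewrite addrA -scalerDl [_ + (a - _)]addrC subrK.
  apply: kY.2 => //; apply: (ksubD kY) => //; apply: ZY.
  by apply: mZ; [apply: mx0_res | apply: YZ'].
have [a [d [ad dYZ dZY]]] := kdim_sub kZ' kY kZ ZY YZ' dZ.
have dY1 : kdim iota Y Z 1.
  exists (fun=> g); split=> [_|_ [c [z [Zz ->]]]].
    by exists 1, 0; rewrite rmorph1 scale1r addr0; split=> //; exact: (ksub0 kZ).
  exists (const_mx c); split=> [|c']; first by rewrite big_ord1 mxE addrC addKr.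
  rewrite big_ord1 addrAC -scalerBl -rmorphB => Zg.
  have {}Zg : Z (iota (c - c' 0 0) *: g).
    by rewrite -[_ *: _](addrK z); apply: (ksubB kZ).
  (* The zero vector and a multiple of the first unit vector both represent 0 modulo Z; uniqueness
     makes the multiple trivial. *)
  have [t [_ tu]] := eP 0 (ksub0 kZ').
  have t0 : t = 0.
    apply: tu; rewrite big1 ?subr0; first exact: (ksub0 kZ).
    by move=> i _; rewrite mxE rmorph0 scale0r.
  have : t = (c' 0 0 - c) *: delta_mx 0 ord0.
    apply: tu; rewrite (bigD1 ord0) //= !mxE !eqxx mulr1 big1 => [|i /negPf ni].
      by rewrite addr0 sub0r -scaleNr -rmorphN opprB.
    by rewrite !mxE ni andbF mulr0 rmorph0 scale0r.
  rewrite t0 => /matrixP/(_ 0 ord0); rewrite !mxE !eqxx mulr1 => /esym/eqP.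
  by rewrite subr_eq0 => /eqP <-; apply/rowP => i; rewrite mxE ord1.
have a1 : a = 1%N := kdim_uniq kY kZ dYZ dY1.
have dq : d = q by apply/eqP; rewrite -eqSS -ad a1.
rewrite dq in dZY.
rewrite addSn; apply: (chain_cons sZ sY ZY dY1); apply: IH => // c x mc Zx.
by apply: ZY; apply: mZ.
Qed.

End Length.

Section ModuleGrading.
Variables (K : fieldType) (R : comNzRingType).
Variables (iota : {rmorphism K -> R}) (res : {rmorphism R -> K}).
Hypothesis resK : cancel iota res.

Local Notation mm := (mx0 res).
Local Notation mm2 := (mx02 res).
Local Notation lift := (map_mx iota).

Hypothesis m3 : forall x y z, mm x -> mm y -> mm z -> x * y * z = 0.

Variable V : set R.
Hypothesis kV : ksubR iota V.
Hypothesis Vm : V `<=` mm.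
Hypothesis Vdec : forall x, mm x -> exists2 v, V v & mm2 (x - v).
Hypothesis V0 : forall x, V x -> mm2 x -> x = 0.

Local Notation G := (short_grading iota res V).

(** Free summands reach degree 2, so three pieces are needed; spelling the sum out lets a grading be
    transported componentwise along a splitting of M into R and N. *)
Definition three_graded (M : lmodType R) (D : int -> set M) : Prop :=
  [/\ forall i, is_subgroup (D i), forall i, i \notin [:: 0; 1; 2%:Z] -> D i = [set 0],
      forall x, exists x0 x1 x2, [/\ D 0 x0, D 1 x1, D 2%:Z x2 & x = x0 + (x1 + x2)],
      forall x0 x1 x2, D 0 x0 -> D 1 x1 -> D 2%:Z x2 -> x0 + (x1 + x2) = 0 ->
        [/\ x0 = 0, x1 = 0 & x2 = 0]
    & forall (i : nat) (j : int) a x, G i a -> D j x -> D (i%:Z + j) (a *: x)].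

Lemma three_graded_module (M : lmodType R) (D : int -> set M) :
  three_graded D -> module_grading G D.
Proof.
case=> sD D0 ex un mulD; split=> //.
apply: (@direct_sum_seq _ M D [:: 0; 1; 2%:Z]) => // [x|f Df].
  have [x0 [x1 [x2 [D0x D1x D2x xE]]]] := ex x.
  exists (fun i => if i == 0 then x0 else if i == 1 then x1 else x2).
  split; last by rewrite !big_cons big_nil addr0.
  by move=> i; rewrite !inE => /or3P [] /eqP -> /=.
rewrite !big_cons big_nil addr0 => f0.
have [f00 f10 f20] := un _ _ _ (Df 0 isT) (Df 1 isT) (Df 2%:Z isT) f0.
by move=> i; rewrite !inE => /or3P [] /eqP ->.
Qed.

Lemma ring_decomp (x : R) : exists x0 x1 x2,
  [/\ G 0 x0, G 1%N x1, G 2%N x2 & x = x0 + (x1 + x2)].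
Proof.
have [v Vv mv] := Vdec (mx0_res resK x).
exists (iota (res x)), v, (x - iota (res x) - v); split=> //; first by exists (res x).
by rewrite [v + _]addrC subrK addrC subrK.
Qed.

Lemma ring_unique x0 x1 x2 : G 0 x0 -> G 1%N x1 -> G 2%N x2 -> x0 + (x1 + x2) = 0 ->
  [/\ x0 = 0, x1 = 0 & x2 = 0].
Proof.
move=> [c _ <-] V1 m2 /[dup] /(congr1 res).
rewrite !rmorphD rmorph0 /= (Vm V1) (mx02_sub m2) !addr0 resK => ->.
rewrite rmorph0 add0r => /eqP; rewrite addr_eq0 => /eqP x1E.
have x10 : x1 = 0 by apply: V0 => //; rewrite x1E -mulN1r; apply: mx02M.
split=> //; apply/eqP; rewrite -oppr_eq0 -x1E; exact/eqP.
Qed.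

Section Generators.
Variables (M : lmodType R) (b : nat) (g : 'I_b -> M).
Local Notation mM := (max_mul res [set: M]).
Hypothesis gP : forall z, exists! c : 'rV[K]_b, mM (z - \sum_i iota (c 0 i) *: g i).
Hypothesis m2M : forall a a' (x : M), mm a -> mm a' -> a *: (a' *: x) = 0.

Definition generator_grading (i : int) : set M := match i with
  | Posz 0 => [set x | exists c, x = kcomb iota g c]
  | Posz 1 => mM
  | _ => [set 0]
  end.

Let kmM : ksub iota mM := submodule_ksub iota (max_mul_submodule res [set: M]).

Lemma mul_mM a x : mm a -> mM x -> a *: x = 0.
Proof.
move=> ma [n [c [y [cy ->]]]]; rewrite scaler_sumr big1 // => i _.
by apply: m2M => //; case: (cy i).
Qed.

Lemma mx02_annihilates a (x : M) : mm2 a -> a *: x = 0.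
Proof.
move=> [n [c [d [cd ->]]]]; rewrite scaler_suml big1 // => i _.
by rewrite -scalerA; case: (cd i) => *; apply: m2M.
Qed.

Lemma ksub_generator_grading i : ksub iota (generator_grading i).
Proof.
case: i => [[|[|n]]|n]; [|exact: kmM|exact: ksub_set0|exact: ksub_set0].
split; first by exists 0; rewrite kcomb0.
by move=> a _ _ [c ->] [d ->]; exists (a *: c + d); rewrite kcombD.
Qed.

Lemma kcomb_mM c : mM (kcomb iota g c) -> c = 0.
Proof.
move=> mc; have [d [_ du]] := gP 0.
have dc : d = - c.
  apply: du; rewrite -[\sum_i _]/(kcomb iota g (- c)) -[- c]add0r kcombB kcomb0.
  by rewrite opprB subr0 add0r.
apply/eqP; rewrite -oppr_eq0 -dc; apply/eqP; apply: du.
by rewrite -[\sum_i _]/(kcomb iota g 0) kcomb0 subr0; exact: (ksub0 kmM).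
Qed.

Lemma generator_three_graded : three_graded generator_grading.
Proof.
split=> [i|[[|[|[|n]]]|n]|x|x0 x1 x2|[|[|[|i]]] j a x] //.
- exact: (ksub_subgroup (ksub_generator_grading i)).
- have [c [mc _]] := gP x; exists (kcomb iota g c), (x - kcomb iota g c), 0.
  by split=> //; [exists c | rewrite addr0 addrC subrK].
- move=> [c ->] m1 -> /=; rewrite addr0 => /eqP; rewrite addr_eq0 => /eqP cE.
  have c0 : c = 0 by apply: kcomb_mM; rewrite cE; apply: (ksubN kmM).
  rewrite c0 kcomb0 in cE *; split=> //; apply/eqP.
  by rewrite -oppr_eq0 -cE.
- by move=> [c _ <-] Dx; rewrite add0r; apply: (ksubZ (ksub_generator_grading j)).
- move=> Va; case: j => [[|[|n]]|n] Dx.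
  + by exists 1%N, (fun=> a), (fun=> x); rewrite big_ord1; split=> // _; split=> //; apply: Vm.
  + by rewrite (mul_mM (Vm Va) Dx).
  + by rewrite Dx scaler0; apply: (ksub0 (ksub_generator_grading _)).
  + by rewrite Dx scaler0; apply: (ksub0 (ksub_generator_grading _)).
- by move=> m2a _; rewrite mx02_annihilates //; apply: (ksub0 (ksub_generator_grading _)).
- by move=> -> _; rewrite scale0r; apply: (ksub0 (ksub_generator_grading _)).
Qed.

End Generators.

Definition torsionless (M : lmodType R) : Prop :=
  forall x : M, (forall f : {linear M -> R^o}, f x = 0) -> x = 0.

(** A functional with a unit value would split off a free summand; so f(x) is in m and f(a a' x) is
    in m^3 = 0 for every f. *)
Lemma torsionless_m2 (M : lmodType R) : torsionless M -> ~ has_free_summand M ->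
  forall a a' (x : M), mm a -> mm a' -> a *: (a' *: x) = 0.
Proof.
move=> tM nfs a a' x ma ma'; apply: tM => f; rewrite !linearZ /=.
rewrite [_ *: _]mulrA m3 //.
apply: contrapT => /(res_unit resK m3) [u fu].
by apply: nfs; apply: (unit_value_free_summand (f := f) (x := x) (u := u)); rewrite mulrC.
Qed.

(** Free summands are split off by induction on the k-dimension. Being torsionless passes to the
    complement N because functionals on M restrict to N. *)
Lemma torsionless_grading n (M : lmodType R) : kdim iota [set: M] [set 0] n ->
  torsionless M -> exists D : int -> set M, three_graded D.
Proof.
elim/ltn_ind: n M => n IH M dM tM.
have [[N [f bf]]|nfs] := pselect (has_free_summand M); last first.
  have [b [g [_ _ _ [g' [_ g'P]]]]] := minimal_generators resK m3 (submoduleT M) dM.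
  exists (generator_grading g'); apply: generator_three_graded; last exact: torsionless_m2.
  by move=> z; apply: g'P.
have [h hK fK] := bf.
have lh : linear h.
  by move=> a x y; apply: (can_inj hK); rewrite linearP /= !fK.
pose f2 (x : M) : N := (f x).2.
have lf2 : klinear iota f2 by move=> c x y; rewrite /f2 linearP.
have kB := ksub_preimage lf2 (ksub_set0 iota N).
have [|a [d [ad dB dN]]] := kdim_sub (ksubT iota M) kB (ksub_set0 iota M) _ (@subsetT _ _) dM.
  by move=> _ ->; exact: (ksub0 kB).
have dN' : kdim iota [set: N] [set 0] d.
  apply: (proj1 (kdim_map lf2 (ksub_set0 iota N) _ _ _ (ksubT iota M)) dN) => // y _.
  by exists (h (0, y)) => //; rewrite /f2 fK.
have dn : (d < n)%N.
  rewrite -ad -[X in (X < _)%N]add0n ltn_add2r lt0n; apply/eqP => a0.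
  move: dB; rewrite a0 => /kdim0_eq /(_ (h (1, 0))).
  rewrite /f2 /= fK => /(_ erefl) /(congr1 f); rewrite fK linear0 => -[] /eqP.
  by rewrite oner_eq0.
have tN : torsionless N.
  move=> y fy; have : h (0, y) = 0.
    apply: tM => phi.
    have lphi : linear ((fun z : N => phi (h (0, z))) : N -> R^o).
      move=> c u v; rewrite -linearP -lh; congr (phi (h _)).
      by congr (_, _); rewrite /= scaler0 addr0.
    exact: (fy (linear_of lphi)).
  by move/(congr1 f); rewrite fK linear0 => -[].
have [D [sD D0 ex un mulD]] := IH d dn N dN' tN.
have kG n' := ksub_grading res kV n'.
have kz i : is_subgroup (zpiece G i : set R).
  case: i => n'; first exact: (@ksub_subgroup _ _ iota R^o _ (kG n')).
  exact: (@ksub_subgroup _ _ iota R^o _ (ksub_set0 iota R^o)).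
exists (fun i => [set x | zpiece G i (f x).1 /\ D i (f x).2]); split.
- move=> i; split; first by rewrite /= linear0; split; [case: (kz i) | case: (sD i)].
  move=> x y [zx Dx] [zy Dy]; rewrite /= linearB /=.
  by split; [apply: (kz i).2 | apply: (sD i).2].
- move=> i ni; apply/seteqP; split=> [x /= [zx]|x ->]; last first.
    by rewrite /= linear0; split; [case: (kz i) | case: (sD i)].
  rewrite D0 // => Dx; apply: (can_inj hK); rewrite linear0.
  rewrite [f x]surjective_pairing Dx; congr (_, _).
  by move: ni zx {Dx}; case: i => [[|[|[|i]]]|i].
- move=> x; have [a0 [a1 [a2 [G0 G1 G2 aE]]]] := ring_decomp (f x).1.
  have [y0 [y1 [y2 [D0y D1y D2y yE]]]] := ex (f x).2.
  exists (h (a0, y0)), (h (a1, y1)), (h (a2, y2)); rewrite /= !fK; split=> //.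
  apply: (can_inj hK); rewrite !linearD /= !fK [f x]surjective_pairing aE yE //.
- move=> x0 x1 x2 [z0 D0x] [z1 D1x] [z2 D2x] /(congr1 f).
  rewrite !linearD linear0 /= => -[E1 E2].
  have [a0 a1 a2] := ring_unique z0 z1 z2 E1.
  have [b0 b1 b2] := un _ _ _ D0x D1x D2x E2.
  split; apply: (can_inj hK); rewrite linear0.
  + by rewrite [f x0]surjective_pairing a0 b0.
  + by rewrite [f x1]surjective_pairing a1 b1.
  + by rewrite [f x2]surjective_pairing a2 b2.
- move=> i j a' x Ga [zx Dx]; rewrite /= linearZ /=; split; last exact: mulD.
  case: j zx {Dx} => [j|j] /= zx; first by apply: (grading_mul m3 kV Vm).
  by rewrite zx [_ *: _]mulr0; case: (kz (i%:Z + Negz j)).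
Qed.

End ModuleGrading.

Section GDimZero.
Variables (K : fieldType) (R : comNzRingType).
Variables (iota : {rmorphism K -> R}) (res : {rmorphism R -> K}).
Hypothesis resK : cancel iota res.

Local Notation mm := (mx0 res).
Local Notation mm2 := (mx02 res).
Local Notation lift := (map_mx iota).

Hypothesis m3 : forall x y z, mm x -> mm y -> mm z -> x * y * z = 0.
Hypothesis m2n0 : exists2 z, mm2 z & z <> 0.
Hypothesis nhom : ~ hom_extend res.
Hypothesis socE : socle res = mm2.
Variables (dimR r : nat).
Hypothesis dR : @kdim K R iota R^o setT [set 0] dimR.
Hypothesis de : @kdim K R iota R^o mm mm2 r.+1.
Hypothesis dr : @kdim K R iota R^o (socle res) [set 0] r.

Variable V : set R.
Hypothesis Vdec : forall x, mm x -> exists2 v, V v & mm2 (x - v).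

Local Notation G := (short_grading iota res V).

Lemma linear_part p q (A : 'M[R]_(p, q)) : entries mm A ->
  exists2 L, entries V L & entries mm2 (A - L).
Proof.
move=> mA; have [A1 [A2 [VA1 mA2 AE]]] := mx_decomp resK Vdec A.
exists A1 => //; have A0 : map_mx res A = 0.
  by apply/matrixP => i j; rewrite !mxE; apply: mA.
by rewrite AE A0 map_mx0 add0r addrC addKr.
Qed.

Section LinearPart.
Variables (p q : nat) (A L : 'M[R]_(p, q)).
Hypothesis mAL : entries mm2 (A - L).

Lemma entries_VM0 t (X : 'M[R]_(t, p)) : entries mm X -> X *m A = X *m L.
Proof.
move=> mX; apply/eqP; rewrite -subr_eq0 -mulmxBr; apply/eqP/trmx_inj.
rewrite trmx_mul trmx0; apply: (@entries_soc_mul _ _ res) => i j.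
  by rewrite mxE; apply: (mx02_socle m3); apply: mAL.
by rewrite mxE; apply: mX.
Qed.

Lemma entries_V0M t (X : 'M[R]_(q, t)) : entries mm X -> A *m X = L *m X.
Proof.
move=> mX; apply/eqP; rewrite -subr_eq0 -mulmxBl; apply/eqP.
by apply: (@entries_soc_mul _ _ res) mX => i j; apply: (mx02_socle m3); apply: mAL.
Qed.

End LinearPart.

Section LinearResolution.
Variables (M : lmodType R) (b : nat) (l : nat -> nat).
Variable (d : forall n, 'M[R]_(l n, if n is n'.+1 then l n' else b)).
Local Notation F := (@complex_cons R b l d).
Variable eps : {linear 'rV[R]_b -> M}.
Hypothesis resF : is_resolution (F := F) eps.
Hypothesis minF : forall n, entries mm (diff F n).
Hypothesis surF : forall n (v : 'rV_(rk F n)), entries mm2 v ->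
  exists2 x : 'rV_(rk F n.+1), entries mm x & v = x *m diff F n.

(** A differential A and its linear part L have the same image: x A - x L lies in m^2, hence equals
    y A with y in m, and y A = y L because m m^2 = 0. The kernels agree for a similar reason. *)
Lemma linear_resolution : exists L : forall n, 'M[R]_(rk F n.+1, rk F n),
  (forall n, entries V (L n)) /\ is_resolution (F := FreeComplex L) eps.
Proof.
have exF n := resolution_row_exact n resF.
have kerF n (v : 'rV_(rk F n.+1)) : v *m diff F n = 0 -> entries mm v.
  by move=> /(exF n).2 [x ->]; apply: entries_mx0M; apply: minF.
have Lx n : {L : 'M[R]_(rk F n.+1, rk F n) | entries V L /\ entries mm2 (diff F n - L)}.
  by apply: cid; have [L VL mL] := linear_part (@minF n); exists L.
pose L n := sval (Lx n); have LP n := svalP (Lx n).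
have VL n : entries V (L n) := (LP n).1.
have mL n : entries mm2 (diff F n - L n) := (LP n).2.
have imE n (v : 'rV_(rk F n)) :
    (exists x, v = x *m diff F n) <-> (exists x, v = x *m L n).
  have mxAL (x : 'rV_(rk F n.+1)) : entries mm2 (x *m (diff F n - L n)).
    apply: (entries_mul (X := setT) (Y := mm2)) => //.
    - exact: mx020.
    - exact: mx02D.
    - by move=> a c _; apply: mx02M.
  split=> [[x ->]|[x ->]].
    have [y my yE] := surF (mxAL x).
    exists (x + y); rewrite mulmxDl -(entries_VM0 (@mL n) my) -yE mulmxBr.
    by rewrite addrC subrK.
  have [y my yE] := surF (mxAL x).
  by exists (x - y); rewrite mulmxBl -yE mulmxBr subKr.
have kerE n (v : 'rV_(rk F n.+1)) : v *m diff F n = 0 <-> v *m L n = 0.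
  split=> [vA|vL]; first by rewrite -(entries_VM0 (@mL n)) //; apply: kerF.
  suff mv : entries mm v by rewrite (entries_VM0 (@mL n)).
  have : entries mm2 (v *m diff F n).
    have -> : v *m diff F n = v *m (diff F n - L n) by rewrite mulmxBr vL subr0.
    apply: (entries_mul (X := setT) (Y := mm2)) => //.
    - exact: mx020.
    - exact: mx02D.
    - by move=> a c _; apply: mx02M.
  move=> /surF [y my /eqP]; rewrite -subr_eq0 -mulmxBl => /eqP /kerF mvy i j.
  by rewrite -[v](subrK y) mxE; apply: mx0D.
exists L; split=> //; have [sur E0 E] := resF; split=> // [|n].
  rewrite E0; apply/seteqP; split=> v /= [x _ xE].
    have /(imE 0%N v).1 [y ->] : exists x, v = x *m diff F 0 by exists x; rewrite xE.
    by exists y.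
  have /(imE 0%N v).2 [y ->] : exists x, v = x *m L 0%N by exists x; rewrite xE.
  by exists y.
apply/seteqP; split=> [v /= /kerE /(exF n).2 /imE [x ->]|v /= [x _ xE]]; first by exists x.
apply/kerE; have /(imE n.+1 v).2 [y ->] : exists x, v = x *m L n.+1 by exists x; rewrite xE.
by rewrite -mulmxA (exF n).1 mulmx0.
Qed.

End LinearResolution.

(** The ranks equal b only pointwise; replacing the whole rank function brings the matrices to the
    fixed type. *)
Lemma const_rank_resolution (M : lmodType R) b (D : int -> set M)
    (k : nat -> nat) (L : forall n, 'M[R]_(k n.+1, k n)) (eps : {linear 'rV[R]_(k 0) -> M}) :
  (forall n, k n = b) ->
  @is_graded_resolution R G (FreeComplex L) (fun n _ => n%:Z) M D eps ->
  exists (d : nat -> 'M[R]_b) (eps' : {linear 'rV[R]_b -> M}),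
    @is_graded_resolution R G (@FreeComplex R (fun=> b) d) (fun n _ => n%:Z) M D eps'.
Proof.
move=> kb; have kE : k = (fun=> b) by apply/funext.
by move: L eps; rewrite kE => L eps h; exists L, eps.
Qed.

Section Splice.
Variable M : lmodType R.
Hypotheses (fgM : fin_gen M) (gM : G_dim_zero M) (nfs : ~ has_free_summand M).

Lemma values_in_max (f : {linear M -> R^o}) x : mm (f x).
Proof.
apply: contrapT => /(res_unit resK m3) [u fu].
by apply: nfs; apply: (unit_value_free_summand (f := f) (x := x) (u := u)); rewrite mulrC.
Qed.

Lemma G_dim_zero_torsionless : torsionless M.
Proof.
move=> x fx; have [/bij_inj inj _ _] := gM; apply: inj.
by apply: linear_ext => f; rewrite /= /eval_at fx linear0.
Qed.

(** The vanishing of Ext for the dual comes with a resolution by finite free modules, whose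
    augmentation supplies generators. *)
Lemma fin_gen_dual : fin_gen (dual M).
Proof.
have [_ _ /(_ 1%N isT) [F [[eps [sur _ _]] _]]] := gM.
exists (rk F 0), (fun i => eps (delta_mx 0 i)) => f.
have : [set: dual M] f by [].
rewrite -sur => -[v _ <-]; exists v.
by rewrite {1}[v]row_sum_delta linear_sum; apply: eq_bigr => i _; rewrite linearZ.
Qed.

Lemma factor_hom (N : lmodType R) b (eps : {linear 'rV[R]_b -> N}) (g : 'cV[R]_b) :
  range eps = setT -> (forall v, eps v = 0 -> v *m g = 0) ->
  exists f : {linear N -> R^o}, forall v, f (eps v) = (v *m g) 0 0.
Proof.
move=> sur ker.
have /choice [h hP] : forall x, exists v, eps v = x.
  by move=> x; have : [set: N] x by []; rewrite -sur => -[v _ <-]; exists v.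
have E v w : eps v = eps w -> v *m g = w *m g.
  move=> vw; apply/eqP; rewrite -subr_eq0 -mulmxBl; apply/eqP/ker.
  by rewrite linearB /= vw subrr.
have lf : linear ((fun x => (h x *m g) 0 0) : N -> R^o).
  move=> a x y; rewrite (E _ (a *: h x + h y)) ?linearP ?hP //.
  by rewrite mulmxDl -scalemxAl !mxE.
by exists (linear_of lf) => v; rewrite /= /linear_of (E (h (eps v)) v) ?hP.
Qed.

(* A minimal resolution of M is spliced, along c, with the transpose of one of the dual of M;
   M then sits far enough inside an acyclic minimal complex for its ranks to be constant. *)
Lemma splice : exists b (eps : {linear 'rV[R]_b -> M}) l d a (c : 'M[R]_(b, a)),
  let F := @complex_cons R b l d in
  [/\ [/\ is_resolution (F := F) eps, forall n, entries mm (diff F n),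
      forall v, eps v = 0 -> entries mm v, forall n, rk F n = b &
      forall n (v : 'rV_(rk F n)), entries mm2 v ->
        exists2 x : 'rV_(rk F n.+1), entries mm x & v = x *m diff F n],
      forall v, eps v = 0 <-> v *m c = 0
    & exists Y : set 'rV[R]_b, (forall v, Y v <-> v *m c = 0) /\
        kdim iota (@entries R mm 1 b) Y (b * r)].
Proof.
have [bij extM extD] := gM.
have [b [eps [l [d [resF minF kerF dmM]]]]] := minimal_resolution resK m3 dR fgM.
have [a [eps' [l' [d' [resF' minF' kerF' _]]]]] := minimal_resolution resK m3 dR fin_gen_dual.
set F := complex_cons d in resF minF; set F' := complex_cons d' in resF' minF'.
have acF : acyclic F := resolution_acyclic resF extM.
have acF' : acyclic F' := resolution_acyclic resF' extD.
have [sur E0 _] := resF; have [sur' E0' _] := resF'.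
(* The composite of R^b -> M, biduality and the dual of R^a -> dual M: generators of M are paired
   with generators of its dual. *)
pose c : 'M[R]_(b, a) := \matrix_(i, j) (eps' (delta_mx 0 j) : {linear _ -> R^o}) (eps (delta_mx 0 i)).
have hom_sum (f : {linear M -> R^o}) (v : 'rV[R]_b) :
    f (eps v) = \sum_i v 0 i * f (eps (delta_mx 0 i)).
  by rewrite {1}[v]row_sum_delta !linear_sum; apply: eq_bigr => i _; rewrite !linearZ.
have dual_sum (u : 'rV[R]_a) x : (eps' u : {linear _ -> R^o}) x =
    \sum_j u 0 j * (eps' (delta_mx 0 j) : {linear _ -> R^o}) x.
  rewrite -[LHS]/(biduality x (eps' u)) {1}[u]row_sum_delta !linear_sum.
  by apply: eq_bigr => j _; rewrite !linearZ.
have dualE (u : 'rV[R]_a) (v : 'rV[R]_b) :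
    (eps' u : {linear _ -> R^o}) (eps v) = (v *m (c *m u^T)) 0 0.
  rewrite hom_sum mxE; apply: eq_bigr => i _; congr (_ * _).
  by rewrite dual_sum mxE; apply: eq_bigr => j _; rewrite !mxE mulrC.
have dual0 (u : 'rV[R]_a) : c *m u^T = 0 -> eps' u = 0.
  move=> cu; apply: linear_ext => x; have : [set: M] x by [].
  by rewrite -sur => -[v _ <-]; rewrite dualE cu mulmx0 mxE.
have cM (v : 'rV[R]_b) : eps v = 0 <-> v *m c = 0.
  split=> [v0|vc].
    apply/rowP => j; have := dualE (delta_mx 0 j) v; rewrite v0 linear0.
    by rewrite mulmxA trmx_delta -colE !mxE => <-.
  apply: G_dim_zero_torsionless => f; have : [set: dual M] f by [].
  by rewrite -sur' => -[u _ <-]; rewrite dualE mulmxA vc mul0mx mxE.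
have c0 : diff F 0 *m c = 0.
  apply/row_matrixP => i; rewrite row_mul row0; apply/cM.
  suff : [set v | eps v = 0] (row i (diff F 0)) by [].
  by rewrite E0; exists (delta_mx 0 i) => //; rewrite rowE.
have c0' : diff F' 0 *m c^T = 0.
  apply/row_matrixP => i; rewrite row_mul row0.
  have : [set v | eps' v = 0] (row i (diff F' 0)).
    by rewrite E0'; exists (delta_mx 0 i) => //; rewrite rowE.
  move=> /= e0; apply/rowP => j; have := dualE (row i (diff F' 0)) (delta_mx 0 j).
  rewrite e0 -rowE => h; rewrite -[_ *m _]trmxK trmx_mul trmxK [LHS]mxE [RHS]mxE.
  by move: h; rewrite !mxE => <-.
have im0 (v : 'rV[R]_b) : v *m c = 0 -> exists x, v = x *m diff F 0.
  move=> /cM v0; have : [set v | eps v = 0] v by [].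
  by rewrite E0 => -[x _ <-]; exists x.
have im0' (u : 'rV[R]_a) : u *m c^T = 0 -> exists x, u = x *m diff F' 0.
  move=> uc; have : [set v | eps' v = 0] u.
    by apply: dual0; apply: trmx_inj; rewrite trmx_mul trmxK uc trmx0.
  by rewrite E0' => -[x _ <-]; exists x.
(* Such a row is a functional on the dual of M, hence evaluation at an element of M by surjectivity
   of biduality. *)
have row_c (v : 'rV[R]_a) : v *m (diff F' 0)^T = 0 -> exists x, v = x *m c.
  move=> vF; have [u eu|Phi PhiE] := factor_hom (g := v^T) sur'.
    have : [set u | eps' u = 0] u by [].
    rewrite E0' => -[x _ <-]; rewrite -mulmxA -[_ *m v^T]trmxK trmx_mul trmxK vF.
    by rewrite trmx0 mulmx0.
  have [g _ gK] := bij; have := gK Phi; set x := g Phi => xE.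
  have : [set: M] x by [].
  rewrite -sur => -[w _ wx]; exists w; apply/rowP => j.
  have := PhiE (delta_mx 0 j); rewrite -xE /= /eval_at -wx dualE.
  by rewrite mulmxA trmx_delta -colE -rowE !mxE => <-.
have col_c (u : 'rV[R]_b) : u *m (diff F 0)^T = 0 -> exists x, u = x *m c^T.
  move=> uF; have [v ev|f fE] := factor_hom (g := u^T) sur.
    have : [set v | eps v = 0] v by [].
    rewrite E0 => -[x _ <-]; rewrite -mulmxA -[_ *m u^T]trmxK trmx_mul trmxK uF.
    by rewrite trmx0 mulmx0.
  have : [set: dual M] f by [].
  rewrite -sur' => -[w _ wf]; exists w; apply/rowP => j.
  have := fE (delta_mx 0 j); rewrite -wf dualE -rowE -[c *m _]trmxK trmx_mul trmxK.
  by rewrite -rowE !mxE => <-.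
(* M is the image of c, from position 3 to position 2. Two transposed differentials are kept below,
   since [rank_recurrence] controls the ranks from position 2 on; so a, at position 2, equals b, at
   position 3. *)
pose k n := match n with 0 => rk F' 2 | 1 => rk F' 1 | 2 => a | n'.+3 => rk F n' end.
pose t n : 'M[R]_(k n.+1, k n) := match n with
  | 0 => (diff F' 1)^T | 1 => (diff F' 0)^T | 2 => c | n'.+3 => diff F n' end.
pose T := FreeComplex t.
have mc : entries mm c by move=> i j; rewrite mxE; apply: values_in_max.
have minT n : entries mm (diff T n).
  by case: n => [|[|[|n]]] i j //=; rewrite ?mxE; [apply: minF'|apply: minF'|apply: minF].
have acT : acyclic T.
  case=> [|[|[|n]]] /=; rewrite /t; last exact: acF.
  - by rewrite !trmxK; split; [apply: (acF' 0%N).2 | apply: (acF' 0%N).1].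
  - rewrite trmxK; split; last by split.
    by split=> //; apply: trmx_inj; rewrite trmx_mul trmxK trmx0.
  - split; first by split.
    by split=> //; rewrite -trmx_mul c0 trmx0.
have ranks n : rk T n.+2 = a.
  elim: n => [//|n IH]; rewrite -IH.
  have [_ /eqP] := rank_recurrence resK m3 m2n0 nhom acT minT de dr n socE.
  by rewrite eqn_mul2r /= => /eqP.
have ab : a = b by rewrite -(ranks 1%N).
exists b, eps, l, d, a, c; split=> //.
  split=> // [n|n v mv]; first by apply: etrans ab; apply: (ranks n.+1).
  apply: (socle_rows resK m3 nhom acT minT (n := n.+2)).
  by rewrite socE.
have [Y [YE dY _ _]] := count_complex resK m3 nhom acT minT de dr 1 socE.
by exists Y; split=> //; apply: kdim_ext dY => //; rewrite /= ab.
Qed.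

End Splice.

End GDimZero.

Section GradedModules.
Variables (K : fieldType) (R : comNzRingType).
Variables (iota : {rmorphism K -> R}) (res : {rmorphism R -> K}).
Hypothesis resK : cancel iota res.

Local Notation mm := (mx0 res).
Local Notation mm2 := (mx02 res).
Local Notation lift := (map_mx iota).

Hypothesis m3 : forall x y z, mm x -> mm y -> mm z -> x * y * z = 0.
Hypothesis m2n0 : exists2 z, mm2 z & z <> 0.
Hypothesis nhom : ~ hom_extend res.
Hypothesis socE : socle res = mm2.
Variables (dimR r : nat).
Hypothesis dR : @kdim K R iota R^o setT [set 0] dimR.
Hypothesis de : @kdim K R iota R^o mm mm2 r.+1.
Hypothesis dr : @kdim K R iota R^o (socle res) [set 0] r.

Variable V : set R.
Hypothesis kV : ksubR iota V.
Hypothesis Vm : V `<=` mm.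
Hypothesis Vdec : forall x, mm x -> exists2 v, V v & mm2 (x - v).
Hypothesis V0 : forall x, V x -> mm2 x -> x = 0.

Local Notation G := (short_grading iota res V).

Lemma G_dim_zero_graded (M : lmodType R) : fin_gen M -> G_dim_zero M ->
  exists D : int -> set M, module_grading G D /\
    (~ has_free_summand M ->
     exists b : nat,
       [/\ forall i, i != 0 -> i != 1 -> D i = [set 0],
           kdim iota (D 0) [set 0] b,
           min_gens M b,
           kdim iota (D 1) [set 0] (r * b)
         & has_length M (b * (1 + r)) /\
           exists (d : nat -> 'M[R]_b) (eps : {linear 'rV[R]_b -> M}),
             @is_graded_resolution R G (@FreeComplex R (fun=> b) d)
               (fun n _ => n%:Z) M D eps]).
Proof.
move=> fgM gM; have tM := G_dim_zero_torsionless gM.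
have [fs|nfs] := pselect (has_free_summand M).
  have [n dM] := fin_gen_kdim dR fgM.
  have [D D3] := torsionless_grading resK m3 kV Vm Vdec V0 dM tM.
  exists D; split=> // ; exact: three_graded_module D3.
have m2M := torsionless_m2 resK m3 tM nfs.
have [b [eps [l [d [a [c [[resF minF kerF rkF surF] cM [Y [YE dY]]]]]]]]] :=
  splice resK m3 m2n0 nhom socE dR de dr fgM gM nfs.
have [L [VL resL]] := linear_resolution resK m3 Vdec resF minF surF.
have [sur _ _] := resF.
pose mM := max_mul res [set: M].
have smM : is_submodule mM := max_mul_submodule res [set: M].
have kmM : ksub iota mM := submodule_ksub iota smM.
pose g i := eps (delta_mx 0 i).
have gE y : kcomb iota g y = eps (lift y).
  rewrite [lift y]row_sum_delta linear_sum; apply: eq_bigr => i _.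
  by rewrite linearZ mxE.
have eps_mM (v : 'rV[R]_b) : entries mm v -> mM (eps v).
  move=> mv; exists b, (fun i => v 0 i), g; split=> [i|]; first by split.
  by rewrite {1}[v]row_sum_delta linear_sum; apply: eq_bigr => i _; rewrite linearZ.
have mM_eps x : mM x -> exists2 v, entries mm v & eps v = x.
  move=> [n [u [y [uy ->]]]].
  have /choice [w wP] : forall i, exists w, eps w = y i.
    by move=> i; have : [set: M] (y i) by []; rewrite -sur => -[w _ <-]; exists w.
  exists (\sum_i u i *: w i); last first.
    by rewrite linear_sum; apply: eq_bigr => i _; rewrite linearZ /= wP.
  move=> i j; rewrite summxE; apply: (ksub_sum (ksub_mx0 iota res)) => t _.
  by rewrite mxE mulrC; apply: mx0M; case: (uy t).
have kcomb_inj y : mM (eps (lift y)) -> y = 0.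
  move=> /mM_eps [v mv /eqP]; rewrite -subr_eq0 -linearB => /eqP /kerF mvy.
  apply/rowP => i; rewrite mxE; have := mvy 0 i; rewrite /mx0 /= !mxE rmorphB resK mv.
  by move/eqP; rewrite sub0r oppr_eq0 => /eqP.
have gP z : exists! y : 'rV[K]_b, mM (z - \sum_i iota (y 0 i) *: g i).
  have : [set: M] z by []; rewrite -sur => -[v _ <-].
  have mv : mM (eps v - kcomb iota g (map_mx res v)).
    by rewrite gE -linearB; apply: eps_mM => i j; rewrite !mxE; apply: mx0_res.
  exists (map_mx res v); split=> // y my; apply/eqP; rewrite -subr_eq0; apply/eqP.
  apply: kcomb_inj; rewrite -gE kcombB.
  have := ksubB kmM my mv; rewrite opprB addrC addrA subrK //.
pose D := generator_grading iota res g.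
exists D; split=> [|_]; first exact: three_graded_module (generator_three_graded Vm gP m2M).
(* mM is m^b modulo the kernel of eps, which is the kernel Y of c; its codimension in m^b was
   counted in the spliced complex. *)
have dD1 : kdim iota (D 1) [set 0] (b * r).
  have lf := linear_klinear iota eps.
  apply: (proj1 (kdim_map lf (ksub_set0 iota M) _ _ _ (ksub_entries (ksub_mx0 iota res))) dY).
  - by move=> v mv; apply: eps_mM.
  - by move=> x /mM_eps.
  - by move=> v _; split=> [/YE/cM|/cM/YE].
have dMb : kdim iota setT mM b by exists g; split=> // z _; apply: gP.
exists b; split=> //.
- by move=> [[|[|n]]|n].
- exists g; split=> [i|_ [y ->]]; first by exists (delta_mx 0 i); rewrite kcomb_delta.
  exists y; split=> [|y']; first by rewrite /= subrr.
  rewrite -[\sum_i _]/(kcomb iota g y') /= -kcombB gE => E.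
  apply/eqP; rewrite -subr_eq0; apply/eqP/kcomb_inj; rewrite E; exact: (ksub0 kmM).
- split=> [|n [h hP]].
    exists g => x; have : [set: M] x by []; rewrite -sur => -[v _ <-].
    exists v; rewrite {1}[v]row_sum_delta linear_sum.
    by apply: eq_bigr => i _; rewrite linearZ.
  apply: (kdim_le_span (ksubT iota M) kmM dMb (g := h)) => // z _.
  have [u uE] := hP z; exists (map_mx res u); rewrite uE /kcomb -sumrB.
  exists n, (fun i => u 0 i - iota (res (u 0 i))), h; split=> [i|].
    by split=> //; apply: mx0_res.
  by apply: eq_bigr => i _; rewrite mxE scalerBl.
- by rewrite mulnC.
- split.
    have s0 : is_submodule [set (0 : M)].
      by split=> // u x y -> ->; rewrite scaler0 addr0.
    have chT : chain_to [set: M] [set: M] 0 by exists (fun=> setT).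
    have ch1 := chain_kdim resK smM (submoduleT M) (@subsetT _ _) _ dMb chT.
    have ch2 : chain_to [set 0] [set: M] (b * r + (b + 0)).
      apply: (chain_kdim resK s0 smM _ _ dD1).
      - by move=> _ ->; case: smM.
      - by move=> u x mu mx; apply: (mul_mM m2M mu mx).
      - by apply: ch1 => u x mu _; apply: max_mul1.
    rewrite mulnDr muln1 addnC; move: ch2; rewrite addn0 => -[c' [? ? ? ?]].
    by exists c'.
  apply: (const_rank_resolution (L := L) (eps := eps)) => //; split=> // [n i v Fv|i v Fv].
    apply: (linear_piece m3 kV Vm (@VL n)) => j.
    have E : n.+1%:Z = n%:Z + 1 by rewrite -addn1 PoszD.
    by have := Fv j; rewrite E.
  have kD j : ksub iota (D j) by apply: ksub_generator_grading.
  case: i Fv => [[|[|[|n]]]|n] Fv.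
  + have /choice [y yP] : forall j, exists y, v 0 j = iota y.
      by move=> j; have := Fv j; rewrite subr0 => -[y _ <-]; exists y.
    exists (\row_j y j); rewrite gE; congr (eps _); apply/rowP => j.
    by rewrite !mxE yP.
  + by apply: eps_mM => j j'; rewrite (ord1 j); have := Fv j'; rewrite subr0; apply: Vm.
  + have -> : eps v = 0; last exact: (ksub0 (kD 2%:Z)).
    rewrite [v]row_sum_delta linear_sum big1 // => j _; rewrite linearZ.
    by apply: (mx02_annihilates m2M); have := Fv j; rewrite subr0.
  + have -> : v = 0; last by rewrite linear0; apply: (ksub0 (kD n.+3%:Z)).
    by apply/rowP => j; have := Fv j; rewrite subr0 mxE.
  + have -> : v = 0; last by rewrite linear0; apply: (ksub0 (kD (Negz n))).
    by apply/rowP => j; have := Fv j; rewrite subr0 mxE.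
Qed.

End GradedModules.

Section NonfreeModule.
Variables (K : fieldType) (R : comNzRingType).
Variables (iota : {rmorphism K -> R}) (res : {rmorphism R -> K}).
Hypothesis resK : cancel iota res.

Local Notation mm := (mx0 res).
Local Notation mm2 := (mx02 res).

Hypothesis m3 : forall x y z, mm x -> mm y -> mm z -> x * y * z = 0.
Hypothesis m2n0 : exists2 z, mm2 z & z <> 0.
Hypothesis nhom : ~ hom_extend res.
Variables (dimR e r : nat).
Hypothesis dR : @kdim K R iota R^o setT [set 0] dimR.
Hypothesis de : @kdim K R iota R^o mm mm2 e.
Hypothesis dr : @kdim K R iota R^o (socle res) [set 0] r.

(** Rank 0 at position 1 would make eps bijective and M free; [rank0_descent] reduces the later
    positions to this one. *)
Lemma nonfree_complex (M : lmodType R) : fin_gen M -> ~ free_module M ->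
  (forall i, (0 < i)%N -> Ext_zero i M R^o) ->
  exists F : free_complex R, [/\ acyclic F, forall n, entries mm (diff F n)
    & forall n, (0 < rk F n.+1)%N].
Proof.
move=> fgM nfM ext.
have [b [eps [l [d [resF minF kerF _]]]]] := minimal_resolution resK m3 dR fgM.
set F := complex_cons d in resF minF; have acF := resolution_acyclic resF ext.
exists F; split=> // n; rewrite lt0n; apply/eqP; elim: n => [F0|n IH]; last first.
  by move/(rank0_descent acF minF).
have [sur E0 _] := resF; apply: nfM; exists b, eps.
have /choice [h hP] : forall x, exists v, eps v = x.
  by move=> x; have : [set: M] x by []; rewrite -sur => -[v _ <-]; exists v.
exists h => // v; apply/eqP; rewrite -subr_eq0; apply/eqP.
have : [set v | eps v = 0] (h (eps v) - v) by rewrite /= linearB /= hP subrr.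
rewrite E0 => -[x _ <-]; apply/rowP => j; rewrite !mxE big1 // => i _.
by have := ltn_ord i; rewrite [X in (_ < X)%N]F0.
Qed.

(** Two consecutive relations, b_2 (r + 1) = e b_3 and b_3 (r + 1) = e b_4 = e b_2, combine to (r +
    1)^2 = e^2. *)
Lemma embedding_dimension (F : free_complex R) : acyclic F ->
  (forall n, entries mm (diff F n)) -> (forall n, (0 < rk F n.+1)%N) ->
  socle res = mm2 /\ e = r.+1.
Proof.
move=> acF minF b0; have socE := socle_eq resK m3 nhom acF minF (b0 0%N).
split=> //.
have [E1 E2] := rank_recurrence resK m3 m2n0 nhom acF minF de dr 0 socE.
have [_ E3] := rank_recurrence resK m3 m2n0 nhom acF minF de dr 1 socE.
have : (rk F 2 * (r.+1 * r.+1) = rk F 2 * (e * e))%N.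
  by rewrite mulnA E2 -mulnA [(e * _)%N]mulnC mulnA E3 E1 -mulnA.
by move/eqP; rewrite eqn_pmul2l // !mulnn eqn_sqr => /eqP.
Qed.

Lemma linear_complement : @kdim K R iota R^o mm mm2 e ->
  exists V : set R, [/\ ksubR iota V, V `<=` mm,
    forall x, mm x -> exists2 v, V v & mm2 (x - v),
    @kdim K R iota R^o V [set 0] e & forall x, V x -> mm2 x -> x = 0].
Proof.
move=> [g [mg gP]].
have k2 : ksub (N := R^o) iota mm2 := ksub_mx02 iota res.
have km : ksub (N := R^o) iota mm := ksub_mx0 iota res.
have ind c : mm2 (kcomb (N := R^o) iota g c) -> c = 0.
  move=> mc; have [t [_ tu]] := gP 0 (ksub0 km).
  have t0 : t = 0.
    by apply: tu; rewrite -[\sum_i _]/(kcomb (N := R^o) iota g 0) kcomb0 subr0; apply: (ksub0 k2).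
  have : t = - c.
    apply: tu; rewrite -[\sum_i _]/(kcomb (N := R^o) iota g (- c)) -[- c]add0r kcombB kcomb0.
    by rewrite opprB subr0 add0r.
  by rewrite t0 => /esym/eqP; rewrite oppr_eq0 => /eqP.
exists [set x | exists c, x = kcomb (N := R^o) iota g c]; split.
- split; first by exists 0; rewrite kcomb0.
  by move=> a _ _ [c ->] [c' ->]; exists (a *: c + c'); rewrite kcombD.
- by move=> _ [c ->]; apply: (ksub_kcomb km).
- move=> x /gP [c [mc _]]; exists (kcomb (N := R^o) iota g c) => //.
  by exists c.
- exists g; split=> [i|_ [c ->]]; first by exists (delta_mx 0 i); rewrite kcomb_delta.
  exists c; split=> [|c']; first by rewrite /= subrr.
  rewrite -[\sum_i _]/(kcomb (N := R^o) iota g c') /= -kcombB => E.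
  by apply/eqP; rewrite -subr_eq0; apply/eqP/ind; rewrite E; apply: (ksub0 k2).
- by move=> _ [c ->] /ind ->; rewrite kcomb0.
Qed.

End NonfreeModule.

(** * Conclusion *)

Lemma convolution3 (a : nat -> int) (q : {poly int}) n : (size q <= 3)%N ->
  \sum_(i < n.+3) a i * q`_(n.+2 - i) = a n.+2 * q`_0 + a n.+1 * q`_1 + a n * q`_2.
Proof.
move=> sq; rewrite !big_ord_recr /= subnn subSnn.
rewrite (_ : n.+2 - n = 2)%N; last by rewrite -addn2 addKn.
rewrite big1 ?add0r => [|i _]; first by rewrite addrC [_ * q`_2 + _]addrC addrA.
by rewrite nth_default ?mulr0 // (leq_trans sq) //; have := ltn_ord i; lia.
Qed.

Section Series.
Variables (r : nat) (p : nat -> nat).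
Hypotheses (p0 : p 0%N = 1%N) (pS : forall n, p n.+1 = (r * p n).+1).

Let pE n : (p n.+1)%:Z = r%:Z * (p n)%:Z + 1.
Proof. by rewrite pS -addn1 PoszD PoszM. Qed.

Lemma poincare_series : series_is_frac p 1 ((1 - 'X) * (1 - r%:R *: 'X)).
Proof.
have E : (1 - 'X) * (1 - r%:R *: 'X) = 1 - (r%:Z + 1) *: 'X + r%:Z *: 'X^2 :> {poly int}.
  by rewrite natz -!mul_polyC rmorphD rmorph1; ring.
have c0 : (1 - (r%:Z + 1) *: 'X + r%:Z *: 'X^2 : {poly int})`_0 = 1.
  by rewrite !coefE /= !mulr0 subr0 addr0.
have c1 : (1 - (r%:Z + 1) *: 'X + r%:Z *: 'X^2 : {poly int})`_1 = - (r%:Z + 1).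
  by rewrite !coefE /= mulr0 mulr1 add0r addr0.
have c2 : (1 - (r%:Z + 1) *: 'X + r%:Z *: 'X^2 : {poly int})`_2 = r%:Z.
  by rewrite !coefE /= mulr0 mulr1 subr0 add0r.
rewrite /series_is_frac E; split=> // -[|[|n]].
- by rewrite big_ord1 c0 p0 coef1.
- by rewrite !big_ord_recr big_ord0 /= subn0 subnn c0 c1 pE p0 coef1 /=; ring.
rewrite (convolution3 (fun i => (p i)%:Z)) ?c0 ?c1 ?c2 ?coef1 /=.
  by rewrite !pE; ring.
apply: leq_trans (size_polyD _ _) _; rewrite geq_max; apply/andP; split.
  apply: leq_trans (size_polyD _ _) _; rewrite size_poly1 geq_max /= size_polyN.
  by apply: leq_trans (size_scale_leq _ _) _; rewrite size_polyX.
by apply: leq_trans (size_scale_leq _ _) _; rewrite size_polyXn.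
Qed.

Lemma bass_series (B : nat -> nat) : B 0%N = r ->
  (forall n, (B n.+1 + p n * r.+1 = p n.+1 * r + (if n is n'.+1 then p n' else 0))%N) ->
  series_is_frac B (r%:R%:P - 'X) (1 - r%:R *: 'X).
Proof.
move=> B0 BS.
have c0 : (1 - r%:R *: 'X : {poly int})`_0 = 1 by rewrite !coefE /= mulr0 subr0.
have c1 : (1 - r%:R *: 'X : {poly int})`_1 = - r%:Z.
  by rewrite !coefE /= mulr1 add0r natz.
have sz : (size (1 - r%:R *: 'X : {poly int})%R <= 2)%N.
  apply: leq_trans (size_polyD _ _) _; rewrite size_poly1 geq_max /= size_polyN.
  by apply: leq_trans (size_scale_leq _ _) _; rewrite size_polyX.
have c2 : (1 - r%:R *: 'X : {poly int})`_2 = 0 by rewrite nth_default.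
have BZ n : (B n.+1)%:Z = (p n.+1)%:Z * r%:Z +
    (if n is n'.+1 then (p n')%:Z else 0) - (p n)%:Z * (r%:Z + 1).
  by case: n (BS n) => [|n] E; lia.
split=> // -[|[|n]].
- by rewrite big_ord1 c0 B0 !coefE /= subr0 mulr1 natz.
- rewrite !big_ord_recr big_ord0 /= subn0 subnn c0 c1 BZ B0 pE p0 !coefE /=; ring.
rewrite (convolution3 (fun i => (B i)%:Z)) ?c0 ?c1 ?c2 ?(leq_trans sz) //.
rewrite !coefE /= !BZ; case: n => [|n]; rewrite !pE ?p0; ring.
Qed.

End Series.

Section ResidueTheorem.
Variables (K : fieldType) (R : comNzRingType).
Variables (iota : {rmorphism K -> R}) (res : {rmorphism R -> K}).
Hypothesis resK : cancel iota res.

Local Notation mm := (mx0 res).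
Local Notation mm2 := (mx02 res).
Local Notation lift := (map_mx iota).

Hypothesis m3 : forall x y z, mm x -> mm y -> mm z -> x * y * z = 0.
Hypothesis nhom : ~ hom_extend res.
Hypothesis socE : socle res = mm2.
Variable r : nat.
Hypothesis r0 : (0 < r)%N.
Hypothesis de : @kdim K R iota R^o mm mm2 r.+1.
Hypothesis dr : @kdim K R iota R^o mm2 [set 0] r.

Variable V : set R.
Hypothesis kV : ksubR iota V.
Hypothesis Vm : V `<=` mm.
Hypothesis Vdec : forall x, mm x -> exists2 v, V v & mm2 (x - v).
Hypothesis dV : @kdim K R iota R^o V [set 0] r.+1.
Hypothesis V0 : forall x, V x -> mm2 x -> x = 0.

Variable m : idealr R.
Hypothesis mE : forall x, x \in m <-> res x = 0.

Variable F : free_complex R.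
Hypotheses (acF : acyclic F) (minF : forall n, entries mm (diff F n)).
Hypothesis F0 : forall n, (0 < rk F n.+1)%N.

(** D_i is the transposed linear part of d_{i+2}. Dropping the part over m^2 is harmless against
    vectors over m since m^3 = 0; transposing makes products run towards larger i, as [covers]
    requires. *)
Lemma strand_exists : exists (b : nat -> nat) (D : forall i, 'M[R]_(b i, b i.+1)),
  [/\ forall i, entries V (D i), forall i, D i *m D i.+1 = 0,
      forall i (u : 'cV_(b i)), entries mm2 u ->
        exists2 x : 'cV_(b i.+1), entries V x & u = D i *m x,
      forall i (v : 'rV_(b i.+1)), entries V v -> v *m D i.+1 = 0 ->
        exists y, v = lift y *m D i
    & (0 < b 0)%N].
Proof.
have Lx n : {L : 'M[R]_(rk F n.+1, rk F n) | entries V L /\ entries mm2 (diff F n - L)}.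
  by apply: cid; have [L VL mL] := linear_part resK Vdec (@minF n); exists L.
pose L n := sval (Lx n).
have VL n : entries V (L n) := (svalP (Lx n)).1.
have mL n : entries mm2 (diff F n - L n) := (svalP (Lx n)).2.
have VmE p q (X : 'M[R]_(p, q)) : entries V X -> entries mm X.
  by move=> VX i j; apply: Vm.
exists (fun i => rk F i.+2), (fun i => (L i.+2)^T); split=> // [i|i|i u mu|i v Vv vD].
- by move=> a c; rewrite mxE; apply: VL.
- rewrite -trmx_mul -(entries_VM0 m3 (@mL i.+2) (VmE _ _ _ (@VL i.+3))).
  by rewrite -(entries_V0M m3 (@mL i.+3) (@minF i.+2)) (acF i.+2).1.1 trmx0.
- have [|x mx xE] := socle_rows resK m3 nhom acF minF (n := i.+1) (v := u^T).
    by rewrite socE => a c; rewrite mxE; apply: mu.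
  have [x1 Vx1 mx1] := linear_part resK Vdec mx.
  exists x1^T; first by move=> a c; rewrite mxE; apply: Vx1.
  rewrite -trmx_mul; apply: trmx_inj; rewrite trmxK xE.
  rewrite (entries_VM0 m3 (@mL i.+2) mx); apply/eqP; rewrite -subr_eq0 -mulmxBl.
  by rewrite (mul_mx02_V m3 Vm mx1 (@VL i.+2)).
- have vd : v *m (diff F i.+3)^T = 0.
    apply: trmx_inj; rewrite trmx_mul trmxK trmx0 (entries_V0M m3 (@mL i.+3)); last first.
      by apply: VmE => a c; rewrite mxE; apply: Vv.
    by rewrite -[L i.+3]trmxK -trmx_mul vD trmx0.
  have [x xE] := (acF i.+2).2.2 _ vd.
  (* With the residue of x as coefficients over k, the difference lies both in V and in m^2. *)
  exists (map_mx res x); apply/eqP; rewrite -subr_eq0; apply/eqP.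
  have Vd : entries V (v - lift (map_mx res x) *m (L i.+2)^T).
    apply: (entriesB kV) => //; apply: (entries_lift_mull kV) => a c.
    by rewrite mxE; apply: VL.
  have md : entries mm2 (v - lift (map_mx res x) *m (L i.+2)^T).
    have -> : v - lift (map_mx res x) *m (L i.+2)^T =
        x *m (diff F i.+2 - L i.+2)^T + (x - lift (map_mx res x)) *m (L i.+2)^T.
      by rewrite {1}xE linearB /= mulmxBr mulmxBl addrA subrK.
    have m1 : entries mm2 (x *m (diff F i.+2 - L i.+2)^T).
      apply: (entries_mul (X := setT) (Y := mm2)) => //; last by move=> a c; rewrite mxE; apply: mL.
      - exact: mx020.
      - exact: mx02D.
      - by move=> a c _; apply: mx02M.
    have m2 : entries mm2 ((x - lift (map_mx res x)) *m (L i.+2)^T).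
      apply: entries_mx02M => a c; last by rewrite mxE; apply: Vm; apply: VL.
      by rewrite !mxE; apply: mx0_res.
    by move=> a c; rewrite mxE; apply: mx02D.
  by apply/matrixP => a c; rewrite [RHS]mxE; apply: V0.
Qed.

Lemma residue_field_series :
  (koszul (short_grading iota res V) m /\
   exists P : nat -> nat,
     (forall i, Tor_dim iota i {ideal_quot m} {ideal_quot m} (P i)) /\
     series_is_frac P 1 ((1 - 'X) * (1 - r%:R *: 'X))) /\
  (exists B : nat -> nat,
     (forall i, Ext_dim iota i {ideal_quot m} R^o (B i)) /\
     series_is_frac B (r%:R%:P - 'X) (1 - r%:R *: 'X)).
Proof.
have [b [D [VD DD DS DX b0]]] := strand_exists.
have [l [d [goodF sy0 sy]]] := residue_complex kV Vm dV VD DD DS b0.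
have [co [coD co0]] := mx02_coord dr.
have [h [g [VH HH goodH trH gen0]]] :=
  canonical_complex kV Vm dV VD DD DS DX b0 coD co0.
have colF : forall n (u : 'cV_(rk (complex_cons d) n.+1)), entries V u ->
    diff (complex_cons d) n.+1 *m u = 0 -> exists z, u = diff (complex_cons d) n *m lift z.
  exact: (linear_col_exact resK m3 socE de kV Vm Vdec V0 sy0 sy coD co0 VH HH goodH trH gen0).
have p0 : rk (complex_cons d) 0 = 1%N by [].
have pS := betti_rec dr kV Vm dV goodF sy0 sy.
have koz := linear_koszul resK m3 kV Vm Vdec V0 mE goodF sy0 sy.
split; first split=> //.
  exists (rk (complex_cons d)); split; last exact: poincare_series.
  exact: (linear_Tor_dim resK m3 kV Vm Vdec V0 mE goodF sy0 sy).
have e0 := Ext_dim0 resK m3 socE r0 dr kV Vm Vdec V0 mE goodF sy0 sy colF.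
have /choice [B BP] : forall n, exists c, Ext_dim iota n.+1 {ideal_quot m} R^o c /\
    (c + rk (complex_cons d) n * r.+1 = rk (complex_cons d) n.+1 * r +
      (if n is n'.+1 then rk (complex_cons d) n' else 0))%N.
  move=> n; have [c] := Ext_dimS resK m3 socE r0 dr kV Vm Vdec dV V0 mE goodF sy0 sy colF n.
  by exists c.
exists (fun n => if n is n'.+1 then B n' else r); split.
  by case=> [|n] //; case: (BP n).
by apply: (bass_series p0 pS) => // n; case: (BP n).
Qed.

End ResidueTheorem.

Section ResidueMorphism.
Variables (K : fieldType) (R : comNzRingType) (f : R -> K).
Hypotheses (fB : zmod_morphism f) (fM : monoid_morphism f).

(** Mentioning the two proofs makes them arguments of the constant to which the morphism instances
    are attached. *)
Definition morphism_of := let _ := (fB, fM) in f.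

HB.instance Definition _ := GRing.isZmodMorphism.Build R K morphism_of fB.
HB.instance Definition _ := GRing.isMonoidMorphism.Build R K morphism_of fM.

End ResidueMorphism.

Theorem theorem3p1
  (R : comNzRingType) (m : idealr R)
  (hnoeth : noetherian R) (hlocal : local_ring m)
  (hgor : ~ gorenstein R)
  (hm3 : ideal_pow [set` m] 3 = [set 0])
  (hm2 : ideal_pow [set` m] 2 <> [set 0])
  (k : fieldType) (iota : {rmorphism k -> R})
  (hk : bijective (fun c : k => \pi_({ideal_quot m}) (iota c)))
  (r : nat)
  (hr : kdim iota [set: {linear {ideal_quot m} -> R^o}] [set 0] r)
  (hex : exists M : lmodType R,
     [/\ fin_gen M, ~ free_module M & G_dim_zero M]) :
  exists G : nat -> set R,
  [/\ homogeneous_grading iota G,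
      forall i, (2 < i)%N -> G i = [set 0],
      @kdim k R iota R^o (G 1%N) [set 0] r.+1,
      @kdim k R iota R^o (G 2%N) [set 0] r
    & (exists H : nat -> nat,
         (forall i, @kdim k R iota R^o (G i) [set 0] (H i)) /\
         series_is_frac H ((1 + 'X) * (1 + r%:R *: 'X)) 1)
      /\ annihilator [set` m] = ideal_pow [set` m] 2] /\
  (koszul G m /\
   exists P : nat -> nat,
     (forall i, Tor_dim iota i {ideal_quot m} {ideal_quot m} (P i)) /\
     series_is_frac P 1 ((1 - 'X) * (1 - r%:R *: 'X))) /\
  (exists B : nat -> nat,
     (forall i, Ext_dim iota i {ideal_quot m} R^o (B i)) /\
     series_is_frac B (r%:R%:P - 'X) (1 - r%:R *: 'X)) /\
  forall M : lmodType R, fin_gen M -> G_dim_zero M ->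
    exists D : int -> set M, module_grading G D /\
      (~ has_free_summand M ->
       exists b : nat,
         [/\ forall i, i != 0 -> i != 1 -> D i = [set 0],
             kdim iota (D 0) [set 0] b,
             min_gens M b,
             kdim iota (D 1) [set 0] (r * b)
           & has_length M (b * (1 + r)) /\
             exists (d : nat -> 'M[R]_b) (eps : {linear 'rV[R]_b -> M}),
               @is_graded_resolution R G (@FreeComplex R (fun=> b) d)
                 (fun n _ => n%:Z) M D eps]).
Proof.
(* h inverts k -> R/m, so f is the residue map of R with values in k. *)
have [h hK Kh] := hk; pose f (x : R) := h (\pi_({ideal_quot m}) x).
have fE x : \pi_({ideal_quot m}) (iota (f x)) = \pi_({ideal_quot m}) x by apply: Kh.
have fB : zmod_morphism f.
  move=> x y; apply: (can_inj hK); rewrite /= fE !rmorphB /= -(rmorphB \pi_({ideal_quot m})).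
  by rewrite !rmorphB /= !fE.
have fM : monoid_morphism f.
  split; first by apply: (can_inj hK); rewrite /= fE rmorph1.
  by move=> x y; apply: (can_inj hK); rewrite /= fE !rmorphM /= !fE.
pose res : {rmorphism R -> k} := morphism_of fB fM.
have resE x : res x = f x by [].
have resK : cancel iota res by move=> c; apply: hK.
have mE x : x \in m <-> res x = 0.
  split=> [/quot_eq0 xm|x0]; first by rewrite resE /f xm -(hK 0) rmorph0 rmorph0.
  by apply/quot_eq0; rewrite -fE -resE x0 !rmorph0.
have mmE : [set` m] = mx0 res by apply/predeqP => x; apply: mE.
have pow1 x : ideal_mul [set` m] setT x <-> mx0 res x.
  split=> [[n [a [c [ac ->]]]]|mx].
    apply: (big_ind (mx0 res)) => [|u v|i _]; [exact: mx00 | exact: mx0D |].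
    by apply: mx0Mr; rewrite -mmE; case: (ac i).
  by exists 1%N, (fun=> x), (fun=> 1); rewrite big_ord1 mulr1 mmE.
have pow2 : ideal_pow [set` m] 2 = mx02 res.
  apply/predeqP => x; split=> -[n [a [c [ac ->]]]]; exists n, a, c; split=> // i.
    by have [ma /pow1 mc] := ac i; rewrite mmE in ma.
  by have [ma mc] := ac i; split; [rewrite mmE | apply/pow1].
have m3 x y z : mx0 res x -> mx0 res y -> mx0 res z -> x * y * z = 0.
  move=> mx my mz; have yz : ideal_pow [set` m] 2 (y * z) by rewrite pow2; apply: mx02_mul.
  have : ideal_pow [set` m] 3 (x * (y * z)).
    exists 1%N, (fun=> x), (fun=> y * z); rewrite big_ord1; split=> // _.
    by split; [rewrite mmE | exact: yz].
  by rewrite hm3 mulrA.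
have m2n0 : exists2 z, mx02 res z & z <> 0.
  apply: contrapT => no; apply: hm2; rewrite pow2; apply/seteqP; split=> [z mz|_ ->].
    by apply: contrapT => z0; apply: no; exists z.
  exact: mx020.
have km : ksub (N := R^o) iota (mx0 res) := ksub_mx0 iota res.
have k2 : ksub (N := R^o) iota (mx02 res) := ksub_mx02 iota res.
have k0 : ksub (N := R^o) iota [set 0] := ksub_set0 iota R^o.
have [n [g gP]] := hnoeth m.
have mg i : mx0 res (g i).
  apply/mE/gP; exists (delta_mx 0 i); rewrite (bigD1 i) //= mxE !eqxx mul1r big1 ?addr0 //.
  by move=> j /negPf ji; rewrite mxE ji andbF mul0r.
(* Modulo m^2, coefficients of generators of m may be replaced by their residues. For products of
   two generators the same replacement is exact, by m^3 = 0. *)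
have [e _ de] : exists2 e, (e <= #|'I_n|)%N & @kdim k R iota R^o (mx0 res) (mx02 res) e.
  apply: (kspan_kdim km k2 mg) => x /mE /gP [c ->].
  exists (fun i => res (c 0 i)); rewrite -sumrB; apply: (ksub_sum k2) => i _.
  rewrite -mulrBl; apply: mx02_mul => //; exact: mx0_res.
have [s _ ds] : exists2 s, (s <= #|{: 'I_n * 'I_n}|)%N & @kdim k R iota R^o (mx02 res) [set 0] s.
  pose gg (t : 'I_n * 'I_n) : R^o := g t.1 * g t.2.
  apply: (kspan_kdim (g := gg) k2 k0) => [t|x [l [a [c [ac ->]]]]]; first exact: mx02_mul.
  have span2 x' y' : mx0 res x' -> mx0 res y' -> exists c : 'I_n * 'I_n -> k,
      x' * y' = \sum_t iota (c t) * gg t.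
    move=> /mE /gP [u ->] /mE /gP [v ->].
    exists (fun t => res (u 0 t.1) * res (v 0 t.2)).
    rewrite -(pair_bigA _ (fun i j => iota (res (u 0 i) * res (v 0 j)) * (g i * g j))) /=.
    rewrite mulr_suml; apply: eq_bigr => i _; rewrite mulr_sumr; apply: eq_bigr => j _.
    rewrite rmorphM mulrACA; apply/eqP; rewrite -subr_eq0 -mulrBl; apply/eqP.
    rewrite mulrA; apply: m3 => //.
    rewrite /mx0 /= rmorphB !rmorphM /= !resK subrr //.
  have /choice [w wP] : forall i, exists d : 'I_n * 'I_n -> k, a i * c i = \sum_t iota (d t) * gg t.
    by move=> i; case: (ac i) => ma mc; apply: span2.
  exists (fun t => \sum_i w i t).
  rewrite /= (eq_bigr _ (fun i _ => wP i)) exchange_big -sumrB big1 // => t _.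
  by rewrite rmorph_sum scaler_suml -sumrB big1 // => i _; rewrite subrr.
have d1 : @kdim k R iota R^o setT (mx02 res) (e + 1).
  exact: (kdim_add (ksubT iota R^o) km k2 (@mx02_sub _ _ res) (@subsetT _ _) de (kdim_res resK)).
have dR : @kdim k R iota R^o setT [set 0] (s + (e + 1)).
  apply: (kdim_add (ksubT iota R^o) k2 k0 _ (@subsetT _ _) ds d1) => _ ->.
  exact: mx020.
(* A homomorphism from R/m is determined by its value at 1, an arbitrary socle element; so r is the
   dimension of the socle. *)
pose ev (phi : {linear {ideal_quot m} -> R^o}) : R^o := phi (\pi_({ideal_quot m}) 1).
have evK (phi : {linear {ideal_quot m} -> R^o}) x : phi x = repr x * ev phi.
  by rewrite -[LHS]/(phi x) -{1}[x]reprK -[repr x]mulr1 -quot_scale linearZ mulr1.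
have dsoc : @kdim k R iota R^o (socle res) [set 0] r.
  have lev : klinear iota ev by move=> c x y.
  apply: (proj1 (kdim_map lev k0 _ _ _ (ksubT iota _)) hr).
  - move=> phi _ y my; rewrite mulrC -[y * _]/(y *: (ev phi : R^o)) -linearZ.
    by rewrite quot_annihilated ?linear0 //; apply/mE.
  - move=> a sa.
    have la : linear ((fun x : {ideal_quot m} => repr x * a) : {ideal_quot m} -> R^o).
      move=> c x y; apply/eqP; rewrite -subr_eq0; apply/eqP.
      rewrite -[c *: (_ * a)]/(c * (repr x * a)) mulrA -mulrDl -mulrBl mulrC; apply: sa.
      apply/mE/quot_eq0; rewrite rmorphB rmorphD rmorphM /= !reprK subrr //.
    exists (linear_of la : {linear {ideal_quot m} -> R^o}) => //; rewrite /ev /= /linear_of; apply/eqP.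
    rewrite -subr_eq0 -{2}[a]mul1r -mulrBl mulrC; apply/eqP; apply: sa.
    by apply/mE/quot_eq0; rewrite rmorphB /= reprK subrr.
  - move=> phi _; split=> [->|e0] //; apply: linear_ext => x.
    by rewrite evK e0 mulr0.
have nhom : ~ hom_extend res.
  by move=> /(self_injective_gorenstein m3 (res_unit resK m3)).
have [M [fgM nfM [_ extM _]]] := hex.
have [F [acF minF F0]] := nonfree_complex resK m3 dR fgM nfM extM.
have [socE eE] := embedding_dimension resK m3 m2n0 nhom de dsoc acF minF F0.
rewrite eE in de; have dr := dsoc; rewrite socE in dr.
have r0 : (0 < r)%N := ltnW (type_gt1 resK m3 de socE m2n0 dr nhom).
have [V [kV Vm Vdec dV V0]] := linear_complement de.
exists (short_grading iota res V); split.
  split=> //.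
  - exact: (short_homogeneous resK m3 kV Vm Vdec dV V0).
  - by move=> [|[|[|i]]].
  - split; first exact: (short_hilbert resK dr dV).
    by rewrite pow2 -socE mmE.
have [koz bass] := residue_field_series resK m3 nhom socE r0 de dr kV Vm Vdec dV V0 mE acF minF F0.
split=> //; split=> // N fgN gN.
exact: (G_dim_zero_graded resK m3 m2n0 nhom socE dR de dsoc kV Vm Vdec V0 fgN gN).
Qed.
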